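(* Let $S$ be a set of $n$ points in the plane, $P$ a simple polygon with $m$ vertices, and $r$ a point in the plane. The Fixed MCR problem, namely computing an angle $\theta\in[0,2\pi)$ such that, after rotating $P$ clockwise around $r$ by $\theta$, the number of points of $S$ contained in $P$ is maximized, can be solved in $O(nm\log(nm))$ time and $O(nm)$ space.
   Context: A simple polygon $P$ is understood as the closed planar region bounded by it. Time and space are worst-case in the usual real-RAM model of computational geometry (exact real arithmetic and elementary geometric operations at unit cost). *)

(* Defs.v *)
From mathcomp Require Import all_boot all_order all_algebra.
From mathcomp Require Import all_classical all_reals all_analysis.

Set Implicit Arguments.
Unset Strict Implicit.
Unset Printing Implicit Defensive.

Import Order.TTheory GRing.Theory Num.Theory numFieldNormedType.Exports.

Local Open Scope classical_set_scope.
Local Open Scope ring_scope.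

(** * Polygons and the Fixed MCR problem *)

Section Geometry.
Variable R : realType.
Implicit Types (x r : R * R) (theta : R).

Definition edge_pt m (P : m.-tuple (R * R)) (i : 'I_m) (t : R) : R * R :=
  tnth P i + t *: (tnth P (ordS i) - tnth P i).

Definition boundary m (P : m.-tuple (R * R)) : set (R * R) :=
  [set x | exists i, exists2 t, 0 <= t <= 1 & x = edge_pt P i t].

(* The closed polygonal curve through the vertices, in the order of the tuple,
   is an injective image of a circle.  Either orientation is allowed, and so
   are vertices with a straight angle. *)
Definition simple_polygon m (P : m.-tuple (R * R)) : Prop :=
  forall i j s t, 0 <= s < 1 -> 0 <= t < 1 ->
    edge_pt P i s = edge_pt P j t -> i = j /\ s = t.

(* The closed region bounded by the curve: the curve itself, together with the
   bounded connected components of its complement. *)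
Definition region m (P : m.-tuple (R * R)) : set (R * R) :=
  boundary P `|`
  [set x | (~` boundary P) x /\
           bounded_set (connected_component (~` boundary P) x)].

Definition rot_cw r theta x : R * R :=
  (r.1 + cos theta * (x.1 - r.1) + sin theta * (x.2 - r.2),
   r.2 - sin theta * (x.1 - r.1) + cos theta * (x.2 - r.2)).

Definition covered n m (S : n.-tuple (R * R)) (P : m.-tuple (R * R)) r theta
    : nat :=
  count (mem (rot_cw r theta @` region P)) S.

Definition fixed_mcr_solution n m (S : n.-tuple (R * R))
    (P : m.-tuple (R * R)) r theta : Prop :=
  0 <= theta < 2 * pi /\
  forall phi, 0 <= phi < 2 * pi ->
    (covered S P r phi <= covered S P r theta)%N.

End Geometry.

(** * The real RAM *)

Local Open Scope nat_scope.

(* Structured programs over a machine with two random-access memory banks, one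
   of integers and one of reals, and finitely many integer and real registers
   (those named in the program).  Arithmetic expressions read registers only;
   the memory banks are accessed by explicit loads and stores, addressed by
   integers.  There is no conversion from reals to integers (no rounding), so
   reals influence the integers through comparisons only. *)

Inductive iexp : Type :=
| IConst of nat
| IReg of nat
| IAdd of iexp & iexp
| ISub of iexp & iexp
| IMul of iexp & iexp
| IDiv of iexp & iexp.

(* Square roots and arc cosines are what it takes to intersect a circle with a
   line and to produce an angle as output.  Out of their domain, the partial
   operations take the conventional values of the library ([x / 0 = 0], etc). *)
Inductive rexp : Type :=
| ROfInt of iexp
| RPi
| RReg of nat
| RAdd of rexp & rexp
| RSub of rexp & rexp
| RMul of rexp & rexp
| RDiv of rexp & rexp
| RSqrt of rexp
| RAcos of rexp.

Inductive test : Type :=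
| TILt of iexp & iexp
| TRLt of rexp & rexp
| TNot of test
| TAnd of test & test.

Inductive cmd : Type :=
| Skip
| Seq of cmd & cmd
| ISet of nat & iexp          (* integer register := expression *)
| RSet of nat & rexp          (* real register := expression *)
| ILoad of nat & iexp         (* integer register := integer cell *)
| RLoad of nat & iexp         (* real register := real cell *)
| IStore of iexp & iexp       (* integer cell := expression *)
| RStore of iexp & rexp       (* real cell := expression *)
| If of test & cmd & cmd
| While of test & cmd.

Fixpoint icost (e : iexp) : nat :=
  match e with
  | IConst _ | IReg _ => 1
  | IAdd a b | ISub a b | IMul a b | IDiv a b => (icost a + icost b).+1
  end.

Fixpoint rcost (e : rexp) : nat :=
  match e with
  | ROfInt a => (icost a).+1
  | RPi | RReg _ => 1
  | RAdd a b | RSub a b | RMul a b | RDiv a b => (rcost a + rcost b).+1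
  | RSqrt a | RAcos a => (rcost a).+1
  end.

Fixpoint tcost (b : test) : nat :=
  match b with
  | TILt a b => (icost a + icost b).+1
  | TRLt a b => (rcost a + rcost b).+1
  | TNot a => (tcost a).+1
  | TAnd a b => (tcost a + tcost b).+1
  end.

Section Machine.
Variable R : realType.

Record state := State {
  ireg : nat -> nat;
  rreg : nat -> R;
  imem : nat -> nat;
  rmem : nat -> R }.

Definition set_ireg (s : state) x v :=
  State [eta ireg s with x |-> v] (rreg s) (imem s) (rmem s).
Definition set_rreg (s : state) x v :=
  State (ireg s) [eta rreg s with x |-> v] (imem s) (rmem s).
Definition set_imem (s : state) a v :=
  State (ireg s) (rreg s) [eta imem s with a |-> v] (rmem s).
Definition set_rmem (s : state) a v :=
  State (ireg s) (rreg s) (imem s) [eta rmem s with a |-> v].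

Fixpoint ieval (s : state) (e : iexp) : nat :=
  match e with
  | IConst k => k
  | IReg x => ireg s x
  | IAdd a b => ieval s a + ieval s b
  | ISub a b => ieval s a - ieval s b
  | IMul a b => ieval s a * ieval s b
  | IDiv a b => ieval s a %/ ieval s b
  end.

Fixpoint reval (s : state) (e : rexp) : R :=
  match e with
  | ROfInt a => (ieval s a)%:R%R
  | RPi => pi
  | RReg x => rreg s x
  | RAdd a b => (reval s a + reval s b)%R
  | RSub a b => (reval s a - reval s b)%R
  | RMul a b => (reval s a * reval s b)%R
  | RDiv a b => (reval s a / reval s b)%R
  | RSqrt a => Num.sqrt (reval s a)
  | RAcos a => acos (reval s a)
  end.

Fixpoint teval (s : state) (b : test) : bool :=
  match b with
  | TILt a b => ieval s a < ieval s b
  | TRLt a b => (reval s a < reval s b)%R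
  | TNot a => ~~ teval s a
  | TAnd a b => teval s a && teval s b
  end.

(* [exec M c s t s'] : on a machine with [M] integer cells and [M] real cells,
   [c] started in [s] halts in [s'] after [t] unit-cost operations.  An access
   to a cell beyond the first [M] blocks the machine.  So does the assignment
   of an integer not smaller than [M]: integer words are just long enough to
   address the memory, which keeps unit-cost integer arithmetic honest. *)
Inductive exec (M : nat) : cmd -> state -> nat -> state -> Prop :=
| ExSkip s :
    exec M Skip s 1 s
| ExSeq c1 c2 s1 s2 s3 t1 t2 :
    exec M c1 s1 t1 s2 -> exec M c2 s2 t2 s3 ->
    exec M (Seq c1 c2) s1 (t1 + t2) s3
| ExISet x e s :
    ieval s e < M ->
    exec M (ISet x e) s (icost e).+1 (set_ireg s x (ieval s e))
| ExRSet x e s :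
    exec M (RSet x e) s (rcost e).+1 (set_rreg s x (reval s e))
| ExILoad x a s :
    ieval s a < M ->
    exec M (ILoad x a) s (icost a).+1 (set_ireg s x (imem s (ieval s a)))
| ExRLoad x a s :
    ieval s a < M ->
    exec M (RLoad x a) s (icost a).+1 (set_rreg s x (rmem s (ieval s a)))
| ExIStore a e s :
    ieval s a < M -> ieval s e < M ->
    exec M (IStore a e) s (icost a + icost e).+1
      (set_imem s (ieval s a) (ieval s e))
| ExRStore a e s :
    ieval s a < M ->
    exec M (RStore a e) s (icost a + rcost e).+1
      (set_rmem s (ieval s a) (reval s e))
| ExIfTrue b c1 c2 s t s' :
    teval s b -> exec M c1 s t s' ->
    exec M (If b c1 c2) s (tcost b + t).+1 s'
| ExIfFalse b c1 c2 s t s' :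
    ~~ teval s b -> exec M c2 s t s' ->
    exec M (If b c1 c2) s (tcost b + t).+1 s'
| ExWhileDone b c s :
    ~~ teval s b ->
    exec M (While b c) s (tcost b).+1 s
| ExWhileStep b c s1 s2 s3 t1 t2 :
    teval s1 b -> exec M c s1 t1 s2 -> exec M (While b c) s2 t2 s3 ->
    exec M (While b c) s1 (tcost b + t1 + t2).+1 s3.

(* A program has at most one terminating run from a given state, so asserting
   the existence of a run of length [t] does determine the running time. *)
Lemma exec_det M c s t1 s1 t2 s2 :
  exec M c s t1 s1 -> exec M c s t2 s2 -> t1 = t2 /\ s1 = s2.
Proof.
move=> h; elim: h t2 s2 => {c s t1 s1}; intros;
  match goal with H : exec _ _ _ ?t ?s |- _ = ?t /\ _ => inversion H; subst end;
  try by [];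
  repeat match goal with
  | IH : forall t s, exec _ ?c ?s0 t s -> _, H : exec _ ?c ?s0 _ _ |- _ =>
      case: (IH _ _ H) => ? ?; subst; clear IH H
  end; try by [];
  by match goal with
  | H : is_true (teval ?s ?b), H' : is_true (~~ teval ?s ?b) |- _ =>
      rewrite H in H'
  end.
Qed.

(* The sizes are in integer registers 0 and 1, and the coordinates of the
   points of [S], of the vertices of [P] and of [r], in this order, in the
   first real cells.  The rest of the initial state is arbitrary. *)
Definition fixed_mcr_input n m (S : n.-tuple (R * R)) (P : m.-tuple (R * R))
    (r : R * R) (s : state) : Prop :=
  let pts := S ++ P ++ [:: r] in
  [/\ ireg s 0 = n, ireg s 1 = m &
      forall k, k < size pts ->
        rmem s k.*2 = (nth 0%R pts k).1 /\ rmem s k.*2.+1 = (nth 0%R pts k).2].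

Definition output (s : state) : R := rreg s 0.

End Machine.

(* Main.v *)
(* Divide by the vector from r to a point x of S, regarded as a complex number:
   the rotated polygon contains x exactly when the point of angle theta of the
   unit circle lies in the transformed polygon.  A point off a simple closed
   polygon is in the bounded region iff a ray from it crosses the polygon an odd
   number of times: parity is locally constant off the boundary, and near every
   boundary point the complement has only two sides, of opposite parities, so
   that two points of equal parity are in the same component.

   Take the ray pointing away from the origin.  An edge is crossed by the ray
   from the unit circle iff it is crossed by the ray from the origin but its part
   inside the unit disc is not.  Hence, as theta grows, an edge changes the
   parity at no more than four angles, those of its endpoints and of the
   endpoints of its part in the disc, and the point meets the edge at no more
   than two angles.  This gives 6nm events; the program computes them all, keeps
   them in a tournament tree, and sweeps theta from 0 to 2 pi, maintaining the
   number of covered points at a cost of O(log(nm)) per event. *)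

Require Import Defs.
From mathcomp Require Import all_boot all_order all_algebra.
From mathcomp Require Import all_classical all_reals all_analysis.
From mathcomp Require Import ring lra zify.

Set Implicit Arguments.
Unset Strict Implicit.
Unset Printing Implicit Defensive.

Import Order.TTheory GRing.Theory Num.Theory numFieldNormedType.Exports.

Local Open Scope classical_set_scope.
Local Open Scope ring_scope.

(** * Crossings of a ray with a segment *)

(** Nothing is assumed to be in general position, and several events may share an angle; the
    conventions are chosen for that. Crossings are half-open, so that an event counts as past from
    its own angle on, and the initial parities are those just before angle 0, to be toggled by the
    events at angle 0 itself. A count is meaningful only after all the events of one angle, hence it
    competes for the maximum only when time strictly advances. A point that merely touches the
    polygon at an isolated angle may keep its parity, so contact with the boundary is recorded apart
    from parity. The time 2 pi, just outside the admissible angles, stands for an absent or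
    processed event, and the sweep ends when the least remaining time is 2 pi. Points of [S] equal
    to [r] do not move and get no events. The parity criterion is proved for every nonzero direction
    of the ray, because the direction used later turns with theta and differs from point to
    point. *)

Lemma mul_gt0_signs (R : realFieldType) (a b : R) : 0 < a * b -> (0 < a) = (0 < b).
Proof. by have [?|?] := ltP 0 a; have [?|?] := ltP 0 b; nra. Qed.

Lemma pos_stable (R : realFieldType) (a a' : R) :
  (0 < a -> 0 < a') -> (a < 0 -> a' < 0) -> a != 0 -> (0 < a') = (0 < a).
Proof. by move=> pos neg; have [/neg/lt_gtF //|/pos //|] := ltgtP a 0. Qed.

(** The case of an edge not collinear with the query point: [a], [b] are the sides of its ends
    relative to the ray, [p], [q] their positions along it, and primes refer to a nearby query
    point. An end with [a = 0] may switch sides, but the last hypothesis then gives [p] the sign of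
    [b], so the switch changes the crossing exactly when that end lies ahead on the ray; similarly
    for [b = 0]. *)
Lemma hits_signs_pos (R : realFieldType) (uu a' b' a b D p q : R) : 0 < uu -> 0 < D ->
  (a != 0 -> (0 < a') = (0 < a)) -> (b != 0 -> (0 < b') = (0 < b)) -> uu * D = p * b - a * q ->
  (a' <= 0) && (0 < b') = (a <= 0) && (0 < b)
  (+) ([&& a == 0, 0 < p & (0 < a') != (0 < a)] (+) [&& b == 0, 0 < q & (0 < b') != (0 < b)]).
Proof.
move=> uu0 D0; have := mulr_gt0 uu0 D0; rewrite !leNgt.
have [->|a0] := eqVneq a 0; have [->|b0] := eqVneq b 0 => uD sa sb; rewrite ?ltxx /=.
- by rewrite mulr0 mul0r subrr => e; rewrite e ltxx in uD.
- rewrite sb // mul0r subr0 => e; rewrite e in uD; have -> : (0 < p) = (0 < b).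
    by have [?|?|be] := ltgtP b 0; [apply/negbTE; rewrite -leNgt; nra|nra|rewrite be eqxx in b0].
  by case: (0 < a'); case: (0 < b).
- rewrite sa // mulr0 sub0r => e; rewrite e in uD; have -> : (0 < q) = ~~ (0 < a).
    by have [?|?|ae] := ltgtP a 0; [nra|apply/negbTE; rewrite -leNgt; nra|rewrite ae eqxx in a0].
  by case: (0 < a); case: (0 < b').
by rewrite sa // sb //; case: (0 < a); case: (0 < b).
Qed.

(** With both ends ahead or both behind, the sides of the ends alone decide the crossing, whatever
    the sign of [D]. This covers an edge that runs along the ray. *)
Lemma hits_signs_zero (R : realFieldType) (uu a b D p q : R) : 0 < uu -> 0 < p * q -> uu * D = p * b - a * q ->
  [&& 0 < D, a <= 0 & 0 < b] || [&& D < 0, b <= 0 & 0 < a] = (0 < p) && ((0 < a) (+) (0 < b)).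
Proof.
move=> uu0 pq e; have [p0|p0] := ltP 0 p.
  have q0 : 0 < q by nra.
  have [a0|a0] := leP a 0; have [b0|b0] := leP b 0; rewrite ?andbF //= ?andbT ?orbF; nra.
have q0 : q < 0 by nra.
by apply/negbTE; rewrite negb_or; apply/andP; split; apply/negP => /and3P[? ? ?]; nra.
Qed.

(** [D = 0] puts the query point on the line of the edge. The last hypothesis lists what remains
    possible off the edge itself: both ends strictly on one side of the line of the ray, or both on
    that line and on the same side of the query point. *)
Lemma hits_signs (R : realFieldType) (uu a' b' D' p' q' a b D p q : R) : 0 < uu ->
  (0 < a -> 0 < a') -> (a < 0 -> a' < 0) -> (0 < b -> 0 < b') -> (b < 0 -> b' < 0) ->
  (0 < D -> 0 < D') -> (D < 0 -> D' < 0) -> (0 < p -> 0 < p') -> (p < 0 -> p' < 0) ->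
  (0 < q -> 0 < q') -> (q < 0 -> q' < 0) ->
  uu * D = p * b - a * q -> uu * D' = p' * b' - a' * q' ->
  (D = 0 -> 0 < a * b \/ [/\ a = 0, b = 0 & 0 < p * q]) ->
  [&& 0 < D', a' <= 0 & 0 < b'] || [&& D' < 0, b' <= 0 & 0 < a'] =
  [&& 0 < D, a <= 0 & 0 < b] || [&& D < 0, b <= 0 & 0 < a]
  (+) ([&& a == 0, 0 < p & (0 < a') != (0 < a)]
       (+) [&& b == 0, 0 < q & (0 < b') != (0 < b)]).
Proof.
move=> uu0 sa1 sa2 sb1 sb2 sD1 sD2 sp1 sp2 sq1 sq2 L L' N.
have sa := pos_stable sa1 sa2; have sb := pos_stable sb1 sb2; move: {sa1 sa2 sb1 sb2} sa sb => sa sb.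
have [D0|D0|D0] := ltgtP D 0.
- have D'0 := sD2 D0; rewrite (lt_gtF D'0) D'0 /= [X in _ (+) X]addbC.
  apply: (@hits_signs_pos _ uu _ _ _ _ (- D)) => //; first by rewrite oppr_gt0.
  by rewrite mulrN L; ring.
- have D'0 := sD1 D0; rewrite (lt_gtF D'0) D'0 /= !orbF.
  exact: (@hits_signs_pos _ uu _ _ _ _ D).
have [ab|[a0 b0 pq]] := N D0.
  have a0 : a != 0 by apply: contraTneq ab => ->; rewrite mul0r ltxx.
  have b0 : b != 0 by apply: contraTneq ab => ->; rewrite mulr0 ltxx.
  rewrite (negbTE a0) (negbTE b0) !leNgt sa // sb // (mul_gt0_signs ab) /=.
  by case: (0 < b); rewrite ?andbF.
have pq' : 0 < p' * q' by have [/[dup] /sp1 ? ?|p0] := ltP 0 p; [have := sq1|have := sq2]; nra.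
rewrite (hits_signs_zero uu0 pq' L') a0 b0 !eqxx ltxx /=.
have -> : (0 < p') = (0 < p).
  by apply: pos_stable => //; apply: contraTneq pq => ->; rewrite mul0r ltxx.
rewrite -(mul_gt0_signs pq); clear; by case: (0 < p); case: (0 < a'); case: (0 < b').
Qed.

Section Plane.
Variable R : realType.
Implicit Types (u v a b x y : R * R) (t : R).

Definition cross a b : R := a.1 * b.2 - a.2 * b.1.
Definition dot a b : R := a.1 * b.1 + a.2 * b.2.

(* The ray from the origin in direction [u] crosses the segment from [a] to
   [b].  An endpoint on the line of [u] counts as lying to its right, so that
   crossings at a common endpoint of two segments have the correct parity. *)
Definition hits u a b : bool :=
  [&& 0 < cross a b, cross u a <= 0 & 0 < cross u b] ||
  [&& cross a b < 0, cross u b <= 0 & 0 < cross u a].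

Lemma plane_eq (x y : R * R) : x.1 = y.1 -> x.2 = y.2 -> x = y.
Proof. by case: x y => [? ?] [? ?] /= -> ->. Qed.

Lemma dot_gt0 u : u != 0 -> 0 < dot u u.
Proof.
case: u => p q; rewrite /dot /= => h.
have [p0|p0] := eqVneq p 0; have [q0|q0] := eqVneq q 0; try nra.
by subst; rewrite -[(0, 0)]/(0 : R * R) eqxx in h.
Qed.

Lemma lagrange u a b : dot u u * cross a b = dot u a * cross u b - cross u a * dot u b.
Proof. by rewrite /dot /cross; ring. Qed.

Lemma dot_cross_eq u a : u != 0 ->
  a = (dot u u)^-1 *: (dot u a *: u + cross u a *: (- u.2, u.1)).
Proof.
move=> u0; have h := dot_gt0 u0; have h' : dot u u != 0 by rewrite gt_eqF.
apply: plane_eq; rewrite /= /GRing.scale /=; apply: (mulfI h'); rewrite mulVKf //;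
  rewrite /dot /cross; ring.
Qed.

(** [V] lies on the ray from [x], and falls to its left when seen from [y]. No edge is mentioned, so
    the value is the same for the two edges that meet at [V]. *)
Definition dl u (V x y : R * R) : bool :=
  [&& cross u (V - x) == 0, 0 < dot u (V - x) &
      (0 < cross u (V - y)) != (0 < cross u (V - x))].

Definition sgn_stable (p q : R) := (0 < p -> 0 < q) /\ (p < 0 -> q < 0).

Lemma near_sgn (f : R * R -> R) x : {for x, continuous f} ->
  \forall y \near x, sgn_stable (f x) (f y).
Proof.
move=> cf; have [h|h|h] := ltrgtP 0 (f x).
- have : \forall y \near x, 0 < f y by have H := @cvgr_gt R _ (nbhs x) _ f (f x) cf 0 h; exact: H.
  by apply: filterS => y h'; split=> // /lt_trans - /(_ _ h); rewrite ltxx.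
- have : \forall y \near x, f y < 0 by have H := @cvgr_lt R _ (nbhs x) _ f (f x) cf 0 h; exact: H.
  by apply: filterS => y h'; split=> // /lt_trans - /(_ _ h); rewrite ltxx.
- by near=> y; rewrite /sgn_stable -h ltxx.
Unshelve. all: by end_near.
Qed.

Lemma cont_fst (f : R * R -> R * R) x :
  {for x, continuous f} -> {for x, continuous (fun y => (f y).1)}.
Proof. by move=> cf; have H := @cvg_comp _ _ _ f fst _ _ _ cf; apply: H; apply: cvg_fst. Qed.

Lemma cont_snd (f : R * R -> R * R) x :
  {for x, continuous f} -> {for x, continuous (fun y => (f y).2)}.
Proof. by move=> cf; have H := @cvg_comp _ _ _ f snd _ _ _ cf; apply: H; apply: cvg_snd. Qed.

Lemma cont_cross (f g : R * R -> R * R) x :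
  {for x, continuous f} -> {for x, continuous g} -> {for x, continuous (fun y => cross (f y) (g y))}.
Proof.
move=> cf cg; rewrite /cross.
by apply: cvgB; apply: cvgM; [exact: cont_fst|exact: cont_snd|exact: cont_snd|exact: cont_fst].
Qed.

Lemma cont_dot (f g : R * R -> R * R) x :
  {for x, continuous f} -> {for x, continuous g} -> {for x, continuous (fun y => dot (f y) (g y))}.
Proof.
move=> cf cg; rewrite /dot.
by apply: cvgD; apply: cvgM; [exact: cont_fst|exact: cont_fst|exact: cont_snd|exact: cont_snd].
Qed.

Lemma cont_subl A x : {for x, continuous (fun y : R * R => A - y)}.
Proof. by apply: cvgB; [exact: cvg_cst|exact: cvg_id]. Qed.

Lemma frac01 (p q : R) : p != q -> p * q <= 0 -> 0 <= p / (p - q) <= 1.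
Proof.
move=> pq h; have [l|l] := ltP p q.
  have s : 0 < q - p by lra.
  have q0 : 0 <= q by rewrite leNgt; apply/negP => q0; nra.
  have p0 : p <= 0 by rewrite leNgt; apply/negP => p0; nra.
  rewrite -[p - q]opprB invrN mulrN -mulNr; apply/andP; split; [apply: divr_ge0; lra|rewrite ler_pdivrMr //; lra].
have s : 0 < p - q by rewrite subr_gt0 lt_neqAle eq_sym pq.
have q0 : q <= 0 by rewrite leNgt; apply/negP => q0; nra.
have p0 : 0 <= p by rewrite leNgt; apply/negP => p0; nra.
by apply/andP; split; [apply: divr_ge0; lra|rewrite ler_pdivrMr //; lra].
Qed.

(** If both alternatives failed, the segment would meet the line of [u]; lying on a line through the
    origin, it would meet it at the origin, or run along [u] and contain the origin. *)
Lemma nondeg u (A B : R * R) : u != 0 ->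
  (forall t, 0 <= t <= 1 -> A + t *: (B - A) <> 0) -> cross A B = 0 ->
  0 < cross u A * cross u B \/
  [/\ cross u A = 0, cross u B = 0 & 0 < dot u A * dot u B].
Proof.
move=> u0 h D0; have uu := dot_gt0 u0.
have L := lagrange u A B; rewrite D0 mulr0 in L.
have [ab|ab] := eqVneq (cross u A) (cross u B).
  have [a0|a0] := eqVneq (cross u A) 0; last first.
    by left; rewrite -ab -expr2 exprn_even_gt0.
  right; split; rewrite -?ab //.
  rewrite ltNge; apply/negP => dd.
  have eA := dot_cross_eq A u0; have eB := dot_cross_eq B u0.
  rewrite -ab a0 scale0r addr0 in eB; rewrite a0 scale0r addr0 in eA.
  have [dab|dab] := eqVneq (dot u A) (dot u B).
    have dA : dot u A = 0 by nra.
    by apply: (h 0); rewrite ?lexx ?ler01 // scale0r addr0 eA dA scale0r scaler0.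
  have dab' : dot u A - dot u B != 0 by rewrite subr_eq0.
  apply: (h (dot u A / (dot u A - dot u B))).
    exact: frac01.
  move: eA eB dab'; set p := dot u A; set q := dot u B => -> -> pq; apply: plane_eq;
    rewrite /= /GRing.scale /=; field; rewrite pq gt_eqF //.
left; rewrite ltNge; apply/negP => aa.
have ab' : cross u A - cross u B != 0 by rewrite subr_eq0.
apply: (h (cross u A / (cross u A - cross u B))).
  exact: frac01.
apply: (scalerI ab'); rewrite scaler0 scalerDr scalerA mulrC divfK //.
move: D0; rewrite /cross => D0.
apply: plane_eq; rewrite /= /GRing.scale /=.
- transitivity (- u.1 * (A.1 * B.2 - A.2 * B.1)); [by ring|by rewrite D0 mulr0].
- transitivity (- u.2 * (A.1 * B.2 - A.2 * B.1)); [by ring|by rewrite D0 mulr0].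
Qed.

(** The quantities in [hits_signs] are continuous in the query point, so the nonzero ones keep their
    signs nearby. *)
Lemma hits_near u (A B : R * R) x : u != 0 ->
  (forall t, 0 <= t <= 1 -> x <> A + t *: (B - A)) ->
  \forall y \near x,
    hits u (A - y) (B - y) = hits u (A - x) (B - x) (+) (dl u A x y (+) dl u B x y).
Proof.
move=> u0 hx.
have cstu : {for x, continuous (fun _ : R * R => u)} by exact: cvg_cst.
near=> y.
have uu := dot_gt0 u0.
have sa : sgn_stable (cross u (A - x)) (cross u (A - y)).
  by near: y; apply: near_sgn; apply: cont_cross => //; exact: cont_subl.
have sb : sgn_stable (cross u (B - x)) (cross u (B - y)).
  by near: y; apply: near_sgn; apply: cont_cross => //; exact: cont_subl.
have sD : sgn_stable (cross (A - x) (B - x)) (cross (A - y) (B - y)).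
  by near: y; apply: (@near_sgn (fun y => cross (A - y) (B - y)));
     apply: cont_cross => //; exact: cont_subl.
have sda : sgn_stable (dot u (A - x)) (dot u (A - y)).
  by near: y; apply: near_sgn; apply: cont_dot => //; exact: cont_subl.
have sdb : sgn_stable (dot u (B - x)) (dot u (B - y)).
  by near: y; apply: near_sgn; apply: cont_dot => //; exact: cont_subl.
have L := lagrange u (A - x) (B - x); have L' := lagrange u (A - y) (B - y).
have N : cross (A - x) (B - x) = 0 -> 0 < cross u (A - x) * cross u (B - x) \/
  [/\ cross u (A - x) = 0, cross u (B - x) = 0 & 0 < dot u (A - x) * dot u (B - x)].
  apply: nondeg => // t t01; rewrite opprD addrACA opprK [- x + x]addrC subrr addr0 => /eqP.
  by rewrite addrAC subr_eq0 => /eqP e; apply: (hx t t01).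
case: sa sb sD sda sdb => [? ?] [? ?] [? ?] [? ?] [? ?].
by rewrite /hits /dl; apply: (hits_signs uu) L L' N.
Unshelve. all: by end_near.
Qed.
End Plane.

(** * The region bounded by a simple polygon *)

Section Polygon.
Variable R : realType.
Implicit Types (u v a b x y z : R * R) (s t : R).

Lemma norm_pair x : `|x| = Num.max `|x.1| `|x.2|.
Proof. by []. Qed.

Lemma ballE x (e : R) y : ball x e y <-> `|x - y| < e.
Proof. by rewrite prod_norm_ball. Qed.

Lemma ball_convex x (e : R) y z t : ball x e y -> ball x e z -> 0 <= t <= 1 ->
  ball x e (y + t *: (z - y)).
Proof.
rewrite !ballE => hy hz /andP[t0 t1].
have -> : x - (y + t *: (z - y)) = (1 - t) *: (x - y) + t *: (x - z) :> R * R.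
  by apply: plane_eq; rewrite /= /GRing.scale /=; ring.
apply: (le_lt_trans (ler_normD _ _)); rewrite !normrZ (ger0_norm t0) ger0_norm ?subr_ge0 //.
have [->|t_ne0] := eqVneq t 0; first by rewrite subr0 mul1r mul0r addr0.
have tp : 0 < t by rewrite lt_neqAle eq_sym t_ne0.
by move: (`|x - y|) (`|x - z|) hy hz => p q hy hz; nra.
Qed.

Lemma continuous_line x v : continuous (fun t : R => x + t *: v : R * R).
Proof.
move=> t; apply: cvgD; first exact: cvg_cst.
by apply: cvgZr_tmp; exact: cvg_id.
Qed.

Definition line_seg x y : set (R * R) := [set x + t *: (y - x) | t in `[0, 1]].

Lemma line_seg_connected x y : connected (line_seg x y).
Proof.
apply: connected_continuous_connected; first exact: segment_connected.
by apply: continuous_subspaceT => t; exact: continuous_line.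
Qed.

Lemma line_seg_closed x y : closed (line_seg x y).
Proof.
apply: compact_closed; first exact: norm_hausdorff.
apply: continuous_compact; last exact: segment_compact.
by apply: continuous_subspaceT => t; exact: continuous_line.
Qed.

Lemma line_seg0 x y : line_seg x y x.
Proof. by exists 0; rewrite /= ?in_itv /= ?lexx ?ler01 // scale0r addr0. Qed.

Lemma line_seg1 x y : line_seg x y y.
Proof. by exists 1; rewrite /= ?in_itv /= ?lexx ?ler01 // scale1r addrC subrK. Qed.

Lemma seg_component (U : set (R * R)) x y :
  (forall t, 0 <= t <= 1 -> U (x + t *: (y - x))) -> connected_component U x y.
Proof.
move=> h; apply: (@connected_component_max _ _ (line_seg x y)); last exact: line_seg1.
- exact: line_seg0.
- by move=> _ [t /= t01 <-]; apply: h; rewrite in_itv in t01.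
- exact: line_seg_connected.
Qed.

Variables (m : nat) (P : m.-tuple (R * R)).
Let bd := boundary P.

Definition par u x : bool :=
  \big[addb/false]_(i < m) hits u (tnth P i - x) (tnth P (ordS i) - x).

Lemma boundaryE : bd = \bigcup_(i in setT) line_seg (tnth P i) (tnth P (ordS i)).
Proof.
apply/seteqP; split=> x.
  by case=> i [t t01 ->]; exists i => //; exists t => //=; rewrite in_itv.
by case=> i _ [t /=]; rewrite in_itv /= => t01 <-; exists i; exists t.
Qed.

Lemma boundary_closed : closed bd.
Proof.
rewrite boundaryE; apply: closed_bigcup => [|i _]; last exact: line_seg_closed.
exact: finite_finset.
Qed.

(** Each vertex ends one edge and starts the next, so its correction [dl] occurs twice; reindexing
    by [ordS] makes the two sums cancel modulo 2. *)
Lemma par_near u x : u != 0 -> ~ bd x -> \forall y \near x, par u y = par u x.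
Proof.
move=> u0 hx.
have : \forall y \near x, forall i : 'I_m,
  hits u (tnth P i - y) (tnth P (ordS i) - y) =
  hits u (tnth P i - x) (tnth P (ordS i) - x) (+)
    (dl u (tnth P i) x y (+) dl u (tnth P (ordS i)) x y).
  have H := @filter_forall _ 'I_m _ (nbhs x); apply: H => i; apply: hits_near => // t t01 e.
  by apply: hx; exists i; exists t.
apply: filterS => y h; rewrite /par (eq_bigr _ (fun i _ => h i)) big_split /= big_split /=.
rewrite -(@reindex _ _ _ _ _ (@ordS m) predT (fun i => dl u (tnth P i) x y)) /=.
  by rewrite addbb addbF.
by apply: onW_bij; exact: ordS_bij.
Qed.

(** Each parity class off the boundary is open, hence clopen in a connected set that avoids the
    boundary. *)
Lemma par_component u x y : u != 0 -> connected_component (~` bd) x y -> par u x = par u y.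
Proof.
move=> u0 [C [Cx Cb Cc] Cy].
have opn (b : bool) : open [set z | ~ bd z /\ par u z = b].
  rewrite openE => z [zb zp]; rewrite /interior /=.
  have h1 := par_near u0 zb.
  have h2 : \forall y \near z, ~ bd y.
    by apply: open_nbhs_nbhs; split=> //; apply: closed_openC; exact: boundary_closed.
  by near=> w; split; [near: w|rewrite (near h1)].
suff h : C `&` [set z | ~ bd z /\ par u z = par u x] = C.
  by move: Cy; rewrite -h => -[_ [_ ->]].
apply: Cc.
- by exists x; split=> //; split=> //; apply: Cb.
- by exists [set z | ~ bd z /\ par u z = par u x].
- exists (~` [set z | ~ bd z /\ par u z = ~~ par u x]); first exact: open_closedC.
  apply/seteqP; split=> z [Cz].
    by move=> [zb zp]; split=> // -[_]; rewrite zp; case: (par u x).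
  move=> h; split=> //; split; first exact: Cb.
  by apply: contrapT => zp; apply: h; split; [exact: Cb|move: zp; case: (par u z); case: (par u x)].
Unshelve. all: by end_near.
Qed.

End Polygon.

(** * Parity on the two sides of an edge *)

Section Sides.
Variable R : realType.
Implicit Types (u v w a b x y z : R * R) (s t : R).

(** The query point is close to the point of parameter [s] of the edge; [c] and [g] are the
    components of the edge direction across and along the ray. When [c = 0] the edge is parallel to
    the ray and never crossed: the jump then comes from its end lying ahead, through a [dl] term. *)
Lemma side_signs (uu c g s a' b' D' p' q' : R) : 0 < uu -> 0 < s -> s < 1 ->
  (c = 0 -> g != 0) ->
  (0 < - s * c -> 0 < a') -> (- s * c < 0 -> a' < 0) ->
  (0 < (1 - s) * c -> 0 < b') -> ((1 - s) * c < 0 -> b' < 0) ->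
  uu * D' = p' * b' - a' * q' -> b' - a' = c -> q' - p' = g -> D' != 0 ->
  [&& 0 < D', a' <= 0 & 0 < b'] || [&& D' < 0, b' <= 0 & 0 < a'] =
  (if c == 0 then 0 < g else c < 0) (+) (0 < D')
  (+) ([&& - s * c == 0, 0 < - s * g & (0 < a') != (0 < - s * c)]
       (+) [&& (1 - s) * c == 0, 0 < (1 - s) * g & (0 < b') != (0 < (1 - s) * c)]).
Proof.
move=> uu0 s0 s1 cg a1 a2 b1 b2 L ba qp D0.
have s1' : 0 < 1 - s by rewrite subr_gt0.
have sc : (- s * c == 0) = (c == 0) by rewrite mulf_eq0 oppr_eq0 (gt_eqF s0).
have s'c : ((1 - s) * c == 0) = (c == 0) by rewrite mulf_eq0 (gt_eqF s1').
rewrite sc s'c.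
have [c0|c0|c0] := ltrgtP c 0.
- have {}a1 : 0 < a' by apply: a1; rewrite mulNr oppr_gt0 pmulr_rlt0.
  have {}b2 : b' < 0 by apply: b2; rewrite pmulr_rlt0.
  by rewrite a1 (ltW b2) (lt_gtF b2) !andbF /= addbF !andbT; case: (ltrgtP D' 0) D0.
- have {}a1 : a' < 0 by apply: a2; rewrite mulNr oppr_lt0 pmulr_rgt0.
  have {}b2 : 0 < b' by apply: b1; rewrite pmulr_rgt0.
  by rewrite (ltW a1) (lt_gtF a1) b2 !andbF /= addbF !andbT orbF.
- rewrite c0 !mulr0 ltxx /= mulNr oppr_gt0 pmulr_rlt0 // pmulr_rgt0 //.
  have {}ba : b' = a' by apply/eqP; rewrite -subr_eq0 ba c0.
  rewrite ba; have g0 := cg c0.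
  have {}L : uu * D' = - (a' * g) by rewrite L -qp ba; ring.
  have -> : [&& 0 < D', a' <= 0 & 0 < a'] || [&& D' < 0, a' <= 0 & 0 < a'] = false.
    by rewrite leNgt andNb !andbF.
  clear - uu0 L g0 D0.
  have Dp : (0 < D') = (a' * g < 0) by rewrite -oppr_gt0 -L pmulr_rgt0.
  rewrite Dp; have [g1|g1|g1] := ltrgtP g 0; last by rewrite g1 eqxx in g0.
    by rewrite nmulr_llt0 //=; case: (0 < a').
  rewrite pmulr_llt0 //=.
  have a0 : a' != 0 by apply: contraNneq D0 => a0; move/eqP: L; rewrite a0 mul0r oppr0 mulf_eq0 (gt_eqF uu0).
  by case: (ltrgtP a' 0) a0.
Qed.

Variables (m : nat) (P : m.-tuple (R * R)).
Let bd := boundary P.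
Hypothesis simple : simple_polygon P.

Let d i := tnth P (ordS i) - tnth P i.

Lemma edge_dir_neq0 i : d i != 0.
Proof.
apply/negP => /eqP d0.
have h : edge_pt P i 0 = edge_pt P i (1 / 2) by rewrite /edge_pt -/(d i) d0 !scaler0.
have [| |_] := simple _ _ h; [by rewrite lexx ltr01|by lra|by lra].
Qed.

Lemma edge_pt1 i : edge_pt P i 1 = edge_pt P (ordS i) 0.
Proof. by rewrite /edge_pt scale1r scale0r addr0 addrC subrK. Qed.

Definition open_edge i : set (R * R) := [set x | exists2 t, 0 < t < 1 & x = edge_pt P i t].

Lemma open_edge_other i j x : open_edge i x -> j != i ->
  forall t, 0 <= t <= 1 -> x <> edge_pt P j t.
Proof.
move=> [s /andP[s0 s1] ->] ji t /andP[t0 t1] e.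
(* Simplicity is stated on half-open edges, so the parameter 1 is read as the start of the next
   edge. *)
have [t1'|t1'] := eqVneq t 1.
  rewrite t1' edge_pt1 in e.
  have [| |_ e'] := simple _ _ e; [by rewrite ltW|by rewrite lexx ltr01|by rewrite e' ltxx in s0].
have [| |e' _] := simple _ _ e; [by rewrite ltW|by rewrite t0 lt_neqAle t1'|].
by rewrite e' eqxx in ji.
Qed.

Lemma open_edge_boundary i x : open_edge i x -> bd x.
Proof. by move=> [t /andP[t0 t1] ->]; exists i; exists t => //; rewrite !ltW. Qed.

(** Up to the cancelling vertex terms, the other edges stay away from [b] and contribute a constant,
    while edge [i] contributes the sign of [D], that is, the side of its line on which [y] lies.
    Opposite sides thus have opposite parities. *)
Lemma par_jump u i b : u != 0 -> open_edge i b -> exists K : bool,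
  \forall y \near b, let D := cross (tnth P i - y) (tnth P (ordS i) - y) in
    D != 0 -> par P u y = K (+) (0 < D).
Proof.
move=> u0 ib; pose c := cross u (d i); pose g := dot u (d i).
pose K j : bool := if j == i then (if c == 0 then 0 < g else c < 0)
  else hits u (tnth P j - b) (tnth P (ordS j) - b).
exists (\big[addb/false]_j K j).
have near_i : \forall y \near b, cross (tnth P i - y) (tnth P (ordS i) - y) != 0 ->
   hits u (tnth P i - y) (tnth P (ordS i) - y) =
   K i (+) (0 < cross (tnth P i - y) (tnth P (ordS i) - y)) (+)
    (dl u (tnth P i) b y (+) dl u (tnth P (ordS i)) b y).
  have [s /andP[s0 s1] be] := ib.
  have cstu : {for b, continuous (fun _ : R * R => u)} by exact: cvg_cst.
  have e1 f : (f = @cross R \/ f = @dot R) -> f u (tnth P i - b) = - s * f u (d i).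
    by move=> hf; rewrite be /edge_pt; case: hf => ->; clear; rewrite /cross /dot /= /GRing.scale /=; ring.
  have e2 f : (f = @cross R \/ f = @dot R) -> f u (tnth P (ordS i) - b) = (1 - s) * f u (d i).
    by move=> hf; rewrite be /edge_pt; case: hf => ->; clear; rewrite /cross /dot /= /GRing.scale /=; ring.
  have sa := near_sgn (cont_cross cstu (@cont_subl _ (tnth P i) b)).
  have sb := near_sgn (cont_cross cstu (@cont_subl _ (tnth P (ordS i)) b)).
  near=> y.
  have [a1 a2] : sgn_stable (cross u (tnth P i - b)) (cross u (tnth P i - y)) by near: y.
  have [b1 b2] : sgn_stable (cross u (tnth P (ordS i) - b)) (cross u (tnth P (ordS i) - y)) by near: y.
  move: a1 a2 b1 b2; rewrite /hits /dl /K eqxx !e1 ?e2; try by [left|right].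
  move=> a1 a2 b1 b2; apply: (@side_signs _ _ _ s _ _ _ 
    (dot u (tnth P i - y)) (dot u (tnth P (ordS i) - y)) (dot_gt0 u0) s0 s1) => //.
  - move=> c0; apply/negP => /eqP g0; have := dot_cross_eq (d i) u0.
    rewrite -/c c0 -/g g0 !scale0r addr0 scaler0 => /eqP; apply/negP; exact: edge_dir_neq0.
  - exact: lagrange.
  - by rewrite /c /d /cross /=; ring.
  - by rewrite /g /d /dot /=; ring.
have near_j : \forall y \near b, forall j : 'I_m, j != i ->
   hits u (tnth P j - y) (tnth P (ordS j) - y) =
   K j (+) (dl u (tnth P j) b y (+) dl u (tnth P (ordS j)) b y).
  have H := @filter_forall _ 'I_m _ (nbhs b); apply: H => j.
  have [->|ji] := eqVneq j i; first by near=> y.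
  have := @hits_near _ u (tnth P j) (tnth P (ordS j)) b u0 (open_edge_other ib ji).
  by apply: filterS => y h _; rewrite h /K (negbTE ji).
near=> y => /= D0; rewrite /par.
have -> : \big[addb/false]_j hits u (tnth P j - y) (tnth P (ordS j) - y) =
  \big[addb/false]_j (K j (+) ((j == i) && (0 < cross (tnth P i - y) (tnth P (ordS i) - y))) (+)
    (dl u (tnth P j) b y (+) dl u (tnth P (ordS j)) b y)).
  apply: eq_bigr => j _; have [->|ji] /= := eqVneq j i; first by rewrite (near near_i y) //.
  by rewrite addbF (near near_j y).
rewrite !big_split /= -(@reindex _ _ _ _ _ (@ordS m) predT (fun i => dl u (tnth P i) b y)) /=; last first.
  by apply: onW_bij; exact: ordS_bij.
rewrite addbb addbF; congr (_ (+) _).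
rewrite (bigD1 i) //= eqxx /= big1 ?addbF // => j /negbTE ->; done.
Unshelve. all: by end_near.
Qed.

End Sides.

(** * Shape of the boundary near one of its points *)

Section Components.
Variable R : realType.
Implicit Types (u v w a b x y z : R * R) (s t : R).
Variables (m : nat) (P : m.-tuple (R * R)).
Let bd := boundary P.
Hypothesis simple : simple_polygon P.
Let d i := tnth P (ordS i) - tnth P i.

(* [A] is the direction in which one of the two branches of the boundary leaves
   the boundary point [b]. *)
Definition branch b A := exists j : 'I_m, (exists2 c : R, c != 0 & A = c *: d j) /\
  forall h : R, 0 < h < 1 -> open_edge P j (b + h *: A).

Lemma branch_bd b A h : bd b -> branch b A -> 0 <= h < 1 -> bd (b + h *: A).
Proof.
move=> bb [j [_ hA]] /andP[h0 h1]; have [->|hn] := eqVneq h 0; first by rewrite scale0r addr0.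
by apply: open_edge_boundary; apply: hA; rewrite lt_neqAle eq_sym hn h0.
Qed.

Lemma branch_neq0 b A : branch b A -> A != 0.
Proof.
move=> [j [[c c0 ->] _]]; rewrite scaler_eq0 negb_or c0 /=.
exact: (edge_dir_neq0 simple).
Qed.

Lemma ordS_neq (i : 'I_m) : ordS i != i.
Proof.
apply/negP => /eqP h; have := edge_dir_neq0 simple i; rewrite h subrr eqxx //.
Qed.

Lemma boundary_param b : bd b -> exists (i : 'I_m) (t : R), 0 <= t < 1 /\ b = edge_pt P i t.
Proof.
move=> [i [t /andP[t0 t1] ->]]; have [->|tn] := eqVneq t 1.
  by exists (ordS i), 0; rewrite lexx ltr01 edge_pt1.
by exists i, t; rewrite t0 lt_neqAle tn t1.
Qed.

Lemma near_edges (J : pred 'I_m) b :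
  (forall j, ~~ J j -> forall t, 0 <= t <= 1 -> b <> edge_pt P j t) ->
  \forall y \near b, bd y -> exists2 j, J j & exists2 t, 0 <= t <= 1 & y = edge_pt P j t.
Proof.
move=> hJ.
have near_j : \forall y \near b, forall j : 'I_m, ~~ J j ->
    ~ line_seg (tnth P j) (tnth P (ordS j)) y.
  have H := @filter_forall _ 'I_m _ (nbhs b); apply: H => j.
  case Jj : (J j); first by near=> y.
  have : \forall y \near b, (~` line_seg (tnth P j) (tnth P (ordS j))) y.
    apply: open_nbhs_nbhs; split; first by apply: closed_openC; exact: line_seg_closed.
    move=> [t]; rewrite /= in_itv /= => t01 e.
    by apply: (hJ j _ t t01); rewrite ?Jj.
  by apply: filterS => y h _.
apply: filterS near_j => y h [j [t t01 e]].
exists j; last by exists t.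
case Jj : (J j) => //; exfalso; apply: (h j); first by rewrite Jj.
by exists t => //=; rewrite in_itv.
Unshelve. all: by end_near.
Qed.

(** Inside an edge the branches are its two parts; at a vertex they are the incoming edge reversed
    and the outgoing edge. The third clause excludes a spike: branches pointing the same way would
    overlap, against simplicity. *)
Lemma local_model b : bd b -> exists A B : R * R, [/\ branch b A, branch b B,
  forall k, 0 < k -> A <> k *: B &
  \forall y \near b, bd y -> exists2 h, 0 <= h <= 1 & (y = b + h *: A \/ y = b + h *: B)].
Proof.
move=> /boundary_param [i [t [/andP[t0 t1] be]]].
have [tz|tn] := eqVneq t 0; last first.
  have tp : 0 < t by rewrite lt_neqAle eq_sym tn.
  have ib : open_edge P i b by exists t => //; rewrite tp.
  exists (- t *: d i), ((1 - t) *: d i); split.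
  - exists i; split; first by exists (- t); rewrite ?oppr_eq0.
    move=> h /andP[h0 h1]; exists (t - h * t); first by apply/andP; split; nra.
    by rewrite be /edge_pt -/(d i); apply: plane_eq; rewrite /= /GRing.scale /=; ring.
  - exists i; split; first by exists (1 - t); rewrite ?subr_eq0 ?gt_eqF.
    move=> h /andP[h0 h1]; exists (t + h * (1 - t)); first by apply/andP; split; nra.
    by rewrite be /edge_pt -/(d i); apply: plane_eq; rewrite /= /GRing.scale /=; ring.
  - move=> k k0 /eqP; rewrite scalerA -subr_eq0 -scalerBl scaler_eq0 (negbTE (edge_dir_neq0 simple i)) orbF.
    by apply/negP; rewrite lt_eqF //; nra.
  have := @near_edges (pred1 i) b (fun j ji => open_edge_other simple ib ji).
  apply: filterS => y h /h [j /eqP -> [s /andP[s0 s1] ->]].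
  have [st|ts] := leP s t.
    exists ((t - s) / t).
      by apply/andP; split; [apply: divr_ge0; lra|rewrite ler_pdivrMr //; lra].
    left; rewrite be /edge_pt -/(d i); apply: plane_eq; rewrite /= /GRing.scale /=; field; exact: tn.
  have t1' : 0 < 1 - t by lra.
  have t1n : 1 - t != 0 by rewrite gt_eqF.
  exists ((s - t) / (1 - t)).
    by apply/andP; split; [apply: divr_ge0; lra|rewrite ler_pdivrMr //; lra].
  right; rewrite be /edge_pt -/(d i); apply: plane_eq; rewrite /= /GRing.scale /=; field; exact: t1n.
subst t; pose p := ord_pred i; have ip : ordS p = i by exact: ord_predK.
have pi : p != i by rewrite -[X in _ != X]ip eq_sym ordS_neq.
have bA h : b + h *: (- 1 *: d p) = edge_pt P p (1 - h).
  by rewrite be /edge_pt -/(d p) /d ip; apply: plane_eq; rewrite /= /GRing.scale /=; ring.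
have bB h : b + h *: (1 *: d i) = edge_pt P i h.
  by rewrite be /edge_pt -/(d i); apply: plane_eq; rewrite /= /GRing.scale /=; ring.
exists (- 1 *: d p), (1 *: d i); split.
- exists p; split; first by exists (- 1) => //; rewrite oppr_eq0 oner_eq0.
  by move=> h /andP[h0 h1]; exists (1 - h); rewrite ?bA //; apply/andP; split; lra.
- exists i; split; first by exists 1 => //; rewrite oner_eq0.
  by move=> h h01; exists h; rewrite ?bB.
(* For this [h] both [h] and [k * h] are below 1, so a single point lies on both edges at admissible
   parameters. *)
- move=> k k0 e; pose h := (1 + k)^-1 / 2 : R.
  have k1 : 0 < (1 + k)^-1 by rewrite invr_gt0; lra.
  have k1' : (1 + k)^-1 * (1 + k) = 1 by rewrite mulVf // gt_eqF //; lra.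
  have h0 : 0 < h by rewrite /h; lra.
  have h1 : h < 1 by rewrite /h; nra.
  have hk1 : k * h < 1 by rewrite /h; nra.
  have hk0 : 0 < k * h by rewrite mulr_gt0.
  have e1 := bA h; rewrite e scalerA [h * k]mulrC bB in e1.
  have [| | ip' _] := simple _ _ e1; [by rewrite ltW|by rewrite /= subr_ge0 ltW //=; lra|].
  by rewrite ip' eqxx in pi.
have other j : ~~ pred2 p i j -> forall t, 0 <= t <= 1 -> b <> edge_pt P j t.
  rewrite /= negb_or => /andP[jp ji] t /andP[s0 s1] e.
  have [tz|tn] := eqVneq t 1.
    rewrite tz edge_pt1 be in e.
    have [| | ij _] := simple _ _ e; [by rewrite lexx|by rewrite lexx ltr01|].
    by rewrite -ip in ij; rewrite (ordS_inj ij) eqxx in jp.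
  rewrite be in e.
  have [| | ij _] := simple _ _ e; [by rewrite lexx|by rewrite s0 lt_neqAle tn|].
  by rewrite ij eqxx in ji.
have := near_edges other; apply: filterS => y h /h [j /orP[/eqP ->|/eqP ->] [s /andP[s0 s1] ->]].
  exists (1 - s); first by apply/andP; split; lra.
  by left; rewrite bA; congr (edge_pt _ _ _); ring.
by exists s; rewrite ?s0 //; right; rewrite bB.
Qed.

End Components.

(** * The two sectors around a boundary point *)

Section Sectors.
Variable R : realType.
Implicit Types (u v w a b x y z : R * R) (s t : R).
Variables (m : nat) (P : m.-tuple (R * R)).
Let bd := boundary P.
Hypothesis simple : simple_polygon P.
Variable u : R * R.
Hypothesis u0 : u != 0.
Let linked := connected_component (~` bd).

(** Near [b] the complement has two pieces told apart by parity. The second clause ranges over all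
    radii: both parities occur arbitrarily close to [b]. *)
Definition both_sides b (e : R) :=
  (forall y z, ball b e y -> ball b e z -> ~ bd y -> ~ bd z -> par P u y = par P u z -> linked y z) /\
  (forall (e' : R) (p : bool), 0 < e' -> exists y, [/\ ball b e' y, ~ bd y & par P u y = p]).

Lemma cross_aa a : cross a a = 0. Proof. by rewrite /cross; ring. Qed.

Lemma cross0_colinear a v : a != 0 -> cross a v = 0 -> exists s, v = s *: a.
Proof.
move=> a0 h; have aa := dot_gt0 a0; exists (dot a v / dot a a).
rewrite {1}(dot_cross_eq v a0) h scale0r addr0 scalerA; congr (_ *: _).
by rewrite mulrC.
Qed.

Lemma ball_shift b (e : R) v : ball b e (b + v) <-> `|v| < e.
Proof. by rewrite ballE opprD addrA subrr sub0r normrN. Qed.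

(** The branches, long enough to leave the ball, cut it into the sector [W1] from [A]
    counterclockwise to [B], an intersection of two half-planes, and the remaining [W2], a union of
    two. Each is linked, and crossing the branch [A] shows by [par_jump] that their parities differ.
    The sign of [cross A B] makes [W1] the convex sector. *)
Lemma sector b A B (e : R) : bd b -> 0 < e -> branch P b A -> branch P b B ->
  (forall k, 0 < k -> A <> k *: B) -> 0 <= cross A B ->
  (forall y, ball b e y -> bd y -> exists2 h, 0 <= h <= 1 & (y = b + h *: A \/ y = b + h *: B)) ->
  e <= `|A| -> e <= `|B| ->
  both_sides b e.
Proof.
move=> bb e0 bA bB AB cr0 hbd eA eB.
have A0 := branch_neq0 simple bA; have B0 := branch_neq0 simple bB.
have AA := dot_gt0 A0.
have anti : cross A B = 0 -> exists2 k, 0 < k & B = - k *: A.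
  move=> /(cross0_colinear A0) [s hs]; exists (- s); last by rewrite opprK.
  have [s0|s0|s0] := ltrgtP s 0; first by rewrite oppr_gt0.
    exfalso; apply: (AB s^-1); first by rewrite invr_gt0.
    by rewrite hs scalerA mulVf ?scale1r // gt_eqF.
  by move: B0; rewrite hs s0 scale0r eqxx.
pose W1 y := 0 < cross A (y - b) /\ 0 < cross (y - b) B.
pose W2 y := cross A (y - b) < 0 \/ cross (y - b) B < 0.
have W12 y : ball b e y -> ~ bd y -> W1 y \/ W2 y.
  move=> be nb; apply: contrapT => /not_orP[n1 /not_orP[n2 n3]].
  have {}n2 : 0 <= cross A (y - b) by rewrite leNgt; apply/negP.
  have {}n3 : 0 <= cross (y - b) B by rewrite leNgt; apply/negP.
  have yb : y = b + (y - b) by rewrite addrC subrK.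
  (* The radius is at most the length of the branch, so a point of the ball on the ray along a
     branch lies on the branch itself. *)
  have noray C s : branch P b C -> e <= `|C| -> 0 <= s -> y - b = s *: C -> False.
    move=> bC eC s0 hs; apply: nb; rewrite yb hs; apply: branch_bd => //.
    rewrite s0 /= ltNge; apply/negP => s1.
    move: be; rewrite yb => /ball_shift; rewrite hs normrZ ger0_norm //.
    apply/negP; rewrite -leNgt; apply: (le_trans eC).
    by rewrite ler_peMl.
  have [cA|cA] := eqVneq (cross A (y - b)) 0.
    have [s hs] := cross0_colinear A0 cA.
    have [s0|s0] := leP 0 s; first exact: (noray A s).
    have ce : cross (y - b) B = s * cross A B.
      by rewrite hs /cross /= /GRing.scale /=; ring.
    have /anti[k k0 hB] : cross A B = 0.
      by apply/eqP; rewrite eq_le cr0 andbT -(nmulr_rge0 _ s0) -ce.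
    apply: (noray B (- s / k)) => //; first by apply: divr_ge0; lra.
    by rewrite hs hB scalerA; congr (_ *: _); field; rewrite gt_eqF.
  have [cB|cB] := eqVneq (cross (y - b) B) 0; last first.
    by apply: n1; split; rewrite lt_neqAle eq_sym ?cA ?cB.
  have cB' : cross B (y - b) = 0.
    by rewrite -[LHS]opprK -[RHS]oppr0 -cB /cross; congr (- _); ring.
  have [s hs] := cross0_colinear B0 cB'.
  have [s0|s0] := leP 0 s; first exact: (noray B s).
  have ce : cross A (y - b) = s * cross A B.
    by rewrite hs /cross /= /GRing.scale /=; ring.
  have cAB : cross A B = 0.
    by apply/eqP; rewrite eq_le cr0 andbT -(nmulr_rge0 _ s0) -ce.
  by rewrite ce cAB mulr0 eqxx in cA.
have Wbd y : ball b e y -> W1 y \/ W2 y -> ~ bd y.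
  move=> be hW /(hbd y be) [h /andP[h0 h1]].
  case=> hy; move: hW; rewrite /W1 /W2 hy [b + _]addrC addrK.
    have -> : cross A (h *: A) = 0 by rewrite /cross /= /GRing.scale /=; ring.
    have -> : cross (h *: A) B = h * cross A B by rewrite /cross /= /GRing.scale /=; ring.
    by rewrite ltxx => -[[]|[]] //; apply/negP; rewrite -leNgt mulr_ge0.
  have -> : cross (h *: B) B = 0 by rewrite /cross /= /GRing.scale /=; ring.
  have -> : cross A (h *: B) = h * cross A B by rewrite /cross /= /GRing.scale /=; ring.
  by rewrite ltxx => -[[]|[]] //; apply/negP; rewrite -leNgt mulr_ge0.
have cA_aff y z t : cross A (y + t *: (z - y) - b) = (1 - t) * cross A (y - b) + t * cross A (z - b).
  by rewrite /cross /= /GRing.scale /=; ring.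
have cB_aff y z t : cross (y + t *: (z - y) - b) B = (1 - t) * cross (y - b) B + t * cross (z - b) B.
  by rewrite /cross /= /GRing.scale /=; ring.
have conv_pos (p q t : R) : 0 < p -> 0 < q -> 0 <= t <= 1 -> 0 < (1 - t) * p + t * q.
  move=> p0 q0 /andP[t0 t1]; have [->|tn] := eqVneq t 0; first by rewrite subr0 mul1r mul0r addr0.
  by have tp : 0 < t by [rewrite lt_neqAle eq_sym tn]; nra.
have conv_neg (p q t : R) : p < 0 -> q < 0 -> 0 <= t <= 1 -> (1 - t) * p + t * q < 0.
  move=> p0 q0 t01; rewrite -oppr_gt0 opprD -!mulrN; apply: conv_pos => //; by rewrite oppr_gt0.
have W1link y z : ball b e y -> ball b e z -> W1 y -> W1 z -> linked y z.
  move=> by_ bz [y1 y2] [z1 z2]; apply: seg_component => t t01.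
  apply: Wbd; first exact: ball_convex.
  by left; split; rewrite ?cA_aff ?cB_aff; apply: conv_pos.
have W2link y z : ball b e y -> ball b e z -> W2 y -> W2 z -> linked y z.
  have hA y' z' : ball b e y' -> ball b e z' -> cross A (y' - b) < 0 -> cross A (z' - b) < 0 -> linked y' z'.
    move=> by_ bz y1 z1; apply: seg_component => t t01; apply: Wbd; first exact: ball_convex.
    by right; left; rewrite cA_aff; apply: conv_neg.
  have hB y' z' : ball b e y' -> ball b e z' -> cross (y' - b) B < 0 -> cross (z' - b) B < 0 -> linked y' z'.
    move=> by_ bz y1 z1; apply: seg_component => t t01; apply: Wbd; first exact: ball_convex.
    by right; right; rewrite cB_aff; apply: conv_neg.
  (* For opposite branches the two half-planes of [W2] coincide. *)
  have [c0|cn] := eqVneq (cross A B) 0.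
    have [k k0 hk] := anti c0.
    have sw v : (cross v B < 0) = (cross A v < 0).
      have -> : cross v B = k * cross A v by rewrite hk /cross /= /GRing.scale /=; ring.
      by rewrite pmulr_rlt0.
    by move=> by_ bz; rewrite /W2 !sw => -[]y1 [] z1; exact: hA.
  have cp : 0 < cross A B by rewrite lt_neqAle eq_sym cn.
  (* The point [q], behind the sector, lies in both half-planes and joins them; the added 1 keeps
     the denominator positive. *)
  pose h := e / 2 / (`|A + B| + 1).
  have nn : 0 < `|A + B| + 1 by rewrite ltr_wpDl.
  have h0 : 0 < h by rewrite divr_gt0 // divr_gt0.
  pose q := b + (- h) *: (A + B).
  have bq : ball b e q.
    apply/ball_shift; rewrite normrZ normrN gtr0_norm // /h mulrAC ltr_pdivrMr //.
    by move: (normr_ge0 (A + B)) e0; move: `|A + B| => n; nra.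
  have qA : cross A (q - b) < 0.
    have -> : cross A (q - b) = - (h * cross A B) by rewrite /q /cross /= /GRing.scale /=; ring.
    by rewrite oppr_lt0 mulr_gt0.
  have qB : cross (q - b) B < 0.
    have -> : cross (q - b) B = - (h * cross A B) by rewrite /q /cross /= /GRing.scale /=; ring.
    by rewrite oppr_lt0 mulr_gt0.
  move=> by_ bz [y1|y1] [z1|z1]; [exact: hA| | |exact: hB].
    by apply: (@connected_component_trans _ _ q); [exact: hA|exact: hB].
  by apply: (@connected_component_trans _ _ q); [exact: hB|exact: hA].
(* A direction leading from branch [A] into [W1]: a normal of [A] if the branches are opposite,
   otherwise [B]. *)
have [w w1 w2] : exists2 w, 0 < cross A w & forall h s, 0 < h -> 0 < s -> 0 < cross (h *: A + s *: w) B.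
  have [c0|cn] := eqVneq (cross A B) 0.
    have [k k0 hk] := anti c0.
    have e1 : cross A (- A.2, A.1) = dot A A by rewrite /cross /dot /=; ring.
    exists (- A.2, A.1) => [|h s h0 s0]; first by rewrite e1.
    have -> : cross (h *: A + s *: (- A.2, A.1)) B = s * (k * dot A A).
      by rewrite hk /cross /dot /= /GRing.scale /=; ring.
    by rewrite !mulr_gt0.
  have cp : 0 < cross A B by rewrite lt_neqAle eq_sym cn.
  exists B => // h s h0 s0.
  have -> : cross (h *: A + s *: B) B = h * cross A B by rewrite /cross /= /GRing.scale /=; ring.
  by rewrite mulr_gt0.
have near_sides (e' : R) : 0 < e' -> e' <= e -> exists y z,
    [/\ ball b e' y, ball b e' z, W1 y, W2 z & par P u y = ~~ par P u z].
  move=> e'0 e'e; have [j [[c c0 hc] hj]] := bA.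
  pose h := Num.min (1 / 2) (e' / 2 / (`|A| + 1)).
  have nn : 0 < `|A| + 1 by rewrite ltr_wpDl.
  have h0 : 0 < h by rewrite lt_min; apply/andP; split; [lra|rewrite divr_gt0 // divr_gt0].
  have h1 : h < 1 by rewrite gt_min; apply/orP; left; lra.
  have hA : `|h *: A| < e' / 2.
    rewrite normrZ gtr0_norm //.
    have hh : h <= e' / 2 / (`|A| + 1) by rewrite ge_min lexx orbT.
    apply: (@le_lt_trans _ _ (e' / 2 / (`|A| + 1) * `|A|)); first by rewrite ler_wpM2r.
    by rewrite mulrAC ltr_pdivrMr //; move: (normr_ge0 A) e'0; move: `|A| => n; nra.
  have hbj := hj h; rewrite h0 h1 in hbj; have {}hbj := hbj isT.
  have [K /nbhs_ballP [r /= r0 hK]] := par_jump simple u0 hbj.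
  pose s := Num.min (r / 2) (e' / 2) / (`|w| + 1).
  have nw : 0 < `|w| + 1 by rewrite ltr_wpDl.
  have mn : 0 < Num.min (r / 2) (e' / 2) by rewrite lt_min !divr_gt0.
  have s0 : 0 < s by rewrite divr_gt0.
  have hs : `|s *: w| < Num.min (r / 2) (e' / 2).
    rewrite normrZ gtr0_norm // /s mulrAC ltr_pdivrMr //.
    by move: (normr_ge0 w) mn; move: `|w| (Num.min _ _) => n q; nra.
  have [hs1 hs2] : `|s *: w| < r /\ `|s *: w| < e' / 2.
    by move: hs; rewrite lt_min => /andP[]; split; lra.
  pose y := b + (h *: A + s *: w); pose z := b + (h *: A - s *: w).
  have yW : W1 y.
    rewrite /W1 /y [b + _]addrC addrK; split; last exact: w2.
    have -> : cross A (h *: A + s *: w) = s * cross A w by rewrite /cross /= /GRing.scale /=; ring.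
    exact: mulr_gt0.
  have zW : W2 z.
    rewrite /W2 /z [b + _]addrC addrK; left.
    have -> : cross A (h *: A - s *: w) = - (s * cross A w) by rewrite /cross /= /GRing.scale /=; ring.
    by rewrite oppr_lt0 mulr_gt0.
  exists y, z; split=> //.
  - by apply/ball_shift; apply: (le_lt_trans (ler_normD _ _)); lra.
  - by apply/ball_shift; apply: (le_lt_trans (ler_normD _ _)); rewrite normrN; lra.
  have [t _ ht] := hbj.
  (* The quantity [D] of [par_jump] is linear in the displacement [v] from the branch, so [s *: w]
     and its opposite lead to different sides of edge [j]. *)
  have Dv v : cross (tnth P j - (b + h *: A + v)) (tnth P (ordS j) - (b + h *: A + v)) = - (cross v A / c).
    rewrite ht /edge_pt hc -/(cross _ _).
    by rewrite /cross /= /GRing.scale /=; field.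
  have Dy := hK y; have Dz := hK z; rewrite /= in Dy Dz.
  rewrite /y /z !addrA Dv in Dy *.
  rewrite /z addrA Dv in Dz.
  have cw1 : cross (s *: w) A = - (s * cross A w) by rewrite /cross /= /GRing.scale /=; ring.
  have cw2 : cross (- (s *: w)) A = (s * cross A w) by rewrite /cross /= /GRing.scale /=; ring.
  have q0 : s * cross A w != 0 by rewrite gt_eqF // mulr_gt0.
  rewrite Dy ?Dz //.
  - rewrite cw1 cw2 mulNr opprK oppr_gt0.
    have : s * cross A w / c != 0 by rewrite mulf_neq0 // invr_eq0.
    by case: (ltrgtP (s * cross A w / c) 0); rewrite ?addbT ?addbF ?negbK.
  - by apply/ball_shift; rewrite normrN.
  - by rewrite oppr_eq0 mulf_neq0 ?invr_eq0 // cw2.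
  - by apply/ball_shift.
  - by rewrite oppr_eq0 mulf_neq0 ?invr_eq0 // cw1 oppr_eq0.
split=> [y z by_ bz ny nz pyz|e' p e'0].
  have [y' [z' [by' bz' y'W z'W pyz']]] := near_sides e e0 (lexx e).
  have [yW|yW] := W12 y by_ ny; have [zW|zW] := W12 z bz nz.
  - exact: W1link.
  - have h1 := par_component u0 (W1link _ _ by_ by' yW y'W).
    have h2 := par_component u0 (W2link _ _ bz bz' zW z'W).
    by move: pyz'; rewrite -h1 -h2 pyz; case: (par P u z).
  - have h1 := par_component u0 (W2link _ _ by_ bz' yW z'W).
    have h2 := par_component u0 (W1link _ _ bz by' zW y'W).
    by move: pyz'; rewrite -h1 -h2 pyz; case: (par P u z).
  - exact: W2link.
pose e2 := Num.min e' e.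
have e20 : 0 < e2 by rewrite lt_min e'0.
have e2e : e2 <= e by rewrite ge_min lexx orbT.
have [y [z [by_ bz yW zW pyz]]] := near_sides e2 e20 e2e.
have sub q : ball b e2 q -> ball b e' q /\ ball b e q.
  by rewrite !ballE lt_min => /andP.
have [by1 by2] := sub y by_; have [bz1 bz2] := sub z bz.
have [py|py] := eqVneq (par P u y) p.
  by exists y; split=> //; apply: Wbd => //; left.
exists z; split=> //; first by apply: Wbd => //; right.
by move: py; rewrite pyz; case: (par P u z); case: p.
Qed.

End Sectors.

Lemma ordS_reach m (T : 'I_m -> Prop) (i0 : 'I_m) : (forall i, T i -> T (ordS i)) -> T i0 ->
  forall j, T j.
Proof.
move=> TS T0 j; have it k : T (iter k (@ordS m) i0) by elim: k => [|k IH] //=; exact: TS.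
have m0 : (0 < m)%N by apply: leq_ltn_trans (ltn_ord i0).
have vk k : nat_of_ord (iter k (@ordS m) i0) = ((i0 + k) %% m)%N.
  elim: k => [|k IH]; first by rewrite /= addn0 modn_small.
  by rewrite iterS /= IH -addn1 modnDml addn1 addnS.
(* Adding [m] keeps the truncated subtraction exact when [j < i0]. *)
have -> : j = iter (j + m - i0)%N (@ordS m) i0; last exact: it.
apply: val_inj => /=; rewrite vk subnKC ?modnDr ?modn_small //.
by apply: ltnW; apply: ltn_addl.
Qed.

(** * Jordan separation for polygons *)

Section Jordan.
Variable R : realType.
Implicit Types (u v w a b x y z : R * R) (s t : R).
Variables (m : nat) (P : m.-tuple (R * R)).
Let bd := boundary P.
Hypothesis simple : simple_polygon P.
Variable u : R * R.
Hypothesis u0 : u != 0.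
Let linked := connected_component (~` bd).

Lemma local_sides b : bd b -> exists2 e : R, 0 < e & both_sides P u b e.
Proof.
move=> bb; have [A [B [bA bB AB /nbhs_ballP [r /= r0 hr]]]] := local_model simple bb.
have A0 := branch_neq0 simple bA; have B0 := branch_neq0 simple bB.
pose e := Num.min r (Num.min `|A| `|B|).
have e0 : 0 < e by rewrite !lt_min r0 !normr_gt0 A0 B0.
have er : e <= r by rewrite ge_min lexx.
have eA : e <= `|A| by rewrite !ge_min lexx !orbT.
have eB : e <= `|B| by rewrite !ge_min lexx !orbT.
have hb y : ball b e y -> bd y -> exists2 h, 0 <= h <= 1 & (y = b + h *: A \/ y = b + h *: B).
  by rewrite ballE => hy; apply: hr; rewrite ballE; exact: lt_le_trans er.
exists e => //; have [c|c] := leP 0 (cross A B).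
  exact: (sector simple u0 bb e0 bA bB).
apply: (sector simple u0 bb e0 bB bA) => //.
- move=> k k0 e1; apply: (AB k^-1); first by rewrite invr_gt0.
  by rewrite e1 scalerA mulVf ?scale1r // gt_eqF.
- by have -> : cross B A = - cross A B; [rewrite /cross; ring|lra].
- by move=> y b1 /(hb y b1) [h h01 [->|->]]; exists h => //; [right|left].
Qed.

Lemma ball_linked y : ~ bd y -> exists2 e : R, 0 < e & forall z, ball y e z -> linked y z.
Proof.
move=> ny; have : \forall z \near y, (~` bd) z.
  by apply: open_nbhs_nbhs; split=> //; apply: closed_openC; exact: boundary_closed.
move=> /nbhs_ballP [e /= e0 he]; exists e => // z bz; apply: seg_component => t t01.
by apply: he; apply: ball_convex => //; exact: ballxx.
Qed.

Lemma closure_linked x y : closure (linked x) y -> ~ bd y -> linked x y.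
Proof.
move=> cy ny; have [e e0 he] := ball_linked ny.
have [z [xz yz]] := cy _ (nbhsx_ballx y _ e0).
by apply: (connected_component_trans xz); apply: connected_component_sym; exact: he.
Qed.

Lemma linked_open x : open (linked x).
Proof.
rewrite openE => y xy; have [] := @ball_linked y.
  exact: (@connected_component_sub _ _ x y xy).
move=> e e0 he; apply/nbhs_ballP; exists e => //= z bz.
by apply: (connected_component_trans xy); exact: he.
Qed.

(** A segment from [x] to a vertex has to leave the component, and does so at a boundary point of
    its closure. The closure then fills the edge of that point, as lying in it is both an open and a
    closed condition along the edge, and it passes from edge to edge through the vertices. *)
Lemma linked_closure_boundary x : (0 < m)%N -> ~ bd x -> bd `<=` closure (linked x).
Proof.
move=> m0 nx; pose i0 := Ordinal m0; pose b0 := tnth P i0.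
pose G := closure (linked x).
have bb0 : bd b0 by exists i0; exists 0; rewrite ?lexx ?ler01 // /edge_pt scale0r addr0.
have xx : linked x x by apply: connected_component_refl.
have [b [bb Gb]] : exists b, bd b /\ G b.
  apply: contrapT => noG.
  have h : line_seg x b0 `&` linked x = line_seg x b0.
    apply: (@line_seg_connected _ x b0).
    - by exists x; split=> //; exact: line_seg0.
    - by exists (linked x) => //; exact: linked_open.
    - exists G; first exact: closed_closure.
      apply/seteqP; split=> y [y1 y2]; split=> //; first exact: subset_closure.
      by apply: closure_linked => // yb; apply: noG; exists y.
  have : (line_seg x b0 `&` linked x) b0 by rewrite h; exact: line_seg1.
  by move=> [_ /connected_component_sub]; apply.
have edge i y : line_seg (tnth P i) (tnth P (ordS i)) y -> G y ->
    line_seg (tnth P i) (tnth P (ordS i)) `<=` G.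
  move=> iy Gy; pose L := line_seg (tnth P i) (tnth P (ordS i)).
  have Lb : L `<=` bd by move=> z Lz; rewrite /bd boundaryE; exists i.
  have h : L `&` G = L.
    apply: (@line_seg_connected _ (tnth P i) (tnth P (ordS i))).
    - by exists y.
    (* Openness along the edge: the component has points in the ball of [c], and near each boundary
       point [z] of that ball there are points of the parity of [x]; the first clause of
       [both_sides] links them. *)
    - exists [set z | exists c (e : R), [/\ both_sides P u c e, G c & ball c e z]].
        rewrite openE => z [c [e [h1 h2 h3]]].
        have : \forall z' \near z, ball c e z'.
          apply: open_nbhs_nbhs; split=> //; exact: ball_open.
        by apply: filterS => z' h4; exists c, e.
      apply/seteqP; split=> z [Lz hz]; split=> //.
        have [e e0 he] := local_sides (Lb z Lz).
        by exists z, e; split=> //; exact: ballxx.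
      move: hz => [c [e [h1 h2 h3]]] U /nbhs_ballP [r /= r0 hU].
      have e0 : 0 < e by move: h3; rewrite ballE => /(le_lt_trans (normr_ge0 _)).
      have [q [xq cq]] := h2 _ (nbhsx_ballx c _ e0).
      have [z1 [e1 e10 hz1]] : exists z1 : R * R, exists2 e1 : R, 0 < e1 & ball z e1 `<=` ball c e.
        have : \forall z' \near z, ball c e z'.
          by apply: open_nbhs_nbhs; split=> //; exact: ball_open.
        by move=> /nbhs_ballP [e1 /= e10 he1]; exists z, e1.
      have [e' e'0 [_ hz]] := local_sides (Lb z Lz).
      have mn : 0 < Num.min r e1 by rewrite lt_min r0.
      have [w [bw nw pw]] := hz _ (par P u x) mn.
      move: bw; rewrite ballE lt_min => /andP[bw1 bw2].
      exists w; split; last by apply: hU; rewrite ballE.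
      apply: (connected_component_trans xq).
      apply: (h1.1) => //; first by apply: hz1; rewrite ballE.
        exact: (@connected_component_sub _ _ x q xq).
      by rewrite pw; symmetry; exact: (par_component u0 xq).
    - by exists G => //; exact: closed_closure.
  by move=> z Lz; have : (L `&` G) z by [rewrite h]; case.
have [i _ bi] : (\bigcup_(i in setT) line_seg (tnth P i) (tnth P (ordS i))) b by rewrite -boundaryE.
have all i' : line_seg (tnth P i') (tnth P (ordS i')) `<=` G.
  apply: (@ordS_reach m (fun i' => line_seg (tnth P i') (tnth P (ordS i')) `<=` G) i).
    by move=> k hk; apply: (edge _ (tnth P (ordS k))); [exact: line_seg0|apply: hk; exact: line_seg1].
  exact: (edge _ b).
by move=> y; rewrite /bd boundaryE => -[k _]; exact: all.
Qed.

(** Both components come arbitrarily close to the same vertex, where equal parity already links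
    points. *)
Lemma same_par_linked x z : (0 < m)%N -> ~ bd x -> ~ bd z -> par P u x = par P u z -> linked x z.
Proof.
move=> m0 nx nz pxz; pose b := tnth P (Ordinal m0).
have bb : bd b by exists (Ordinal m0); exists 0; rewrite ?lexx ?ler01 // /edge_pt scale0r addr0.
have [e e0 [h1 h2]] := local_sides bb.
have [q [xq bq]] := linked_closure_boundary m0 nx bb (nbhsx_ballx b _ e0).
have [r [zr br]] := linked_closure_boundary m0 nz bb (nbhsx_ballx b _ e0).
apply: (connected_component_trans xq); apply: connected_component_sym.
apply: (connected_component_trans zr); apply: h1 => //.
- exact: (@connected_component_sub _ _ z r zr).
- exact: (@connected_component_sub _ _ x q xq).
- by rewrite -(par_component u0 zr) -(par_component u0 xq).
Qed.

(** All vertices lie strictly on one side of the line through [y] orthogonal to [y]; unlike a bound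
    on the norm, this separation carries over directly to a ray from [y]. *)
Definition far y := forall i, dot y (tnth P i) < dot y y.

(** [v] is normal to [u], with the sign that does not lead back towards the polygon. Far enough
    along it, all vertices are strictly on one side of the line in direction [u] through the query
    point, and no edge is crossed. *)
Lemma far_ray y : far y -> exists v, [/\ v != 0, forall T : R, 0 <= T -> ~ bd (y + T *: v) &
  exists2 T : R, 0 <= T & par P u (y + T *: v) = false].
Proof.
move=> fy; pose v0 : R * R := (- u.2, u.1).
have uu := dot_gt0 u0.
have [v [yv cv]] : exists v, 0 <= dot y v /\ (cross u v = dot u u \/ cross u v = - dot u u).
  have [h|h] := leP 0 (dot y v0).
    by exists v0; split=> //; left; rewrite /cross /dot /v0 /=; ring.
  exists (- v0); split; first by have -> : dot y (- v0) = - dot y v0 by [rewrite /dot /=; ring]; lra.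
  by right; rewrite /cross /dot /v0 /=; ring.
exists v; split.
- apply/eqP => v00; move: cv; rewrite v00 /cross /= !mulr0 subrr => -[/esym|/esym/eqP].
    by move=> e; rewrite e ltxx in uu.
  by rewrite oppr_eq0 gt_eqF.
- move=> T T0 [i [t /andP[t0 t1] e]].
  have h1 := fy i; have h2 := fy (ordS i).
  have e1 : dot y y + T * dot y v = (1 - t) * dot y (tnth P i) + t * dot y (tnth P (ordS i)).
    have -> : dot y y + T * dot y v = dot y (y + T *: v).
      by rewrite /dot /= /GRing.scale /=; ring.
    by rewrite e /edge_pt /dot /= /GRing.scale /=; ring.
  have h3 : 0 <= T * dot y v by exact: mulr_ge0.
  move: e1 h1 h2 h3; move: (dot y y) (dot y (tnth P i)) (dot y (tnth P (ordS i))) (T * _) => q p1 p2 r.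
  have [->|tn] := eqVneq t 0; first by rewrite subr0 mul1r mul0r addr0; lra.
  have tp : 0 < t by rewrite lt_neqAle eq_sym tn.
  by move=> e1 h1 h2 h3; nra.
pose M := \sum_i `|cross u (tnth P i - y)|.
have hM i : `|cross u (tnth P i - y)| <= M.
  by rewrite /M (bigD1 i) //= lerDl sumr_ge0.
have M0 : 0 <= M by apply: sumr_ge0.
pose T := (M + 1) / dot u u; have T0 : 0 <= T by rewrite divr_ge0 ?(ltW uu) // addr_ge0.
have TM : T * dot u u = M + 1 by rewrite /T divfK // gt_eqF.
have ce i : cross u (tnth P i - (y + T *: v)) = cross u (tnth P i - y) - T * cross u v.
  by rewrite /cross /= /GRing.scale /=; ring.
exists T => //; rewrite /par big1 // => i _; rewrite /hits !ce.
have := hM i; have := hM (ordS i); rewrite !ler_norml => /andP[a1 a2] /andP[b1 b2].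
case: cv => ->; rewrite ?mulrN TM.
  rewrite !ltNge; apply/negbTE; rewrite negb_or !negb_and !negbK.
  by apply/andP; split; apply/orP; right; apply/orP; right; lra.
apply/negbTE; rewrite negb_or !negb_and; apply/andP; split; apply/orP; right; apply/orP; left; rewrite -ltNge; lra.
Qed.

Lemma far_par y : far y -> ~ bd y /\ par P u y = false.
Proof.
move=> /far_ray [v [v0 nb [T T0 pT]]]; split; first by have := nb 0 (lexx 0); rewrite scale0r addr0.
rewrite -pT; apply: (par_component u0); apply: seg_component => t /andP[t0 t1].
have -> : y + t *: (y + T *: v - y) = y + (t * T) *: v.
  by apply: plane_eq; rewrite /= /GRing.scale /=; ring.
by apply: nb; rewrite mulr_ge0.
Qed.

Lemma far_norm : exists M : R, forall y, M < `|y| -> far y.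
Proof.
pose S := \sum_i `|tnth P i|; have S0 : 0 <= S by apply: sumr_ge0.
(* The norm is the maximum norm, and each of the two terms of the scalar product is at most [S]
   times the norm of [y]. *)
exists (2 * S) => y hy i; have hi : `|tnth P i| <= S.
  by rewrite /S (bigD1 i) //= lerDl sumr_ge0.
have y0 : 0 <= `|y| by [].
have yn : `|y| ^+ 2 <= dot y y.
  by rewrite norm_pair maxEle /dot; case: ifP => _; rewrite real_normK ?num_real // expr2; nra.
apply: lt_le_trans yn.
have c1 : `|y.1| <= `|y| by rewrite [leRHS]norm_pair le_max lexx.
have c2 : `|y.2| <= `|y| by rewrite [leRHS]norm_pair le_max lexx orbT.
have d1 : `|(tnth P i).1| <= S by apply: le_trans hi; rewrite [leRHS]norm_pair le_max lexx.
have d2 : `|(tnth P i).2| <= S by apply: le_trans hi; rewrite [leRHS]norm_pair le_max lexx orbT.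
apply: (@le_lt_trans _ _ (`|y| * S + `|y| * S)).
  rewrite /dot; apply: lerD; apply: (le_trans (ler_norm _)); rewrite normrM; exact: ler_pM.
by rewrite expr2; nra.
Qed.

Lemma bounded_setP (A : set (R * R)) : bounded_set A <-> exists M : R, forall y, A y -> `|y| <= M.
Proof.
split=> [/pinfty_ex_gt0 [M _ hM]|[M hM]]; first by exists M.
have h := @nbhs_pinfty_ge R M (num_real M).
by apply: filterS h => N MN y /hM /le_trans; exact.
Qed.

(** Even parity links [x] to a far point and onwards along an unbounded ray; odd parity keeps the
    component of [x] away from all far points. *)
Lemma region_par x : (0 < m)%N -> ~ bd x -> region P x <-> par P u x.
Proof.
move=> m0 nx; have [M hM] := far_norm; split=> [[//|[_ /bounded_setP [N hN]]]|px].
  apply/negPn/negP => /negbTE px.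
  pose y : R * R := (`|M| + 1, 0).
  have yf : far y.
    by apply: hM; rewrite norm_pair /= lt_max; apply/orP; left; rewrite (ger0_norm _) ?addr_ge0 // ltr_pwDr // ler_norm.
  have [ny py] := far_par yf; have [v [v0 nb _]] := far_ray yf.
  have xy : linked x y by apply: same_par_linked => //; rewrite px py.
  pose T := (`|y| + `|N| + 1) / `|v|.
  have vp : 0 < `|v| by rewrite normr_gt0.
  have T0 : 0 <= T by rewrite divr_ge0 // !addr_ge0.
  have yT : linked y (y + T *: v).
    apply: seg_component => t /andP[t0 t1].
    have -> : y + t *: (y + T *: v - y) = y + (t * T) *: v.
      by apply: plane_eq; rewrite /= /GRing.scale /=; ring.
    by apply: nb; rewrite mulr_ge0.
  have := hN _ (connected_component_trans xy yT).
  have nT : `|T *: v| = `|y| + `|N| + 1.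
    by rewrite normrZ ger0_norm // /T divfK // gt_eqF.
  have := lerB_normD (T *: v) y; rewrite addrC nT [T *: v + y]addrC.
  by have := ler_norm N; move: (`|y|) (`|N|) (`|y + T *: v|) => p q r; lra.
right; split=> //; apply/bounded_setP; exists M => y xy; rewrite leNgt; apply/negP => /hM /far_par [_].
by rewrite -(par_component u0 xy) px.
Qed.

End Jordan.

(** * Angles and the events of one edge *)

(** For [p = pi], [pos x] is the condition [0 < sin x] on []-2 p, 2 p[]. The arc from [al] to [be]
    is shorter than [p]. Either it does not pass angle 0, and the toggles switch the crossing on at
    [al] and off at [be], or it does, and the crossing, present at the start, is switched off at
    [be] and on again at [al]. *)
Lemma turn_order (R : realFieldType) (p al be th : R) : 0 < p ->
  0 <= al < 2 * p -> 0 <= be < 2 * p -> 0 <= th < 2 * p ->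
  let pos (x : R) := (0 < x < p) || (x < - p) in
  pos (be - al) ->
  ~~ pos (al - th) && pos (be - th) = (pos (- al) && ~~ pos (- be)) (+) ((al <= th) (+) (be <= th)).
Proof.
move=> p0 /andP[a0 a1] /andP[b0 b1] /andP[t0 t1] pos.
have T1 x : 0 < x -> x < p -> pos x = true by move=> h1 h2; rewrite /pos h1 h2.
have T2 x : x < - p -> pos x = true by move=> h1; rewrite /pos h1 orbT.
have F1 x : x <= 0 -> - p <= x -> pos x = false.
  by move=> h1 h2; rewrite /pos !ltNge h1 h2.
have F2 x : p <= x -> pos x = false.
  move=> h1; rewrite /pos [x < p]ltNge h1 andbF /=; apply/negbTE; rewrite -leNgt; lra.
have negE x : 0 <= x -> x < 2 * p -> pos (- x) = (p < x).
  by move=> h1 h2; rewrite /pos oppr_gt0 ltNge h1 /= ltrN2.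
rewrite !negE //; clearbody pos; clear negE => h.
have [X|X] : (al < be /\ be < al + p) \/ be < al - p.
  have [h1|h1] := leP (be - al) 0.
    have [h2|h2] := leP (- p) (be - al); first by rewrite F1 in h.
    by right; lra.
  have [h2|h2] := leP p (be - al); first by rewrite F2 in h.
  by left; split; lra.
- case: X => X1 X2.
  have -> : (p < al) && ~~ (p < be) = false.
    by rewrite -leNgt; apply/negbTE; rewrite negb_and -leNgt -ltNge; case: leP => // h1 /=; lra.
  rewrite addFb; have [at_|at_] := leP al th; have [bt|bt] := leP be th => /=; last 2 first.
  + by exfalso; lra.
  + have [h1|h1] := ltP (al - th) p; first by rewrite T1 // subr_gt0.
    by rewrite [pos (be - th)]F2 ?andbF //; lra.
  + have [h1|h1] := leP (- p) (be - th); first by rewrite [pos (be - th)]F1 ?andbF //; lra.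
    by rewrite T2 //; lra.
  + by rewrite F1 ?T1 //; lra.
- have -> : (p < al) && ~~ (p < be) = true by rewrite -leNgt; apply/andP; split; lra.
  rewrite addTb; have [at_|at_] := leP al th; have [bt|bt] := leP be th => /=.
  + by rewrite F1 ?T2 //; lra.
  + by exfalso; lra.
  + have [h1|h1] := leP (- p) (be - th); first by rewrite [pos (be - th)]F1 ?andbF //; lra.
    by rewrite T1 //; lra.
  + by rewrite F2 ?T1 //; lra.
Qed.

Section Angles.
Variable R : realType.
Implicit Types (u v w a b x y z : R * R) (s t th : R).

Definition dir th : R * R := (cos th, sin th).

Lemma sin_gt0E (x : R) : - (2 * pi) < x < 2 * pi -> (0 < sin x) = (0 < x < pi) || (x < - pi).
Proof.
move=> /andP[x1 x2]; have p0 := pi_gt0 R.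
have neg (y : R) : 0 < y < pi -> sin (- y) < 0.
  by move=> /sin_gt0_pi; rewrite sinN oppr_lt0.
have [h|h|->] := ltrgtP x 0; last by rewrite sin0 ltxx /= oppr_gt0 lt_gtF.
- have [h'|h'|->] /= := ltrgtP x (- pi); last by rewrite sinN sinpi oppr0 ltxx.
    have -> : sin x = sin (x + pi *+ 2) by rewrite sinD2pi.
    by rewrite sin_gt0_pi // mulr2n; apply/andP; split; lra.
  have h1 : 0 < - x < pi by apply/andP; split; lra.
  by rewrite -[x]opprK ltNge (ltW (neg _ h1)).
- have [h'|h'|->] /= := ltrgtP x pi.
  + by rewrite sin_gt0_pi // h.
  + have -> : sin x = - sin (x - pi) by rewrite -[in LHS](subrK pi x) sinDpi.
    rewrite oppr_gt0 ltNge ltW; last by apply: sin_gt0_pi; apply/andP; split; lra.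
    by apply/esym/negbTE; rewrite -leNgt; lra.
  + by rewrite sinpi ltxx; apply/esym/negbTE; rewrite -leNgt; lra.
Qed.

Lemma sin_lt0E (x : R) : - (2 * pi) < x < 2 * pi -> (sin x < 0) = (0 < - x < pi) || (- x < - pi).
Proof.
by move=> /andP[x1 x2]; rewrite -sin_gt0E ?sinN ?oppr_gt0 //; apply/andP; split; lra.
Qed.

(** [acos] sees the abscissa only; a negative ordinate reflects the angle into []pi, 2 * pi[]. *)
Definition ang v : R :=
  let c := acos (v.1 / Num.sqrt (dot v v)) in if v.2 < 0 then 2 * pi - c else c.

Lemma ang_spec v : v != 0 -> 0 <= ang v < 2 * pi /\ v = Num.sqrt (dot v v) *: dir (ang v).
Proof.
move=> v0; have vv := dot_gt0 v0; set n := Num.sqrt (dot v v).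
have p0 := pi_gt0 R.
have n0 : 0 < n by rewrite sqrtr_gt0.
have n2 : n ^+ 2 = v.1 ^+ 2 + v.2 ^+ 2 by rewrite sqr_sqrtr ?(ltW vv) // /dot !expr2.
have cn : v.1 / n * n = v.1 by rewrite divfK // gt_eqF.
have c2 : 1 - (v.1 / n) ^+ 2 = (v.2 / n) ^+ 2.
  have nn : n ^+ 2 != 0 by rewrite expf_neq0 // gt_eqF.
  by apply: (mulIf nn); rewrite mulrBl -!exprMn cn divfK ?gt_eqF // mul1r n2; ring.
have c1 : -1 <= v.1 / n <= 1.
  by rewrite -ler_norml -(@expr_le1 _ 2) // real_normK ?num_real // -subr_ge0 c2 sqr_ge0.
have sn : v.2 / n * n = v.2 by rewrite divfK // gt_eqF.
have sA : sin (acos (v.1 / n)) = `|v.2 / n| by rewrite sin_acos // c2 sqrtr_sqr.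
rewrite /ang -/n; have [vneg|vpos] := ltP v.2 0.
  have lt1 : -1 <= v.1 / n < 1.
    case/andP: (c1) => -> /=; rewrite le_eqVlt => /orP[/eqP e|//].
    by move: c2; rewrite e expr1n subrr => /esym/eqP; rewrite sqrf_eq0 mulf_eq0 invr_eq0 (gt_eqF n0) (lt_eqF vneg).
  have h1 := acos_gt0 lt1; have h2 := acos_lepi c1.
  split; first by apply/andP; split; lra.
  have e1 : 2 * pi - acos (v.1 / n) = - acos (v.1 / n) + pi *+ 2 by rewrite mulr2n; ring.
  rewrite /dir e1 cosD2pi sinD2pi cosN sinN sA acosK //; apply: plane_eq; rewrite /= /GRing.scale /=.
    by rewrite mulrC cn.
  rewrite ltr0_norm ?opprK 1?mulrC ?sn //.
  by rewrite pmulr_rlt0 ?invr_gt0.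
have h1 := acos_ge0 c1; have h2 := acos_lepi c1.
split; first by apply/andP; split; lra.
rewrite /dir sA acosK //; apply: plane_eq; rewrite /= /GRing.scale /=.
  by rewrite mulrC cn.
have vn : 0 <= v.2 / n by apply: divr_ge0 => //; exact: ltW.
by rewrite (ger0_norm vn) mulrC sn.
Qed.

Lemma dot_dir th : dot (dir th) (dir th) = 1.
Proof. by rewrite /dot /dir /= -!expr2 cos2Dsin2. Qed.

Lemma dir_neq0 th : dir th != 0.
Proof. by apply/eqP => h; have := dot_dir th; rewrite h /dot /= !mulr0 addr0 => /eqP; rewrite eq_sym oner_eq0. Qed.

Lemma cross_dir s t : cross (dir s) (dir t) = sin (t - s).
Proof. by rewrite /cross /dir /= sinB; ring. Qed.

Lemma dir_inj s t : 0 <= s < 2 * pi -> 0 <= t < 2 * pi -> dir s = dir t -> s = t.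
Proof.
have p0 := pi_gt0 R.
wlog st : s t / s <= t.
  by move=> H; have [h|/ltW h] := leP s t => *; [|apply/esym]; apply: H.
move=> /andP[s0 s1] /andP[t0 t1] e.
have c : sin (t - s) = 0 by rewrite -cross_dir e; exact: cross_aa.
have d : cos (t - s) = 1.
  by rewrite cosB; case: e => -> ->; rewrite -!expr2 cos2Dsin2.
have [//|st'] := eqVneq s t.
have {}st' : s < t by rewrite lt_neqAle st'.
have [h|h|h] := ltrgtP (t - s) pi.
- have : 0 < sin (t - s) by apply: sin_gt0_pi; rewrite subr_gt0 st'.
  by rewrite c ltxx.
- have : sin (t - s) < 0.
    by rewrite sin_lt0E; [apply/orP; right; lra|apply/andP; split; lra].
  by rewrite c ltxx.
- by move: d; rewrite h cospi => /eqP; rewrite eq_sym -subr_eq0 opprK -mulr2n mulrn_eq0 oner_eq0.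
Qed.

Lemma ang_unit v : v != 0 -> dot v v = 1 -> v = dir (ang v).
Proof. by move=> v0 v1; have [_ {1}->] := ang_spec v0; rewrite v1 sqrtr1 scale1r. Qed.

Lemma ang_dir th : 0 <= th < 2 * pi -> ang (dir th) = th.
Proof.
move=> h; have [h1 _] := ang_spec (dir_neq0 th); apply: dir_inj => //.
by rewrite -ang_unit ?dir_neq0 ?dot_dir.
Qed.

(** The crossing by a ray just before angle 0: the strict and the large inequality of [hits] on the
    two ends are exchanged, since an end at angle 0 toggles at time 0. *)
Definition starts a b : bool :=
  [&& 0 < cross a b, a.2 < 0 & 0 <= b.2] || [&& cross a b < 0, b.2 < 0 & 0 <= a.2].

(** A segment whose line passes through the origin is never crossed; its ends get the time [2 * pi],
    that of no event. *)
Definition turn_key a v : R := if cross a v == 0 then 2 * pi else ang a.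

Lemma hitsC u a b : hits u a b = hits u b a.
Proof.
have c : cross b a = - cross a b by rewrite /cross; ring.
by rewrite /hits c oppr_gt0 oppr_lt0 orbC.
Qed.

Lemma startsC a b : starts a b = starts b a.
Proof.
have c : cross b a = - cross a b by rewrite /cross; ring.
by rewrite /starts c oppr_gt0 oppr_lt0 orbC.
Qed.

Lemma cross_anti a b : cross b a = - cross a b.
Proof. by rewrite /cross; ring. Qed.

Lemma hits_turn th a b : 0 <= th < 2 * pi ->
  hits (dir th) a b = starts a b (+) ((turn_key a b <= th) (+) (turn_key b a <= th)).
Proof.
move=> hth; rewrite /turn_key (cross_anti a b) oppr_eq0.
have [c0|cn] := eqVneq (cross a b) 0.
  by rewrite /hits /starts c0 ltxx /= addbb.
wlog cp : a b cn / 0 < cross a b.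
  move=> H; have [c|c] := ltP 0 (cross a b); first exact: H.
  rewrite hitsC startsC [X in _ (+) X]addbC; apply: H; rewrite (cross_anti a b) ?oppr_eq0 //.
  by rewrite oppr_gt0 lt_neqAle cn.
have a0 : a != 0 by apply: contraNneq cn => ->; rewrite /cross /= !mul0r subrr.
have b0 : b != 0 by apply: contraNneq cn => ->; rewrite /cross /= !mulr0 subrr.
have [ha ea] := ang_spec a0; have [hb eb] := ang_spec b0.
have ra : 0 < Num.sqrt (dot a a) by rewrite sqrtr_gt0 dot_gt0.
have rb : 0 < Num.sqrt (dot b b) by rewrite sqrtr_gt0 dot_gt0.
move: ra rb ea eb ha hb; set al := ang a; set be := ang b.
move: (Num.sqrt (dot a a)) (Num.sqrt (dot b b)) al be => ra rb al be ra0 rb0 ea eb /andP[a1 a2] /andP[b1 b2].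
case/andP: (hth) => t1 t2.
have p0 := pi_gt0 R.
have dirZ s t k v : 0 < k -> v = k *: dir t -> cross (dir s) v = k * sin (t - s).
  by move=> _ ->; rewrite -cross_dir /cross /= /GRing.scale /=; ring.
have cab : cross a b = ra * (rb * sin (be - al)).
  by rewrite ea -(dirZ _ _ _ _ rb0 eb) /cross /= /GRing.scale /=; ring.
rewrite /hits /starts cp (lt_gtF cp) /= !orbF.
rewrite !leNgt.
rewrite (dirZ th al ra a) // (dirZ th be rb b) // !pmulr_rgt0 //.
have -> : (a.2 < 0) = (sin al < 0) by rewrite ea /= /GRing.scale /= pmulr_rlt0.
have -> : (b.2 < 0) = (sin be < 0) by rewrite eb /= /GRing.scale /= pmulr_rlt0.
rewrite !sin_lt0E; try by apply/andP; split; lra.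
rewrite !sin_gt0E; try by apply/andP; split; lra.
rewrite -!leNgt; apply: (turn_order p0); rewrite ?a1 ?b1 //.
rewrite -sin_gt0E; last by apply/andP; split; lra.
by move: cp; rewrite cab !pmulr_rgt0.
Qed.

End Angles.

(** * Outward ray against ray from the origin *)

Section ClipSigns.
Variables (R : realFieldType) (lo hi s t : R) (cl : bool).
Hypothesis cl_le : cl -> lo <= hi.
Hypotheses (lo0 : 0 <= lo) (hi1 : hi <= 1).
Hypothesis t1 : 0 <= s <= 1 -> t != 1.
Hypothesis inC : 0 <= s <= 1 -> t ^+ 2 <= 1 -> cl /\ lo <= s <= hi.
Hypothesis Cin : cl -> lo <= s <= hi -> t ^+ 2 <= 1.
Hypothesis opn : t ^+ 2 < 1 -> (0 < s -> lo < s) /\ (s < 1 -> s < hi).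

Let clip_between : 0 <= s <= 1 -> 0 < t ->
  if t < 1 then [/\ cl, lo <= s, s <= hi, 0 < s -> lo < s & s < 1 -> s < hi]
  else 1 < t /\ (cl -> s < lo \/ hi < s).
Proof.
move=> s01 t0; have tn := t1 s01; case: ltP => [h|h].
  have t2 : t ^+ 2 < 1 by rewrite expr2; nra.
  have [h1 /andP[h2 h3]] := inC s01 (ltW t2); have [h4 h5] := opn t2; split=> //.
have {}h : 1 < t by rewrite lt_neqAle eq_sym tn.
split=> // c; have [h1|h1] := ltP s lo; first by left.
have [h2|h2] := ltP hi s; first by right.
by exfalso; have := Cin c; rewrite h1 h2 => /(_ isT); rewrite expr2; nra.
Qed.

(** The line of the edge meets that of the ray at parameter [s] of the edge and coordinate [t] along
    the ray. The outward ray asks for [1 < t], the ray from the origin for [0 < t], and in between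
    the meeting point is in the disc, that is, [lo <= s <= hi]. Hypothesis [opn] settles the
    half-open ends: strictly inside the disc, [s] equals a clip bound only at an end of the edge. *)
Lemma clip_signs_pos :
  [&& 1 < t, 0 <= s & s < 1] || [&& t < 1, 1 <= s & s < 0] =
  ([&& 0 < t, 0 <= s & s < 1] || [&& t < 0, 1 <= s & s < 0]) (+)
  (cl && ([&& 0 < (hi - lo) * t, lo <= s & s < hi] || [&& (hi - lo) * t < 0, hi <= s & s < lo])).
Proof.
move: (lo0) (hi1) => lo0' hi1'.
have F (p q : R) : p < q -> (q <= s) && (s < p) = false.
  by move=> pq; apply/negbTE/negP => /andP[] h1 h2; lra.
rewrite !(F 0 1) ?ltr01 // !andbF !orbF.
have -> : cl && ([&& 0 < (hi - lo) * t, lo <= s & s < hi] || [&& (hi - lo) * t < 0, hi <= s & s < lo])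
  = [&& 0 < t, cl, lo <= s & s < hi].
  case c : cl => //=; last by rewrite andbF.
  have le := cl_le c; rewrite (_ : (hi <= s) && (s < lo) = false) ?andbF ?orbF; last first.
    by apply/negbTE/negP => /andP[] h1 h2; lra.
  have [h1|h1] := leP lo s => /=; last by rewrite !andbF.
  have [h2|h2] := ltP s hi => /=; last by rewrite !andbF.
  by rewrite !andbT pmulr_rgt0 //; lra.
have [s0|s0] := leP 0 s; last first.
  rewrite /= !andbF /=; apply/esym/negbTE/negP => /and4P[_ _ h1 h2]. lra.
have [s1|s1] := ltP s 1; last first.
  rewrite /= !andbF /=; apply/esym/negbTE/negP => /and4P[_ _ h1 h2]; lra.
rewrite /= !andbT; have [t0|t0] := ltP 0 t; last by rewrite /=; apply/negbTE; rewrite -leNgt; lra.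
have s01 : 0 <= s <= 1 by rewrite s0 ltW.
have := clip_between s01 t0; case: ltP => h.
  by move=> [-> -> _ _ /(_ s1) ->] /=; apply/negbTE; rewrite -leNgt ltW.
case=> -> hc /=; apply/esym/negP => /and3P[c h1 h2].
by case: (hc c) => h3; lra.
Qed.

(** The opposite orientation of the edge, where the half-open interval of parameters is closed at
    the other end. *)
Lemma clip_signs_neg :
  [&& t < 1, s <= 0 & 1 < s] || [&& 1 < t, s <= 1 & 0 < s] =
  ([&& t < 0, s <= 0 & 1 < s] || [&& 0 < t, s <= 1 & 0 < s]) (+)
  (cl && ([&& (hi - lo) * t < 0, s <= lo & hi < s] || [&& 0 < (hi - lo) * t, s <= hi & lo < s])).
Proof.
move: (lo0) (hi1) => lo0' hi1'.
have F (p q : R) : p < q -> (s <= p) && (q < s) = false.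
  by move=> pq; apply/negbTE/negP => /andP[] h1 h2; lra.
rewrite !(F 0 1) ?ltr01 // !andbF !orFb.
have -> : cl && ([&& (hi - lo) * t < 0, s <= lo & hi < s] || [&& 0 < (hi - lo) * t, s <= hi & lo < s])
  = [&& 0 < t, cl, s <= hi & lo < s].
  case c : cl => //=; last by rewrite andbF.
  have le := cl_le c; rewrite (_ : (s <= lo) && (hi < s) = false) ?andbF ?orFb; last first.
    by apply/negbTE/negP => /andP[] h1 h2; lra.
  have [h1|h1] := leP s hi => /=; last by rewrite !andbF.
  have [h2|h2] := ltP lo s => /=; last by rewrite !andbF.
  by rewrite !andbT pmulr_rgt0 //; lra.
have [s0|s0] := ltP 0 s; last first.
  rewrite /= !andbF /=; apply/esym/negbTE/negP => /and4P[_ _ h1 h2]; lra.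
have [s1|s1] := leP s 1; last first.
  rewrite /= !andbF /=; apply/esym/negbTE/negP => /and4P[_ _ h1 h2]; lra.
rewrite /= !andbT; have [t0|t0] := ltP 0 t; last by rewrite /=; apply/negbTE; rewrite -leNgt; lra.
have s01 : 0 <= s <= 1 by rewrite s1 ltW.
have := clip_between s01 t0; case: ltP => h.
  by move=> [-> _ -> /(_ s0) -> _] /=; apply/negbTE; rewrite -leNgt ltW.
case=> -> hc /=; apply/esym/negP => /and3P[c h1 h2].
by case: (hc c) => h3; lra.
Qed.

End ClipSigns.

(** * The part of an edge in the unit disc *)

Section Clip.
Variable R : realType.
Implicit Types (u v w a b x y z : R * R) (s t th : R).

Definition along a b t : R * R := a + t *: (b - a).

(** A quarter of the discriminant of the quadratic equation in [t] saying that the point at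
    parameter [t] is on the unit circle; [disc_lo] and [disc_hi] are its roots. *)
Definition disc_coef a b := let d := b - a in dot a d * dot a d - dot d d * (dot a a - 1).
Definition disc_lo a b := let d := b - a in (- dot a d - Num.sqrt (disc_coef a b)) / dot d d.
Definition disc_hi a b := let d := b - a in (- dot a d + Num.sqrt (disc_coef a b)) / dot d d.
Definition clip_lo a b := if disc_lo a b < 0 then 0 else disc_lo a b.
Definition clip_hi a b := if 1 < disc_hi a b then 1 else disc_hi a b.
Definition clipped a b := ~~ (disc_coef a b < 0) && ~~ (clip_hi a b < clip_lo a b).
Definition clip_p a b := along a b (clip_lo a b).
Definition clip_q a b := along a b (clip_hi a b).

Lemma dot_dir_gt0 a b : a != b -> 0 < dot (b - a) (b - a).
Proof. by move=> ab; apply: dot_gt0; rewrite subr_eq0 eq_sym. Qed.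

Lemma disc_factor a b t : a != b -> 0 <= disc_coef a b ->
  dot (along a b t) (along a b t) - 1 =
  dot (b - a) (b - a) * ((t - disc_lo a b) * (t - disc_hi a b)).
Proof.
move=> ab D0; have q0 := dot_dir_gt0 ab; have qn : dot (b - a) (b - a) != 0 by rewrite gt_eqF.
have e : dot (along a b t) (along a b t) - 1 =
   dot (b - a) (b - a) * t ^+ 2 + 2 * dot a (b - a) * t + (dot a a - 1).
  by rewrite /along /dot /= /GRing.scale /=; ring.
have s2 := sqr_sqrtr D0.
rewrite e /disc_lo /disc_hi /=; move: s2; rewrite {2}/disc_coef /=.
set s := Num.sqrt _; move: (dot (b - a) (b - a)) (dot a (b - a)) (dot a a) qn => A B C qn s2.
have -> : A * ((t - (- B - s) / A) * (t - (- B + s) / A)) = ((A * t + B) ^+ 2 - s ^+ 2) / A.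
  by field.
by rewrite s2; field.
Qed.

(** The coefficient is a square plus a nonnegative multiple of [1 - dot x x], for [x] the point at
    parameter [t]. *)
Lemma disc_coef_ge0 a b t : dot (along a b t) (along a b t) <= 1 -> 0 <= disc_coef a b.
Proof.
have -> : disc_coef a b = (dot (b - a) (b - a) * t + dot a (b - a)) ^+ 2 +
   dot (b - a) (b - a) * (1 - dot (along a b t) (along a b t)).
  by rewrite /disc_coef /along /dot /= /GRing.scale /=; ring.
move=> h; apply: addr_ge0; first exact: sqr_ge0.
apply: mulr_ge0; last by rewrite subr_ge0.
by rewrite /dot -!expr2 addr_ge0 ?sqr_ge0.
Qed.

Lemma disc_lo_hi a b : a != b -> disc_lo a b <= disc_hi a b.
Proof.
move=> ab; have q0 := dot_dir_gt0 ab; rewrite /disc_lo /disc_hi /= ler_pM2r ?invr_gt0 //.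
by rewrite lerD2l; apply: (@le_trans _ _ 0); rewrite ?oppr_le0 sqrtr_ge0.
Qed.

Lemma in_disc a b t : a != b -> 0 <= disc_coef a b ->
  (dot (along a b t) (along a b t) <= 1) = (disc_lo a b <= t <= disc_hi a b).
Proof.
move=> ab D0; rewrite -subr_le0 disc_factor // pmulr_rle0 ?dot_dir_gt0 //.
have := disc_lo_hi ab; move: (disc_lo a b) (disc_hi a b) => p q pq.
apply/idP/andP => [h|[h1 h2]]; last by nra.
by split; rewrite leNgt; apply/negP => h1; nra.
Qed.

Lemma in_open_disc a b t : a != b -> 0 <= disc_coef a b ->
  (dot (along a b t) (along a b t) < 1) = (disc_lo a b < t < disc_hi a b).
Proof.
move=> ab D0; rewrite -subr_lt0 disc_factor // pmulr_rlt0 ?dot_dir_gt0 //.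
have := disc_lo_hi ab; move: (disc_lo a b) (disc_hi a b) => p q pq.
apply/idP/andP => [h|[h1 h2]]; last by nra.
by split; rewrite ltNge; apply/negP => h1; nra.
Qed.

Lemma clip_lo_ge a b : 0 <= clip_lo a b /\ disc_lo a b <= clip_lo a b.
Proof. by rewrite /clip_lo; case: ltP => h; split=> //; exact: ltW. Qed.

Lemma clip_hi_le a b : clip_hi a b <= 1 /\ clip_hi a b <= disc_hi a b.
Proof. by rewrite /clip_hi; case: ltP => h; split=> //; exact: ltW. Qed.

Lemma clip_range a b t : 0 <= t <= 1 ->
  (clip_lo a b <= t <= clip_hi a b) = (disc_lo a b <= t <= disc_hi a b).
Proof.
move=> /andP[t0 t1]; rewrite /clip_lo /clip_hi; congr (_ && _).
  by case: ltP => h; rewrite ?t0; apply/esym; lra.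
by case: ltP => h; rewrite ?t1; apply/esym; lra.
Qed.

Lemma along_range a b t : clipped a b -> clip_lo a b <= t <= clip_hi a b -> 0 <= t <= 1.
Proof.
move=> _ /andP[h1 h2]; have [c0 _] := clip_lo_ge a b; have [c1 _] := clip_hi_le a b.
by apply/andP; split; lra.
Qed.

(** An edge parallel to [u] is never crossed. Otherwise division by [c], the change of [cross u]
    along the edge, turns all sign conditions into conditions on [s] and [t], one case for each sign
    of [c]. *)
Lemma hits_far u a b : dot u u = 1 -> (forall t, 0 <= t <= 1 -> along a b t <> u) ->
  a != b -> hits u (a - u) (b - u) = hits u a b (+) (clipped a b && hits u (clip_p a b) (clip_q a b)).
Proof.
move=> u1 nu ab.
have u0 : u != 0 by apply/eqP => h; move/eqP: u1; rewrite h /dot /= !mul0r addr0 eq_sym oner_eq0.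
have e1 v : cross u (v - u) = cross u v by rewrite /cross /=; ring.
have e2 : cross (a - u) (b - u) = cross a b - (cross u b - cross u a) by rewrite /cross /=; ring.
have ct t : cross u (along a b t) = (1 - t) * cross u a + t * cross u b.
  by rewrite /cross /= /GRing.scale /=; ring.
have cpq : cross (clip_p a b) (clip_q a b) = (clip_hi a b - clip_lo a b) * cross a b.
  by rewrite /clip_p /clip_q /along /cross /= /GRing.scale /=; ring.
have [lo0 _] := clip_lo_ge a b; have [hi1 _] := clip_hi_le a b.
have inC t : dot (along a b t) (along a b t) <= 1 -> 0 <= t <= 1 -> clipped a b /\ clip_lo a b <= t <= clip_hi a b.
  move=> h t01; have D0 := disc_coef_ge0 h; rewrite in_disc // in h.
  rewrite -clip_range // in h; rewrite /clipped -!leNgt D0 h; split=> //=.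
  by case/andP: h; exact: le_trans.
have Cin t : clipped a b -> clip_lo a b <= t <= clip_hi a b -> dot (along a b t) (along a b t) <= 1.
  move=> cl h; have t01 := along_range cl h; rewrite clip_range // in h.
  by case/andP: cl; rewrite -leNgt => D0 _; rewrite in_disc.
have cu t : cross u (along a b t) = cross u a + t * (cross u b - cross u a) by rewrite ct; ring.
have cl_le : clipped a b -> clip_lo a b <= clip_hi a b by case/andP => _; rewrite -leNgt.
rewrite /hits !e1 e2 cpq /clip_p /clip_q !cu.
have [c0|cn] := eqVneq (cross u b - cross u a) 0.
  move/eqP: c0; rewrite subr_eq0 => /eqP ->.
  by rewrite subrr !mulr0 !addr0 !leNgt !andNb /= !andbF; case: (clipped a b).
pose c := cross u b - cross u a; pose s := - cross u a / c; pose t := cross a b / c.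
have sc : s * c = - cross u a by rewrite /s divfK.
have tc : cross a b = t * c by rewrite /t divfK.
have Xs : along a b s = t *: u.
  have u1' := u1; rewrite /dot in u1'.
  apply: plane_eq; rewrite /= /GRing.scale /=; apply: (mulIf cn); rewrite -/c.
    have -> : (a.1 + s * (b.1 - a.1)) * c = a.1 * c + (s * c) * (b.1 - a.1) by ring.
    rewrite sc mulrAC -tc /c /cross; ring.
  have -> : (a.2 + s * (b.2 - a.2)) * c = a.2 * c + (s * c) * (b.2 - a.2) by ring.
  rewrite sc mulrAC -tc /c /cross; ring.
have Xd : dot (along a b s) (along a b s) = t ^+ 2.
  by rewrite Xs; 
  have -> : dot (t *: u) (t *: u) = t ^+ 2 * dot u u by [rewrite /dot /= /GRing.scale /=; ring]; rewrite u1 mulr1.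
have loE : cross u a + clip_lo a b * (cross u b - cross u a) = (clip_lo a b - s) * c.
  by rewrite mulrBl sc opprK addrC.
have hiE : cross u a + clip_hi a b * (cross u b - cross u a) = (clip_hi a b - s) * c.
  by rewrite mulrBl sc opprK addrC.
have aE : cross u a = (0 - s) * c by rewrite mulrBl mul0r sc; ring.
have bE : cross u b = (1 - s) * c by rewrite mulrBl mul1r sc /c; ring.
have tE : cross a b - (cross u b - cross u a) = (t - 1) * c by rewrite tc mulrBl mul1r.
have pE : (clip_hi a b - clip_lo a b) * cross a b = (clip_hi a b - clip_lo a b) * t * c by rewrite tc mulrA.
have t1 : 0 <= s <= 1 -> t != 1.
  by move=> s01; apply/eqP => t1; apply: (nu s s01); rewrite Xs t1 scale1r.
have inC' : 0 <= s <= 1 -> t ^+ 2 <= 1 -> clipped a b /\ clip_lo a b <= s <= clip_hi a b.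
  by move=> s01; rewrite -Xd => h; exact: inC.
have Cin' : clipped a b -> clip_lo a b <= s <= clip_hi a b -> t ^+ 2 <= 1.
  by rewrite -Xd; exact: Cin.
have opn : t ^+ 2 < 1 -> (0 < s -> clip_lo a b < s) /\ (s < 1 -> s < clip_hi a b).
  rewrite -Xd => h; have D0 := disc_coef_ge0 (ltW h); move: h; rewrite in_open_disc // => /andP[h1 h2].
  by split=> h3; rewrite /clip_lo /clip_hi; case: ifP.
rewrite loE hiE tE pE aE bE tc.
move: cn; rewrite -/c.
move: (clip_lo a b) (clip_hi a b) (clipped a b) cl_le lo0 hi1 t1 inC' Cin' opn.
clear; move: c s t => c s t lo hi cl.
move=> cl_le lo0 hi1 t1 inC Cin opn cn.
have [c0|c0|c0] := ltrgtP c 0; last by rewrite c0 eqxx in cn.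
  rewrite !(nmulr_llt0 _ c0) !(nmulr_lgt0 _ c0) !(nmulr_lle0 _ c0) !subr_gt0 !subr_lt0 !subr_ge0.
  exact: clip_signs_neg.
rewrite !(pmulr_llt0 _ c0) !(pmulr_lgt0 _ c0) !(pmulr_lle0 _ c0) !subr_gt0 !subr_lt0 !subr_le0.
exact: clip_signs_pos.
Qed.

(* Times of the events caused by the edge [a, b]: the first four toggle the
   parity of the crossings of the outward ray, the last two are the moments when
   the point is on the edge.  [2 * pi] means that there is no event. *)
Definition edge_key a b (c : nat) : R :=
  match c with
  | 0 => turn_key a b
  | 1 => turn_key b a
  | 2 => if clipped a b then turn_key (clip_p a b) (clip_q a b) else 2 * pi
  | 3 => if clipped a b then turn_key (clip_q a b) (clip_p a b) else 2 * pi
  | 4 => if clipped a b && ~~ (disc_lo a b < 0) then ang (clip_p a b) else 2 * pi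
  | _ => if clipped a b && ~~ (1 < disc_hi a b) then ang (clip_q a b) else 2 * pi
  end.

Definition edge_start a b : bool :=
  starts a b (+) (clipped a b && starts (clip_p a b) (clip_q a b)).

Lemma hits_edge_keys th a b : 0 <= th < 2 * pi -> a != b ->
  (forall t, 0 <= t <= 1 -> along a b t <> dir th) ->
  hits (dir th) (a - dir th) (b - dir th) =
  edge_start a b (+) \big[addb/false]_(c < 4) (edge_key a b c <= th).
Proof.
move=> hth ab nth_; rewrite hits_far ?dot_dir // hits_turn // !big_ord_recl big_ord0 /= /edge_start.
have far : (2 * pi <= th) = false by apply/negbTE; rewrite -ltNge; case/andP: hth.
case: (clipped a b) => /=; rewrite ?far ?hits_turn //.
  move: (starts a b) (starts (clip_p a b) (clip_q a b)) => b1 b2.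
  move: (turn_key a b <= th) (turn_key b a <= th) => b3 b4.
  move: (turn_key (clip_p a b) _ <= th) (turn_key (clip_q a b) _ <= th) => b5 b6.
  by case: b1 b2 b3 b4 b5 b6 => [] [] [] [] [] [].
by rewrite !addbF.
Qed.

(** A point of the edge on the unit circle has a root as parameter. The tests in keys 4 and 5
    discard a root outside [[0, 1]], for which the clip bound is an end of the edge instead. *)
Lemma edge_key_mark th a b : 0 <= th < 2 * pi -> a != b ->
  (exists2 t, 0 <= t <= 1 & dir th = along a b t) <->
  (edge_key a b 4 = th \/ edge_key a b 5 = th).
Proof.
move=> hth ab; have th2 : 2 * pi <> th by move=> e; move: hth; rewrite -e ltxx andbF.
have unit t : along a b t != 0 -> dot (along a b t) (along a b t) = 1 ->
    ang (along a b t) = th -> dir th = along a b t.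
  by move=> h0 h1 <-; rewrite -ang_unit.
have on t : 0 <= disc_coef a b -> t = disc_lo a b \/ t = disc_hi a b ->
    dot (along a b t) (along a b t) = 1.
  move=> D0 h; apply/eqP; rewrite -subr_eq0 disc_factor //.
  by case: h => ->; rewrite subrr ?mul0r ?mulr0.
have nz t : dot (along a b t) (along a b t) = 1 -> along a b t != 0.
  by move=> h; apply/eqP => h0; move/eqP: h; rewrite h0 /dot /= !mul0r addr0 eq_sym oner_eq0.
rewrite /=; split=> [[t t01 e]|].
  have d1 : dot (along a b t) (along a b t) = 1 by rewrite -e dot_dir.
  have D0 : 0 <= disc_coef a b by apply: (@disc_coef_ge0 _ _ t); rewrite d1.
  have inn : clip_lo a b <= t <= clip_hi a b by rewrite clip_range // -in_disc // d1.
  have cl : clipped a b.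
    by rewrite /clipped -!leNgt D0 /=; case/andP: inn; exact: le_trans.
  have : dot (b - a) (b - a) * ((t - disc_lo a b) * (t - disc_hi a b)) = 0.
    by rewrite -disc_factor // d1 subrr.
  move/eqP; rewrite !mulf_eq0 (gt_eqF (dot_dir_gt0 ab)) /= !subr_eq0; case/andP: t01 => t0 t1.
  rewrite cl /=; case/orP => /eqP tE.
    left; rewrite -tE ltNge t0 /=; rewrite /clip_p /clip_lo -tE ltNge t0 /= -e.
    exact: ang_dir.
  right; rewrite -tE ltNge t1 /=; rewrite /clip_q /clip_hi -tE ltNge t1 /= -e.
  exact: ang_dir.
case=> h.
  move: h; case: ifP => // /andP[cl]; rewrite /clip_p /clip_lo => /negbTE lo0.
  case/andP: (cl); rewrite -!leNgt => D0 le; rewrite lo0 => h.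
  exists (disc_lo a b); last by apply: unit => //; [apply: nz|]; apply: on => //; left.
  apply: (along_range cl); rewrite /clip_lo lo0 lexx /=; move: le; by rewrite /clip_lo lo0.
move: h; case: ifP => // /andP[cl]; rewrite /clip_q /clip_hi => /negbTE hi0.
case/andP: (cl); rewrite -!leNgt => D0 le; rewrite hi0 => h.
exists (disc_hi a b); last by apply: unit => //; [apply: nz|]; apply: on => //; right.
apply: (along_range cl); rewrite /clip_hi hi0 lexx andbT; move: le; by rewrite /clip_hi hi0.
Qed.

End Clip.

(** * The objective as a function of the events *)

Section Blocks.
Variables (T : Type) (idx : T) (op : Monoid.law idx).

Lemma big_nat_blocks n l (F : nat -> T) :
  \big[op/idx]_(0 <= j < n * l) F j =
  \big[op/idx]_(0 <= k < n) \big[op/idx]_(0 <= c < l) F (k * l + c)%N.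
Proof.
rewrite big_nat_mul; apply: eq_bigr => k _.
rewrite -{1}[(k * l)%N]add0n big_addn mulSn addnK.
by apply: eq_bigr => c _; rewrite addnC.
Qed.

End Blocks.

Section Sweep.
Variables (R : realType) (n l : nat) (tog : pred nat) (key : nat -> R) (start : pred nat).

(* Event [j] belongs to the point [j %/ l]. *)
Definition parity_upto (D : pred nat) k : bool :=
  start k (+) \big[addb/false]_(0 <= j < n * l) [&& tog j, (j %/ l == k)%N & D j].

Definition marked (D : pred nat) k : bool :=
  has (fun j => [&& ~~ tog j, (j %/ l == k)%N & D j]) (iota 0 (n * l)).

(** The region is closed, so contact with the boundary at the very angle [th] counts whatever the
    parity. *)
Definition inside k (th : R) : bool :=
  parity_upto (fun j => key j <= th) k || marked (fun j => key j == th) k.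

Definition value (th : R) : nat := \sum_(0 <= k < n) inside k th.

End Sweep.

Section Covered.
Variable R : realType.
Implicit Types (u v w a b x y z r : R * R) (s t th : R).

Definition cmul w v : R * R := (w.1 * v.1 - w.2 * v.2, w.1 * v.2 + w.2 * v.1).
(** The complex quotient of [v] by [w]: [dot] and [cross] are the real and imaginary parts of [v]
    times the conjugate of [w]. *)
Definition cdiv w v : R * R := (dot w v / dot w w, cross w v / dot w w).

Lemma cdivK w v : w != 0 -> cmul w (cdiv w v) = v.
Proof.
move=> w0; have ww : dot w w != 0 by rewrite gt_eqF // dot_gt0.
by apply: plane_eq; move: ww; rewrite /cmul /cdiv /dot /cross /= => ww; field.
Qed.

Lemma hits_cmul w u a b : w != 0 -> hits (cmul w u) (cmul w a) (cmul w b) = hits u a b.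
Proof.
move=> w0; have ww := dot_gt0 w0.
have e x y : cross (cmul w x) (cmul w y) = dot w w * cross x y.
  by rewrite /cross /cmul /dot /=; ring.
by rewrite /hits !e !(pmulr_rgt0 _ ww) !(pmulr_rlt0 _ ww) !(pmulr_rle0 _ ww).
Qed.

Variables (n m : nat) (S : n.-tuple (R * R)) (P : m.-tuple (R * R)) (r : R * R).
Hypothesis simple : simple_polygon P.
Hypothesis m0 : (0 < m)%N.

Definition succ_index i := if (i.+1 < m)%N then i.+1 else 0%N.
Definition arm k := nth 0 S k - r.
(* Complex division by [arm k] turns the [k]-th point, seen from the polygon
   rotated by [th], into [dir th]. *)
Definition end1 k i := cdiv (arm k) (nth 0 P i - r).
Definition end2 k i := cdiv (arm k) (nth 0 P (succ_index i) - r).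

(** Event [j] is number [j %% 6] of the pair [j %/ 6]; the pairs of a point and an edge are in
    row-major order. *)
Definition event_key j : R :=
  let q := (j %/ 6)%N in let k := (q %/ m)%N in
  if arm k == 0 then 2 * pi else edge_key (end1 k (q %% m)) (end2 k (q %% m)) (j %% 6).

Definition point_start k : bool :=
  (arm k != 0) && \big[addb/false]_(0 <= i < m) edge_start (end1 k i) (end2 k i).

Definition is_toggle j := (j %% 6 < 4)%N.

Definition the_value := value n (m * 6) is_toggle event_key point_start.

(** Turning clockwise by [th] undoes the factor [dir th]. A fixed point against the rotated polygon
    thus becomes a moving point against [P] itself. *)
Lemma rot_cw_arm k th : rot_cw r th (r + cmul (arm k) (dir th)) = nth 0 S k.
Proof.
have c := cos2Dsin2 th; rewrite !expr2 in c.
apply: plane_eq; rewrite /rot_cw /cmul /dir /= [r.1 + _ - r.1]addrC addKr [r.2 + _ - r.2]addrC addKr.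
  transitivity (r.1 + (cos th * cos th + sin th * sin th) * ((nth 0 S k).1 - r.1)); first by ring.
  by rewrite c; ring.
transitivity (r.2 + (cos th * cos th + sin th * sin th) * ((nth 0 S k).2 - r.2)); first by ring.
by rewrite c; ring.
Qed.

Lemma rot_cw_inj th : injective (rot_cw r th).
Proof.
move=> x y [e1 e2]; have c := cos2Dsin2 th; rewrite !expr2 in c.
have {}e1 : cos th * (x.1 - y.1) + sin th * (x.2 - y.2) = 0.
  by move: e1 => /eqP; rewrite -subr_eq0 => /eqP <-; ring.
have {}e2 : - sin th * (x.1 - y.1) + cos th * (x.2 - y.2) = 0.
  by move: e2 => /eqP; rewrite -subr_eq0 => /eqP <-; ring.
apply: plane_eq; apply/eqP; rewrite -subr_eq0; apply/eqP.
  transitivity ((cos th * cos th + sin th * sin th) * (x.1 - y.1)); first by rewrite c mul1r.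
  transitivity (cos th * (cos th * (x.1 - y.1) + sin th * (x.2 - y.2)) -
    sin th * (- sin th * (x.1 - y.1) + cos th * (x.2 - y.2))); first by ring.
  by rewrite e1 e2 !mulr0 subrr.
transitivity ((cos th * cos th + sin th * sin th) * (x.2 - y.2)); first by rewrite c mul1r.
transitivity (sin th * (cos th * (x.1 - y.1) + sin th * (x.2 - y.2)) +
  cos th * (- sin th * (x.1 - y.1) + cos th * (x.2 - y.2))); first by ring.
by rewrite e1 e2 !mulr0 addr0.
Qed.

Lemma mem_rot_region k th :
  (nth 0 S k \in rot_cw r th @` region P) = (r + cmul (arm k) (dir th) \in region P).
Proof.
apply/idP/idP; rewrite !inE => h.
  case: h => x hx; rewrite -(rot_cw_arm k th) => /rot_cw_inj <-; exact: hx.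
by exists (r + cmul (arm k) (dir th)) => //; exact: rot_cw_arm.
Qed.

Lemma tnth_succ (i : 'I_m) : tnth P (ordS i) = nth 0 P (succ_index i).
Proof.
rewrite (tnth_nth 0) /succ_index /=; case: ltnP => h; first by rewrite modn_small.
have -> : i.+1 = m by apply/eqP; rewrite eqn_leq ltn_ord.
by rewrite modnn.
Qed.

Lemma cmul_inj w : w != 0 -> injective (cmul w).
Proof.
move=> w0 x y e; rewrite -[x]scale1r -[y]scale1r.
have ww : dot w w != 0 by rewrite gt_eqF // dot_gt0.
rewrite -(mulVf ww) -!scalerA; congr (_ *: _).
case: e => e1 e2; apply: plane_eq; rewrite /dot /= /GRing.scale /=.
  transitivity (w.1 * (w.1 * x.1 - w.2 * x.2) + w.2 * (w.1 * x.2 + w.2 * x.1)); first by ring.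
  by rewrite e1 e2; ring.
transitivity (w.1 * (w.1 * x.2 + w.2 * x.1) - w.2 * (w.1 * x.1 - w.2 * x.2)); first by ring.
by rewrite e1 e2; ring.
Qed.

Lemma big_addb_single l0 (F : nat -> bool) k : (k < l0)%N ->
  \big[addb/false]_(0 <= j < l0) ((j == k) && F j) = F k.
Proof.
move=> h; rewrite big_mkord (bigD1 (Ordinal h)) //= eqxx big1 ?addbF // => i ik.
by have -> : (i == k :> nat) = false by apply/negbTE.
Qed.

Lemma event_index k i c : (i < m)%N -> (c < 6)%N -> let j := (k * (m * 6) + (i * 6 + c))%N in
  [/\ (j %/ (m * 6) = k)%N, (j %/ 6 %/ m = k)%N, (j %/ 6 %% m = i)%N & (j %% 6 = c)%N].
Proof.
move=> im c6 j; have jE : j = ((k * m + i) * 6 + c)%N by rewrite /j mulnA mulnDl addnA.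
have j6 : (j %/ 6 = k * m + i)%N by rewrite jE divnMDl // (divn_small c6) addn0.
have jk : (j %/ 6 %/ m = k)%N by rewrite j6 divnMDl // divn_small ?addn0.
split=> //; first by rewrite mulnC divnMA.
  by rewrite j6 modnMDl modn_small.
by rewrite jE modnMDl modn_small.
Qed.

Lemma tnth1 (i : 'I_m) : tnth P i = nth 0 P i. Proof. exact: tnth_nth. Qed.

Section Point.
Variables (k : nat) (th : R).
Hypothesis w0 : arm k != 0.
Hypothesis hth : 0 <= th < 2 * pi.
Let w := arm k.
Let x := r + cmul w (dir th).

Lemma end_neq (i : 'I_m) : end1 k i != end2 k i.
Proof.
apply/negP => /eqP e; have := edge_dir_neq0 simple i.
rewrite tnth_succ tnth1 subr_eq0 => /eqP; apply.
apply: (addIr (- r)); rewrite -(cdivK (nth 0 P (succ_index i) - r) w0) -(cdivK (nth 0 P i - r) w0).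
by congr cmul; rewrite -/(end1 k i) e.
Qed.

Lemma edge_pt_along (i : 'I_m) t : edge_pt P i t = r + cmul w (along (end1 k i) (end2 k i) t).
Proof.
have e1 := cdivK (nth 0 P i - r) w0; have e2 := cdivK (nth 0 P (succ_index i) - r) w0.
rewrite /edge_pt tnth_succ tnth1.
have -> : cmul w (along (end1 k i) (end2 k i) t) =
  cmul w (end1 k i) + t *: (cmul w (end2 k i) - cmul w (end1 k i)).
  by apply: plane_eq; rewrite /cmul /along /= /GRing.scale /=; ring.
rewrite /end1 /end2 -/w e1 e2; apply: plane_eq; rewrite /= /GRing.scale /=; ring.
Qed.

Lemma boundary_along : boundary P x <-> exists (i : 'I_m) (t : R), 0 <= t <= 1 /\ dir th = along (end1 k i) (end2 k i) t.
Proof.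
split=> [[i [t t01]]|[i [t [t01 e]]]].
  by rewrite edge_pt_along => /addrI /(cmul_inj w0) e; exists i, t.
by exists i; exists t => //; rewrite edge_pt_along -e.
Qed.

Lemma boundary_marked : (k < n)%N -> boundary P x <-> marked n (m * 6) is_toggle (fun j => event_key j == th) k.
Proof.
move=> kn; rewrite boundary_along; split=> [[i [t [t01 e]]]|/hasP[j]].
  have /(edge_key_mark hth (end_neq i)) h : exists2 t, 0 <= t <= 1 & dir th = along (end1 k i) (end2 k i) t.
    by exists t.
  have [c c6 [c4 hc]] : exists2 c, (c < 6)%N & (4 <= c)%N /\ edge_key (end1 k i) (end2 k i) c = th.
    by case: h => h; [exists 4%N|exists 5%N].
  have [j1 j2 j3 j4] := event_index k (ltn_ord i) c6.
  apply/hasP; exists (k * (m * 6) + (i * 6 + c))%N.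
    rewrite mem_iota add0n /=; apply: (@leq_trans (k.+1 * (m * 6))); last by rewrite leq_mul2r kn orbT.
    rewrite mulSn [X in (_ < X)%N]addnC ltn_add2l; apply: (@leq_trans (i.+1 * 6)).
      by rewrite mulSn addnC ltn_add2r.
    by rewrite leq_mul2r ltn_ord.
  by rewrite /is_toggle /event_key j1 j2 j3 j4 eqxx -leqNgt c4 (negbTE w0) hc eqxx.
rewrite mem_iota add0n => /= jN /and3P[tj /eqP jk /eqP].
have kE : (j %/ 6 %/ m = k)%N by rewrite -divnMA mulnC.
rewrite /event_key kE (negbTE w0) => hj.
pose i := Ordinal (ltn_pmod (j %/ 6) m0).
have h : edge_key (end1 k i) (end2 k i) 4 = th \/ edge_key (end1 k i) (end2 k i) 5 = th.
  move: tj hj; rewrite /is_toggle -leqNgt /=; have := ltn_pmod j (isT : (0 < 6)%N).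
  by case: (j %% 6)%N => [|[|[|[|[|[|]]]]]] //= _ _ ->; [left|right].
have [t t01 e] := (edge_key_mark hth (end_neq i)).2 h.
by exists i, t.
Qed.

(** The ray points away from [r]; dividing by [w] makes it, edge by edge, the ray from [dir th] away
    from the origin. *)
Lemma par_parity : (k < n)%N -> ~ boundary P x ->
  par P (cmul w (dir th)) x = parity_upto n (m * 6) is_toggle point_start (fun j => event_key j <= th) k.
Proof.
move=> kn nb; rewrite /parity_upto big_nat_blocks.
rewrite (eq_big_nat _ _ (F2 := fun k' => (k' == k) && \big[addb/false]_(0 <= i < m)
   \big[addb/false]_(0 <= c < 4) (edge_key (end1 k i) (end2 k i) c <= th))); last first.
  move=> k' _; have [->|kk] := eqVneq k' k; last first.
    apply: big1_seq => c; rewrite mem_index_iota => /andP[_ cl].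
    have ml : (0 < m * 6)%N by apply: leq_ltn_trans cl.
    by rewrite divnMDl // divn_small // addn0 (negbTE kk) andbF.
  rewrite big_nat_blocks; apply: eq_big_nat => i /andP[_ im] /=.
  rewrite (@big_cat_nat _ _ _ 4 0 6) //= [X in _ (+) X]big1_seq ?addbF; last first.
    move=> c; rewrite mem_index_iota => /andP[_ /andP[c4 c6]].
    by have [j1 j2 j3 j4] := event_index k im c6; rewrite /is_toggle j4 ltnNge c4.
  apply: eq_big_nat => c /andP[_ c4]; have c6 : (c < 6)%N by apply: leq_trans c4 _.
  have [j1 j2 j3 j4] := event_index k im c6.
  by rewrite /is_toggle /event_key j1 j2 j3 j4 c4 eqxx (negbTE w0).
rewrite (big_addb_single (fun=> _)) // /point_start w0 /= -big_split /= big_mkord /par.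
apply: eq_bigr => i _.
have sub v : v - x = cmul w (cdiv w (v - r) - dir th).
  have -> : cmul w (cdiv w (v - r) - dir th) = cmul w (cdiv w (v - r)) - cmul w (dir th).
    by apply: plane_eq; rewrite /cmul /=; ring.
  by rewrite cdivK // /x opprD addrA.
rewrite !sub hits_cmul // tnth_succ tnth1 (hits_edge_keys hth (end_neq i)) ?big_mkord //.
by move=> t t01 e; apply: nb; apply/boundary_along; exists i, t.
Qed.

Lemma inside_region : (k < n)%N ->
  (x \in region P) = inside n (m * 6) is_toggle event_key point_start k th.
Proof.
move=> kn; rewrite /inside; have [bx|bx] := pselect (boundary P x).
  by rewrite (boundary_marked kn).1 // orbT; apply/mem_set; left.
have -> : marked n (m * 6) is_toggle (fun j => event_key j == th) k = false.
  by apply/negP => /(boundary_marked kn).2.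
rewrite orbF -par_parity //.
have u0 : cmul w (dir th) != 0.
  apply/eqP => h; have : cmul w (dir th) = cmul w 0 by rewrite h; apply: plane_eq; rewrite /cmul /= !mulr0 ?subrr ?addr0.
  by move/(cmul_inj w0) => h'; have := dir_neq0 th; rewrite h' eqxx.
have := region_par simple u0 m0 bx; case: (par _ _ _) => h.
  by apply/mem_set; exact: h.2.
by apply/negP => /set_mem /h.1.
Qed.

End Point.

Lemma inside_center k th : (k < n)%N -> arm k == 0 -> 0 <= th < 2 * pi ->
  inside n (m * 6) is_toggle event_key point_start k th = false.
Proof.
move=> kn w0 hth; have key2 j : (j %/ (m * 6) == k)%N -> event_key j = 2 * pi.
  by move=> /eqP jk; rewrite /event_key -divnMA [(6 * m)%N]mulnC jk w0.
have far : (2 * pi <= th) = false by apply/negbTE; rewrite -ltNge; case/andP: hth.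
rewrite /inside /parity_upto /point_start w0 /= big1 => [|j _].
  apply/negbTE/hasPn => j _; apply/negP => /and3P[_ /key2 -> /eqP e].
  by move: hth; rewrite -e ltxx andbF.
by case: eqP => [/eqP/key2 ->|_]; rewrite ?far ?andbF.
Qed.

(** Points at [r] are fixed by all rotations and contribute a constant, so [covered] and [the_value]
    have the same maximisers. *)
Lemma coveredE th : 0 <= th < 2 * pi ->
  covered S P r th =
  (\sum_(0 <= k < n | arm k == 0%R) (r \in region P : nat) + the_value th)%N.
Proof.
move=> hth; rewrite /covered -sum1_count big_mkcond /= (big_nth 0) size_tuple.
rewrite /the_value /value (bigID (fun k => arm k == 0)) /= big_mkcond /=.
congr (_ + _)%N.
  rewrite [RHS]big_mkcond /=; apply: eq_big_nat => k /andP[_ kn].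
  case: ifP => // /eqP w0; have := mem_rot_region k th; rewrite w0.
  have -> : cmul 0 (dir th) = 0 by apply: plane_eq; rewrite /cmul /= !mul0r ?subrr ?addr0.
  by rewrite addr0 => ->; case: (_ \in _).
rewrite big_mkcond /=; apply: eq_big_nat => k /andP[_ kn].
case: (eqVneq (arm k) 0) => w0 /=; first by rewrite inside_center // w0.
by rewrite -inside_region // -mem_rot_region; case: (_ \in _).
Qed.

Lemma value_solution th : 0 <= th < 2 * pi ->
  (forall phi, 0 <= phi < 2 * pi -> (the_value phi <= the_value th)%N) ->
  fixed_mcr_solution S P r th.
Proof.
by move=> hth h; split=> // phi hphi; rewrite !coveredE // leq_add2l h.
Qed.

End Covered.

(** * Cost of programs *)

Section Logic.
Variables (R : realType) (M : nat).
Implicit Types (s : state R) (c : cmd) (Q : state R -> Prop).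
Local Open Scope nat_scope.

Definition runs c s (T : nat) Q := exists t s', [/\ exec M c s t s', t <= T & Q s'].

Lemma runs_weaken c s T T' Q Q' : runs c s T Q -> T <= T' -> (forall s', Q s' -> Q' s') -> runs c s T' Q'.
Proof. by move=> [t [s' [h1 h2 h3]]] h4 h5; exists t, s'; split; [|exact: leq_trans h4|exact: h5]. Qed.

Lemma runs_seq c1 c2 s T1 T2 Q1 Q : runs c1 s T1 Q1 -> (forall s', Q1 s' -> runs c2 s' T2 Q) ->
  runs (Seq c1 c2) s (T1 + T2) Q.
Proof.
move=> [t1 [s1 [h1 h2 h3]]] /(_ _ h3) [t2 [s2 [h4 h5 h6]]].
by exists (t1 + t2), s2; split=> //; [exact: ExSeq h1 h4|exact: leq_add].
Qed.

Lemma runs_if b c1 c2 s T Q :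
  (teval s b -> runs c1 s T Q) -> (~~ teval s b -> runs c2 s T Q) -> runs (If b c1 c2) s (tcost b + T).+1 Q.
Proof.
move=> h1 h2; case hb : (teval s b).
  have [t [s' [e1 e2 e3]]] := h1 hb; exists (tcost b + t).+1, s'; split=> //; first exact: ExIfTrue.
  by rewrite ltnS leq_add2l.
have nb : ~~ teval s b by rewrite hb.
have [t [s' [e1 e2 e3]]] := h2 nb; exists (tcost b + t).+1, s'; split=> //; first exact: ExIfFalse.
by rewrite ltnS leq_add2l.
Qed.

(** [k] bounds the number of rounds left: each round lowers it, and the test must fail at 0. *)
Lemma runs_while b c T (I : nat -> state R -> Prop) :
  (forall k s, I k s -> teval s b -> 0 < k /\ runs c s T (I k.-1)) ->
  forall k s, I k s ->
  runs (While b c) s (k * (tcost b + T).+1 + (tcost b).+1) (fun s' => ~~ teval s' b /\ exists k', I k' s').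
Proof.
move=> body; elim=> [|k IH] s Is; case hb : (teval s b).
- by have [] := body _ _ Is hb.
- exists (tcost b).+1, s; split=> //; first by apply: ExWhileDone; rewrite hb.
  by split; [rewrite hb|exists 0].
- have [_ [t [s1 [e1 e2 /IH[t' [s2 [e3 e4 e5]]]]]]] := body _ _ Is hb.
  exists (tcost b + t + t').+1, s2; split=> //; first exact: ExWhileStep e1 e3.
  by rewrite mulSn; move: (k * _) e2 e4; lia.
- exists (tcost b).+1, s; split=> //; first by apply: ExWhileDone; rewrite hb.
    by rewrite leq_addl.
  by split; [rewrite hb|exists k.+1].
Qed.

(* Each assigned value is abstracted by a variable, so that the symbolic
   states of straight-line code stay linear in its length. *)
Fixpoint wp c Q s : Prop :=
  match c with
  | Skip => Q s
  | Seq c1 c2 => wp c1 (wp c2 Q) s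
  | ISet x e => ieval s e < M /\ forall v, v = ieval s e -> Q (set_ireg s x v)
  | RSet x e => forall v, v = reval s e -> Q (set_rreg s x v)
  | ILoad x a => ieval s a < M /\ forall v, v = imem s (ieval s a) -> Q (set_ireg s x v)
  | RLoad x a => ieval s a < M /\ forall v, v = rmem s (ieval s a) -> Q (set_rreg s x v)
  | IStore a e => [/\ ieval s a < M, ieval s e < M & Q (set_imem s (ieval s a) (ieval s e))]
  | RStore a e => ieval s a < M /\ Q (set_rmem s (ieval s a) (reval s e))
  | If b c1 c2 => (teval s b -> wp c1 Q s) /\ (~~ teval s b -> wp c2 Q s)
  | While _ _ => False
  end.

(** An upper bound for straight-line code: the two branches of a conditional are added up. *)
Fixpoint cmd_cost c : nat :=
  match c with
  | Skip => 1
  | Seq c1 c2 => cmd_cost c1 + cmd_cost c2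
  | ISet _ e => (icost e).+1
  | RSet _ e => (rcost e).+1
  | ILoad _ a | RLoad _ a => (icost a).+1
  | IStore a e => (icost a + icost e).+1
  | RStore a e => (icost a + rcost e).+1
  | If b c1 c2 => (tcost b + (cmd_cost c1 + cmd_cost c2)).+1
  | While _ _ => 0
  end.

Lemma wp_runs c s Q : wp c Q s -> runs c s (cmd_cost c) Q.
Proof.
elim: c s Q => [|c1 IH1 c2 IH2|x e|x e|x a|x a|a e|a e|b c1 IH1 c2 IH2|b c _] s Q //=.
- by exists 1, s; split=> //; exact: ExSkip.
- by move=> /IH1 h; apply: runs_seq h _ => s' /IH2.
- by move=> [h1 h2]; eexists; eexists; split; [exact: ExISet|by []|exact: h2].
- by move=> h2; eexists; eexists; split; [exact: ExRSet|by []|exact: h2].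
- by move=> [h1 h2]; eexists; eexists; split; [exact: ExILoad|by []|exact: h2].
- by move=> [h1 h2]; eexists; eexists; split; [exact: ExRLoad|by []|exact: h2].
- by move=> [h1 h2 h3]; eexists; eexists; split; [exact: ExIStore|by []|exact: h3].
- by move=> [h1 h2]; eexists; eexists; split; [exact: ExRStore|by []|exact: h2].
- move=> [h1 h2]; apply: runs_if => [/h1 /IH1|/h2 /IH2] h; apply: runs_weaken h _ _ => //.
    exact: leq_addr.
  exact: leq_addl.
Qed.

Lemma wp_weaken c s Q Q' : wp c Q s -> (forall s', Q s' -> Q' s') -> wp c Q' s.
Proof.
elim: c s Q Q' => [|c1 IH1 c2 IH2|x e|x e|x a|x a|a e|a e|b c1 IH1 c2 IH2|b c _] s Q Q' //=.
- by move=> h hQ; exact: hQ.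
- by move=> h hQ; apply: IH1 h _ => s' h; apply: IH2 h _.
- by move=> [h1 h2] hQ; split=> // v hv; apply: hQ; exact: h2.
- by move=> h2 hQ v hv; apply: hQ; exact: h2.
- by move=> [h1 h2] hQ; split=> // v hv; apply: hQ; exact: h2.
- by move=> [h1 h2] hQ; split=> // v hv; apply: hQ; exact: h2.
- by move=> [h1 h2 h3] hQ; split=> //; exact: hQ.
- by move=> [h1 h2] hQ; split=> //; exact: hQ.
- by move=> [h1 h2] hQ; split=> h; [apply: IH1 (h1 h) _|apply: IH2 (h2 h) _].
Qed.

Lemma set_rreg2 s x v v' : set_rreg (set_rreg s x v) x v' = set_rreg s x v'.
Proof.
rewrite /set_rreg /=; congr (State _ _ _ _).
by apply/funext => y /=; case: eqP.
Qed.

Lemma set_rreg_id s x : set_rreg s x (rreg s x) = s.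
Proof.
case: s => a b c d; rewrite /set_rreg /=; congr (State _ _ _ _).
by apply/funext => y /=; case: eqP => // ->.
Qed.

Lemma set_ireg_id s x : set_ireg s x (ireg s x) = s.
Proof.
case: s => a b c d; rewrite /set_ireg /=; congr (State _ _ _ _).
by apply/funext => y /=; case: eqP => // ->.
Qed.

End Logic.

(** * Computation of the events *)

Section EdgeCode.
Local Open Scope nat_scope.

Definition RInt k := ROfInt (IConst k).
Definition angle_code x y z : cmd :=
  Seq (RSet z (RAcos (RDiv (RReg x) (RSqrt (RAdd (RMul (RReg x) (RReg x)) (RMul (RReg y) (RReg y)))))))
      (If (TRLt (RReg y) (RInt 0)) (RSet z (RSub (RMul (RInt 2) RPi) (RReg z))) Skip).

Definition two_pi := RMul (RInt 2) RPi.

Definition flip_code : cmd := ISet 10 (ISub (IConst 1) (IReg 10)).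

(** Real registers 43 to 46 hold [a] and [b], registers 22 and 23 receive their keys, and integer
    register 10 is flipped when [starts a b] holds. Reals can only be tested by [<], so vanishing is
    the failure of two strict comparisons. *)
Definition turn_code : cmd :=
  Seq (RSet 50 (RSub (RMul (RReg 43) (RReg 46)) (RMul (RReg 44) (RReg 45))))
 (Seq (If (TAnd (TNot (TRLt (RReg 50) (RInt 0))) (TNot (TRLt (RInt 0) (RReg 50))))
          (Seq (RSet 22 two_pi) (RSet 23 two_pi))
          (Seq (angle_code 43 44 22) (angle_code 45 46 23)))
      (If (TAnd (TRLt (RInt 0) (RReg 50)) (TAnd (TRLt (RReg 44) (RInt 0)) (TNot (TRLt (RReg 46) (RInt 0)))))
          flip_code
          (If (TAnd (TRLt (RReg 50) (RInt 0)) (TAnd (TRLt (RReg 46) (RInt 0)) (TNot (TRLt (RReg 44) (RInt 0)))))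
              flip_code Skip))).

Variables (R : realType) (M : nat).
Implicit Types (s : state R) (Q : state R -> Prop).

Lemma wp_angle x y z s Q : y != z ->
  (forall v, v = ang (rreg s x, rreg s y) -> Q (set_rreg s z v)) -> wp M (angle_code x y z) Q s.
Proof.
move=> yz h /= v ->; rewrite (negbTE yz) /= eqxx; split=> hy.
  by move=> v' ->; rewrite set_rreg2; apply: h; rewrite /ang /= hy.
by apply: h; rewrite /ang /= (negbTE hy).
Qed.

Definition turned a b s v0 : state R :=
  set_ireg (set_rreg (set_rreg (set_rreg s 50 v0) 22 (turn_key a b)) 23 (turn_key b a)) 10
    (starts a b (+) odd (ireg s 10) : nat).

Lemma turn_zero (a b : R * R) : (~~ (cross a b < 0)%R && ~~ (0 < cross a b)%R) = (cross a b == 0%R).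
Proof. by rewrite -!leNgt eq_le andbC. Qed.

Lemma turn_bit (b : bool) i : i < 2 -> (if b then 1 - i else i) = (b (+) odd i : nat).
Proof. by case: i => [|[|]] // _; case: b. Qed.

Lemma wp_seq_eq c1 c2 s s1 Q : wp M c1 (fun s' => s' = s1) s -> wp M c2 Q s1 -> wp M (Seq c1 c2) Q s.
Proof. by move=> h1 h2; apply: wp_weaken h1 _ => s' ->. Qed.

Lemma starts_bit (a b : R * R) i : i < 2 -> (starts a b (+) odd i : nat) =
  if [&& (0 < cross a b)%R, (a.2 < 0)%R & ~~ (b.2 < 0)%R] then 1 - i else
  if [&& (cross a b < 0)%R, (b.2 < 0)%R & ~~ (a.2 < 0)%R] then 1 - i else i.
Proof.
move=> i2; rewrite -turn_bit // /starts !leNgt.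
by case: [&& _, _ & _] => //=; case: [&& _, _ & _].
Qed.

Lemma wp_turn s : let a := (rreg s 43, rreg s 44) in let b := (rreg s 45, rreg s 46) in
  1 < M -> ireg s 10 < 2 -> wp M turn_code (fun s' => s' = turned a b s (cross a b)) s.
Proof.
move=> a b M1 b2; set v0 := cross a b; rewrite /turn_code.
apply: (@wp_seq_eq _ _ _ (set_rreg s 50 v0)); first by move=> v ->.
apply: (@wp_seq_eq _ _ _ (set_rreg (set_rreg (set_rreg s 50 v0) 22 (turn_key a b)) 23 (turn_key b a))).
  split=> c0; rewrite /= turn_zero in c0.
    by move=> v -> v' ->; rewrite /turn_key (cross_anti a b) oppr_eq0 c0.
  apply: (@wp_seq_eq _ _ _ (set_rreg (set_rreg s 50 v0) 22 (turn_key a b))).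
    by apply: wp_angle => // v ->; rewrite /turn_key (negbTE c0).
  by apply: wp_angle => // v ->; rewrite /turn_key (cross_anti a b) oppr_eq0 (negbTE c0).
rewrite /turned starts_bit //=; split=> c1.
  by split; [lia|move=> v ->; rewrite c1].
split=> c2; first by split; [lia|move=> v ->; rewrite (negbTE c1) c2].
by rewrite (negbTE c1) (negbTE c2); apply/esym; exact: set_ireg_id.
Qed.

End EdgeCode.

Section ClipCode.
Local Open Scope nat_scope.

Fixpoint block (cs : seq cmd) : cmd :=
  match cs with
  | [::] => Skip
  | [:: c] => c
  | c :: cs' => Seq c (block cs')
  end.

Local Notation "a ++r b" := (RAdd a b) (at level 50, left associativity).
Local Notation "a --r b" := (RSub a b) (at level 50, left associativity).
Local Notation "a **r b" := (RMul a b) (at level 40, left associativity).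
Local Notation "a %/r b" := (RDiv a b) (at level 40, left associativity).
Local Notation r := RReg.

Definition mark_code : cmd := block [::
  RSet 43 (r 30 ++r r 41 **r r 34); RSet 44 (r 31 ++r r 41 **r r 35);
  RSet 45 (r 30 ++r r 42 **r r 34); RSet 46 (r 31 ++r r 42 **r r 35);
  turn_code;
  If (TRLt (r 39) (RInt 0)) Skip (angle_code 43 44 24);
  If (TRLt (RInt 1) (r 40)) Skip (angle_code 45 46 25)].

Definition clip_code : cmd := block [::
  RSet 39 ((RInt 0 --r r 36 --r RSqrt (r 38)) %/r r 37);
  RSet 40 ((RInt 0 --r r 36 ++r RSqrt (r 38)) %/r r 37);
  If (TRLt (r 39) (RInt 0)) (RSet 41 (RInt 0)) (RSet 41 (r 39));
  If (TRLt (RInt 1) (r 40)) (RSet 42 (RInt 1)) (RSet 42 (r 40));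
  If (TRLt (r 42) (r 41)) Skip mark_code].

(** Keys 2 to 5 are preset to 2 pi, which is already right for an edge that misses the disc. *)
Definition disc_code : cmd := block [::
  RSet 22 two_pi; RSet 23 two_pi; RSet 24 two_pi; RSet 25 two_pi;
  RSet 34 (r 32 --r r 30); RSet 35 (r 33 --r r 31);
  RSet 36 (r 30 **r r 34 ++r r 31 **r r 35);
  RSet 37 (r 34 **r r 34 ++r r 35 **r r 35);
  RSet 38 (r 36 **r r 36 --r r 37 **r (r 30 **r r 30 ++r r 31 **r r 31 --r RInt 1));
  If (TRLt (r 38) (RInt 0)) Skip clip_code].

(** [turn_code] serves the edge and then its part in the disc, leaving its keys in 22 and 23 each
    time; the first two are therefore moved to 20 and 21. In the end register [20 + c] holds key
    [c]. *)
Definition edge_code : cmd := block [::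
  RSet 43 (r 30); RSet 44 (r 31); RSet 45 (r 32); RSet 46 (r 33);
  turn_code; RSet 20 (r 22); RSet 21 (r 23); disc_code].

Variables (R : realType) (M : nat).
Implicit Types (s : state R) (Q : state R -> Prop) (a b : R * R).

Lemma wp_rset x e c s Q : (forall v, v = reval s e -> wp M c Q (set_rreg s x v)) ->
  wp M (Seq (RSet x e) c) Q s.
Proof. by []. Qed.

Lemma wp_if (b : test) c1 c2 s Q : (teval s b -> wp M c1 Q s) -> (~~ teval s b -> wp M c2 Q s) -> wp M (If b c1 c2) Q s.
Proof. by split. Qed.

Definition same_memory s s' :=
  [/\ imem s' = imem s, rmem s' = rmem s, forall x, x != 10 -> ireg s' x = ireg s x &
      forall x, x < 22 -> rreg s' x = rreg s x].

Definition clip_post a b s s' :=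
  [/\ same_memory s s', forall c, 2 <= c < 6 -> rreg s' (20 + c) = edge_key a b c &
      ireg s' 10 = ((clipped a b && starts (clip_p a b) (clip_q a b)) (+) odd (ireg s 10))].

Lemma wp_mark a b s : 1 < M -> ireg s 10 < 2 -> clipped a b ->
  rreg s 24 = (2 * pi)%R -> rreg s 25 = (2 * pi)%R ->
  rreg s 30 = a.1 -> rreg s 31 = a.2 -> rreg s 34 = (b - a).1%R -> rreg s 35 = (b - a).2%R ->
  rreg s 39 = disc_lo a b -> rreg s 40 = disc_hi a b ->
  rreg s 41 = clip_lo a b -> rreg s 42 = clip_hi a b ->
  wp M mark_code (clip_post a b s) s.
Proof.
move=> M1 b2 cl r24 r25 r30 r31 r34 r35 r39 r40 r41 r42.
rewrite /mark_code /block.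
apply: wp_rset => v43 e43; rewrite /= in e43.
apply: wp_rset => v44 e44; rewrite /= in e44.
apply: wp_rset => v45 e45; rewrite /= in e45.
apply: wp_rset => v46 e46; rewrite /= in e46.
have ep : (v43, v44) = clip_p a b.
  by apply: plane_eq; rewrite /= ?e43 ?e44 ?r30 ?r31 ?r41 ?r34 ?r35.
have eq : (v45, v46) = clip_q a b.
  by apply: plane_eq; rewrite /= ?e45 ?e46 ?r30 ?r31 ?r42 ?r34 ?r35.
apply: wp_seq_eq; first exact: wp_turn.
rewrite [(rreg _ 43, rreg _ 44)]ep [(rreg _ 45, rreg _ 46)]eq; set v0 := cross _ _; set s1 := turned _ _ _ _.
apply: (@wp_seq_eq _ _ _ _ _ (set_rreg s1 24 (edge_key a b 4))).
  rewrite /edge_key cl; apply: wp_if; rewrite [teval _ _]/= r39 => h.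
    rewrite h -r24 /=; symmetry; exact: (@set_rreg_id R s1 24).
  apply: wp_angle => // v ->; rewrite (negbTE h) [(rreg _ 43, rreg _ 44)]ep; reflexivity.
apply: (@wp_weaken _ _ _ _ (fun s' => s' = set_rreg (set_rreg s1 24 (edge_key a b 4)) 25 (edge_key a b 5))).
  rewrite /edge_key cl; apply: wp_if; rewrite [teval _ _]/= r40 => h.
    rewrite h -r25 /=; symmetry; exact: (@set_rreg_id R _ 25).
  apply: wp_angle => // v ->; rewrite (negbTE h) [(rreg _ 45, rreg _ 46)]eq; reflexivity.
move=> _ ->; rewrite /s1 /turned; split.
- by split=> //= x; [move/negbTE=> ->|do 30![case: x => [|x] //]].
- by case=> [|[|[|[|[|[|]]]]]] // _; rewrite /= /edge_key cl.
- by rewrite /= cl.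
Qed.

Lemma wp_clip a b s : 1 < M -> ireg s 10 < 2 -> (0 <= disc_coef a b)%R ->
  (forall c, 2 <= c < 6 -> rreg s (20 + c) = (2 * pi)%R) ->
  rreg s 30 = a.1 -> rreg s 31 = a.2 -> rreg s 34 = (b - a).1%R -> rreg s 35 = (b - a).2%R ->
  rreg s 36 = dot a (b - a)%R -> rreg s 37 = dot (b - a)%R (b - a)%R -> rreg s 38 = disc_coef a b ->
  wp M clip_code (clip_post a b s) s.
Proof.
move=> M1 b2 D0 keys r30 r31 r34 r35 r36 r37 r38; rewrite /clip_code /block.
apply: wp_rset => v39 e39; apply: wp_rset => v40 e40.
have {}e39 : v39 = disc_lo a b by rewrite e39 /= r36 r37 r38 /disc_lo sub0r.
have {}e40 : v40 = disc_hi a b by rewrite e40 /= r36 r37 r38 /disc_hi sub0r.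
set s1 := set_rreg _ _ _.
apply: (@wp_seq_eq _ _ _ _ _ (set_rreg s1 41 (clip_lo a b))).
  by apply: wp_if; rewrite [teval _ _]/= e39 /clip_lo => h v -> /=; rewrite ?h ?(negbTE h) ?e39.
apply: (@wp_seq_eq _ _ _ _ _ (set_rreg (set_rreg s1 41 (clip_lo a b)) 42 (clip_hi a b))).
  by apply: wp_if; rewrite [teval _ _]/= e40 /clip_hi => h v -> /=; rewrite ?h ?(negbTE h) ?e40.
apply: wp_if; rewrite [teval _ _]/= => h.
  have cl : clipped a b = false by rewrite /clipped h andbF.
  split; first by split=> //= x; do 30![case: x => [|x] //].
  - move=> c c6; have := keys c c6; move: c6.
    by case: c => [|[|[|[|[|[|]]]]]] // _ k; rewrite /edge_key cl; exact: k.
  - by rewrite /= cl -(turn_bit false b2).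
have cl : clipped a b by rewrite /clipped h andbT -leNgt.
have := @wp_mark a b (set_rreg (set_rreg s1 41 (clip_lo a b)) 42 (clip_hi a b)) M1 b2 cl.
move=> /(_ (keys 4 isT) (keys 5 isT) r30 r31 r34 r35 e39 e40 erefl erefl).
move=> /wp_weaken; apply => s' [[h1 h2 h3 h4] h5 h6]; split=> //; split=> //.
move=> x xl; rewrite h4 //; move: xl; do 30![case: x => [|x] //].
Qed.

Lemma wp_disc a b s : 1 < M -> ireg s 10 < 2 ->
  rreg s 30 = a.1 -> rreg s 31 = a.2 -> rreg s 32 = b.1 -> rreg s 33 = b.2 ->
  wp M disc_code (clip_post a b s) s.
Proof.
move=> M1 b2 r30 r31 r32 r33; rewrite /disc_code /block.
apply: wp_rset => v22 e22; apply: wp_rset => v23 e23; apply: wp_rset => v24 e24; apply: wp_rset => v25 e25.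
apply: wp_rset => v34 e34; rewrite /= r32 r30 in e34.
apply: wp_rset => v35 e35; rewrite /= r31 r33 in e35.
apply: wp_rset => v36 e36; rewrite /= e34 e35 r30 r31 in e36.
apply: wp_rset => v37 e37; rewrite /= e34 e35 in e37.
apply: wp_rset => v38 e38; rewrite /= e36 e37 r30 r31 in e38.
set s1 := set_rreg _ _ _.
have keys c : 2 <= c < 6 -> rreg s1 (20 + c) = (2 * pi)%R.
  by case: c => [|[|[|[|[|[|]]]]]] // _; rewrite /= ?e22 ?e23 ?e24 ?e25.
have mem : same_memory s s1 by split=> //= x; do 30![case: x => [|x] //].
apply: wp_if; rewrite [teval _ _]/= => h.
  have cl : clipped a b = false by rewrite /clipped -[disc_coef a b]e38 h.
  split=> //; last by rewrite /= cl -(turn_bit false b2).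
  by move=> c c6; rewrite keys //; move: c6; case: c => [|[|[|[|[|[|]]]]]] // _; rewrite /edge_key cl.
have := @wp_clip a b s1 M1 b2; rewrite -[disc_coef a b]e38 leNgt h.
move=> /(_ isT keys r30 r31 e34 e35 e36 e37 erefl).
move=> /wp_weaken; apply => s' [[h1 h2 h3 h4] h5 h6]; split=> //; split=> //.
by case: mem => _ _ _ m4 x xl; rewrite h4 // m4.
Qed.

Definition edge_post a b s s' :=
  [/\ imem s' = imem s, rmem s' = rmem s, forall x, x != 10 -> ireg s' x = ireg s x,
      forall x, x < 20 -> rreg s' x = rreg s x &
      (forall c, c < 6 -> rreg s' (20 + c) = edge_key a b c) /\ ireg s' 10 = edge_start a b].

Lemma wp_edge a b s : 1 < M -> ireg s 10 = 0 ->
  rreg s 30 = a.1 -> rreg s 31 = a.2 -> rreg s 32 = b.1 -> rreg s 33 = b.2 ->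
  wp M edge_code (edge_post a b s) s.
Proof.
move=> M1 b0 r30 r31 r32 r33; rewrite /edge_code /block.
apply: wp_rset => v43 e43; rewrite /= r30 in e43.
apply: wp_rset => v44 e44; rewrite /= r31 in e44.
apply: wp_rset => v45 e45; rewrite /= r32 in e45.
apply: wp_rset => v46 e46; rewrite /= r33 in e46.
apply: wp_seq_eq; first by apply: wp_turn => //=; rewrite b0.
have ep : (v43, v44) = a by apply: plane_eq.
have eq : (v45, v46) = b by apply: plane_eq.
rewrite [(rreg _ 43, rreg _ 44)]ep [(rreg _ 45, rreg _ 46)]eq; set v0 := cross _ _; set s1 := turned _ _ _ _.
apply: wp_rset => v20 e20; rewrite /= in e20.
apply: wp_rset => v21 e21; rewrite /= in e21.
have b10 : ireg s1 10 = (starts a b : nat) by rewrite /= b0 addbF.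
apply: wp_weaken; first apply: (@wp_disc a b _ M1) => //=.
  by rewrite b0; case: (starts a b).
move=> s' [[h1 h2 h3 h4] h5 h6]; split=> //.
- by move=> x x10; rewrite h3 //= (negbTE x10).
- by move=> x xl; rewrite h4 /=; [|lia]; move: xl; do 30![case: x => [|x] //].
split; last by rewrite h6 /= b0 addbF /edge_start oddb addbC.
case=> [|[|c]] c6; last exact: h5.
  by rewrite h4 //= e20.
by rewrite h4 //= e21.
Qed.

End ClipCode.

Section Rules.
Variables (R : realType) (M : nat).
Implicit Types (s : state R) (Q : state R -> Prop).
Local Open Scope nat_scope.

Lemma wp_iset x e c s Q : ieval s e < M -> (forall v, v = ieval s e -> wp M c Q (set_ireg s x v)) ->
  wp M (Seq (ISet x e) c) Q s.
Proof. by []. Qed.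

Lemma wp_iload x a c s Q : ieval s a < M -> (forall v, v = imem s (ieval s a) -> wp M c Q (set_ireg s x v)) ->
  wp M (Seq (ILoad x a) c) Q s.
Proof. by []. Qed.

Lemma wp_rload x a c s Q : ieval s a < M -> (forall v, v = rmem s (ieval s a) -> wp M c Q (set_rreg s x v)) ->
  wp M (Seq (RLoad x a) c) Q s.
Proof. by []. Qed.

Lemma wp_istore a e c s Q : ieval s a < M -> ieval s e < M ->
  wp M c Q (set_imem s (ieval s a) (ieval s e)) -> wp M (Seq (IStore a e) c) Q s.
Proof. by []. Qed.

Lemma wp_rstore a e c s Q : ieval s a < M ->
  wp M c Q (set_rmem s (ieval s a) (reval s e)) -> wp M (Seq (RStore a e) c) Q s.
Proof. by []. Qed.

Lemma wp_seq c1 c2 s Q1 Q : wp M c1 Q1 s -> (forall s', Q1 s' -> wp M c2 Q s') -> wp M (Seq c1 c2) Q s.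
Proof. by move=> h1 h2; apply: wp_weaken h1 h2. Qed.

Definition for_loop x B c : cmd := While (TILt (IReg x) (IReg B)) (Seq c (ISet x (IAdd (IReg x) (IConst 1)))).

(** A round costs 4 for the test and 4 for the increment besides the body; the last, failing test
    costs 4. The counter takes the value [N], whence [N < M]. *)
Lemma runs_for x B c T N (Inv : nat -> state R -> Prop) : N < M ->
  (forall i s, Inv i s -> ireg s x = i /\ ireg s B = N) ->
  (forall i s, i < N -> Inv i s -> runs M c s T (fun s' => ireg s' x = i /\ Inv i.+1 (set_ireg s' x i.+1))) ->
  forall s, Inv 0 s -> runs M (for_loop x B c) s (N * (T + 8) + 4) (Inv N).
Proof.
move=> NM reg body s I0.
pose I k s := exists2 i, i + k = N & Inv i s.
have I00 : I N s by exists 0.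
have step k s0 : I k s0 -> teval s0 (TILt (IReg x) (IReg B)) -> 0 < k /\
    runs M (Seq c (ISet x (IAdd (IReg x) (IConst 1)))) s0 (T + 4) (I k.-1).
  move=> [i ik Ii] /=; have [-> ->] := reg _ _ Ii => iN; split; first by lia.
  apply: runs_seq (body i s0 iN Ii) _ => s' [xi Ii'].
  apply: runs_weaken (@wp_runs _ M (ISet x (IAdd (IReg x) (IConst 1))) s' (I k.-1) _) _ _ => //.
  split=> /=; first by lia.
  by move=> v ->; rewrite xi addn1; exists i.+1 => //; lia.
have h := runs_while step I00; apply: (runs_weaken h).
  by rewrite [tcost _]/=; apply: leq_add => //; rewrite leq_mul2l; apply/orP; right; lia.
move=> s' [/= nb [k' [i ik Ii]]]; have [xi BN] := reg _ _ Ii.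
by have -> : N = i by [move: nb; rewrite xi BN -leqNgt; lia].
Qed.

End Rules.

(** These facts let linear arithmetic treat [n * m] as an atom; the last one expands a product of
    [n - 1] and [m - 1]. *)
Lemma sizes (n m : nat) : (0 < n -> 0 < m -> [/\ 0 < n * m, n <= n * m, m <= n * m & n + m <= (n * m).+1])%N.
Proof. by case: n => // n'; case: m => // m' _ _; split; nia. Qed.

Section EventCode.
Local Open Scope nat_scope.
Local Notation "a ++r b" := (RAdd a b) (at level 50, left associativity).
Local Notation "a --r b" := (RSub a b) (at level 50, left associativity).
Local Notation "a **r b" := (RMul a b) (at level 40, left associativity).
Local Notation "a %/r b" := (RDiv a b) (at level 40, left associativity).
Local Notation "a ++i b" := (IAdd a b) (at level 50, left associativity).
Local Notation "a --i b" := (ISub a b) (at level 50, left associativity).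
Local Notation "a **i b" := (IMul a b) (at level 40, left associativity).
Local Notation "a %/i b" := (IDiv a b) (at level 40, left associativity).
Local Notation r := RReg.
Local Notation i_ := IReg.
Local Notation "k %:i" := (IConst k) (at level 1, left associativity, format "k %:i").

Definition arm_code : cmd := block [::
  RSet 30 ((r 10 **r r 12 ++r r 11 **r r 13) %/r r 18);
  RSet 31 ((r 10 **r r 13 --r r 11 **r r 12) %/r r 18);
  RSet 32 ((r 10 **r r 14 ++r r 11 **r r 15) %/r r 18);
  RSet 33 ((r 10 **r r 15 --r r 11 **r r 14) %/r r 18);
  edge_code].

(** The remainder modulo [m], absent from the instruction set, is computed from the quotient. For a
    point at [r] the preset keys 2 pi and start bit 0 stand. *)
Definition pair_code : cmd := block [::
  ISet 6 (i_ 5 %/i i_ 1); ISet 7 (i_ 5 --i i_ 1 **i i_ 6);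
  If (TILt (i_ 7 ++i 1%:i) (i_ 1)) (ISet 16 (i_ 7 ++i 1%:i)) (ISet 16 0%:i);
  RLoad 10 (2%:i **i i_ 6); RLoad 11 (2%:i **i i_ 6 ++i 1%:i);
  RLoad 12 (2%:i **i (i_ 0 ++i i_ 7)); RLoad 13 (2%:i **i (i_ 0 ++i i_ 7) ++i 1%:i);
  RLoad 14 (2%:i **i (i_ 0 ++i i_ 16)); RLoad 15 (2%:i **i (i_ 0 ++i i_ 16) ++i 1%:i);
  RLoad 16 (2%:i **i (i_ 0 ++i i_ 1)); RLoad 17 (2%:i **i (i_ 0 ++i i_ 1) ++i 1%:i);
  RSet 10 (r 10 --r r 16); RSet 11 (r 11 --r r 17);
  RSet 12 (r 12 --r r 16); RSet 13 (r 13 --r r 17);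
  RSet 14 (r 14 --r r 16); RSet 15 (r 15 --r r 17);
  RSet 18 (r 10 **r r 10 ++r r 11 **r r 11);
  RSet 20 two_pi; RSet 21 two_pi; RSet 22 two_pi; RSet 23 two_pi; RSet 24 two_pi; RSet 25 two_pi;
  ISet 10 0%:i;
  If (TRLt (RInt 0) (r 18)) arm_code Skip].

(** The start bit of the pair is added modulo 2 to the cell of the point, which thus accumulates the
    parity over all edges. *)
Definition event_code : cmd := block [::
  pair_code;
  RStore (i_ 4 ++i (6%:i **i i_ 5 ++i 0%:i)) (r 20); RStore (i_ 4 ++i (6%:i **i i_ 5 ++i 1%:i)) (r 21);
  RStore (i_ 4 ++i (6%:i **i i_ 5 ++i 2%:i)) (r 22); RStore (i_ 4 ++i (6%:i **i i_ 5 ++i 3%:i)) (r 23);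
  RStore (i_ 4 ++i (6%:i **i i_ 5 ++i 4%:i)) (r 24); RStore (i_ 4 ++i (6%:i **i i_ 5 ++i 5%:i)) (r 25);
  ILoad 11 (2%:i **i i_ 2 ++i i_ 6);
  If (TILt 0%:i (i_ 10)) (IStore (2%:i **i i_ 2 ++i i_ 6) (1%:i --i i_ 11)) Skip].

Variables (R : realType) (n m M : nat) (S : n.-tuple (R * R)) (P : m.-tuple (R * R)) (o : R * R).
Hypotheses (n0 : 0 < n) (m0 : 0 < m) (HM : 20 * (n * m) <= M).
Implicit Types (s : state R) (Q : state R -> Prop).

(* Memory, with [N = 6nm] and [F = 2(n + m + 1)].  Integer cells: the tournament
   tree below [2N], then the crossing parity of each point.  Real cells: the input
   below [F], then the [N] event times, then for each point the last time at
   which it was seen on the boundary ([-1] if none). *)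
Definition layout s := [/\ ireg s 0 = n, ireg s 1 = m, ireg s 2 = 6 * (n * m), ireg s 3 = n * m &
  ireg s 4 = 2 * (n + m + 1)].

Definition inputs s := [/\
  forall k, k < n -> rmem s (2 * k) = (nth 0%R S k).1 /\ rmem s (2 * k + 1) = (nth 0%R S k).2,
  forall i, i < m -> rmem s (2 * (n + i)) = (nth 0%R P i).1 /\ rmem s (2 * (n + i) + 1) = (nth 0%R P i).2 &
  rmem s (2 * (n + m)) = o.1 /\ rmem s (2 * (n + m) + 1) = o.2].

Definition pair_start q : bool :=
  let k := q %/ m in let i := q %% m in
  (arm S o k != 0%R) && edge_start (end1 S P o k i) (end2 S P o k i).

Definition pair_post q s s' := [/\ imem s' = imem s, rmem s' = rmem s,
  (forall x, x < 6 -> ireg s' x = ireg s x) /\ ireg s' 6 = q %/ m,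
  forall c, c < 6 -> rreg s' (20 + c) = event_key S P o (6 * q + c) &
  ireg s' 10 = pair_start q].

Lemma event_keyE q c : c < 6 -> event_key S P o (6 * q + c) =
  if arm S o (q %/ m) == 0%R then (2 * pi)%R else
  edge_key (end1 S P o (q %/ m) (q %% m)) (end2 S P o (q %/ m) (q %% m)) c.
Proof.
move=> c6; rewrite /event_key [6 * q]mulnC divnMDl // (divn_small c6) addn0.
by rewrite modnMDl (modn_small c6).
Qed.

Lemma wp_pair q s : layout s -> inputs s -> q < n * m -> ireg s 5 = q -> wp M pair_code (pair_post q s) s.
Proof.
move=> [r0 r1 r2 r3 r4] [inS inP [ino1 ino2]] qN r5.
have [nm0 nle mle nmle] := sizes n0 m0.
have kn : q %/ m < n by rewrite ltn_divLR.
have im : q %% m < m by rewrite ltn_mod.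
rewrite /pair_code /block.
apply: wp_iset => [|v6 e6]; first by rewrite /= r5 r1; lia.
rewrite /= r5 r1 in e6.
apply: wp_iset => [|v7 e7]; first by rewrite /= r5; lia.
rewrite /= r5 r1 e6 in e7.
have {}e7 : v7 = q %% m by rewrite e7 {1}(divn_eq q m) mulnC addKn.
set s1 := set_ireg _ _ _.
apply: (@wp_seq_eq _ _ _ _ _ (set_ireg s1 16 (succ_index m (q %% m)))).
  apply: wp_if; rewrite [teval _ _]/= r1 e7 addn1 => h; (split; last move=> v ->) => /=; try lia.
    by rewrite /succ_index h e7 addn1.
  by rewrite /succ_index (negbTE h).
have sm : succ_index m (q %% m) < m by rewrite /succ_index; case: ifP.
have [S1 S2] := inS _ kn; have [P1 P2] := inP _ im; have [P3 P4] := inP _ sm.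
apply: wp_rload => [|v10 e10]; first by rewrite /= e6; lia.
rewrite /= e6 S1 in e10.
apply: wp_rload => [|v11 e11]; first by rewrite /= e6; lia.
rewrite /= e6 S2 in e11.
apply: wp_rload => [|v12 e12]; first by rewrite /= r0 e7; lia.
rewrite /= r0 e7 P1 in e12.
apply: wp_rload => [|v13 e13]; first by rewrite /= r0 e7; lia.
rewrite /= r0 e7 P2 in e13.
apply: wp_rload => [|v14 e14]; first by rewrite /= r0; lia.
rewrite /= r0 P3 in e14.
apply: wp_rload => [|v15 e15]; first by rewrite /= r0; lia.
rewrite /= r0 P4 in e15.
apply: wp_rload => [|v16 e16]; first by rewrite /= r0 r1; lia.
rewrite /= r0 r1 ino1 in e16.
apply: wp_rload => [|v17 e17]; first by rewrite /= r0 r1; lia.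
rewrite /= r0 r1 ino2 in e17.
apply: wp_rset => w10 f10; rewrite /= e10 e16 in f10.
apply: wp_rset => w11 f11; rewrite /= e11 e17 in f11.
apply: wp_rset => w12 f12; rewrite /= e12 e16 in f12.
apply: wp_rset => w13 f13; rewrite /= e13 e17 in f13.
apply: wp_rset => w14 f14; rewrite /= e14 e16 in f14.
apply: wp_rset => w15 f15; rewrite /= e15 e17 in f15.
apply: wp_rset => w18 f18; rewrite /= f10 f11 in f18.
apply: wp_rset => v20 e20; apply: wp_rset => v21 e21; apply: wp_rset => v22 e22.
apply: wp_rset => v23 e23; apply: wp_rset => v24 e24; apply: wp_rset => v25 e25.
apply: wp_iset => [|v1 b0]; first by rewrite /=; lia.
rewrite /= in b0.
set w := arm S o (q %/ m).
have f18' : w18 = dot w w by rewrite f18.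
apply: wp_if; rewrite [teval _ _]/= f18' => h; last first.
  have w0 : w = 0%R by apply/eqP; apply: contraNT h => w0; exact: dot_gt0.
  split=> //=; last by rewrite /pair_start -/w w0 eqxx b0.
    split=> //; do 30![case=> [|] //].
  move=> c c6; rewrite event_keyE // -/w w0 eqxx; move: c6.
  by case: c => [|[|[|[|[|[|]]]]]] // _ /=; rewrite ?e20 ?e21 ?e22 ?e23 ?e24 ?e25.
have w0 : w != 0%R by apply/eqP => w0; move: h; rewrite w0 /dot /= !mul0r addr0 ltxx.
rewrite /arm_code /block.
apply: wp_rset => v30 e30; rewrite /= f10 f11 f12 f13 in e30.
apply: wp_rset => v31 e31; rewrite /= f10 f11 f12 f13 in e31.
apply: wp_rset => v32 e32; rewrite /= f10 f11 f14 f15 in e32.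
apply: wp_rset => v33 e33; rewrite /= f10 f11 f14 f15 in e33.
apply: wp_weaken.
  by apply: (@wp_edge R M (end1 S P o (q %/ m) (q %% m)) (end2 S P o (q %/ m) (q %% m))) => //=; lia.
move=> s' [h1 h2 h3 h4 [h5 h6]]; split=> //.
- split=> [x x6|]; last by rewrite h3 //= e6.
  rewrite h3 /=; last by lia.
  by move: x6; do 6![case: x => [|x] //].
- by move=> c c6; rewrite h5 // event_keyE // -/w (negbTE w0).
- by rewrite h6 /pair_start -/w w0.
Qed.

Definition event_post q s s' := [/\
  forall x, x < 6 -> ireg s' x = ireg s x,
  forall x, ~~ (ireg s 4 + 6 * q <= x < ireg s 4 + 6 * q + 6) -> rmem s' x = rmem s x,
  forall c, c < 6 -> rmem s' (ireg s 4 + (6 * q + c)) = event_key S P o (6 * q + c),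
  forall x, x != 2 * (6 * (n * m)) + q %/ m -> imem s' x = imem s x &
  imem s (2 * (6 * (n * m)) + q %/ m) < 2 -> imem s' (2 * (6 * (n * m)) + q %/ m) =
     (pair_start q (+) odd (imem s (2 * (6 * (n * m)) + q %/ m)))].

Lemma wp_event q s : layout s -> inputs s -> q < n * m -> ireg s 5 = q -> wp M event_code (event_post q s) s.
Proof.
move=> L I qN r5; have [r0 r1 r2 r3 r4] := L.
have [nm0 nle mle nmle] := sizes n0 m0.
have kn : q %/ m < n by rewrite ltn_divLR.
rewrite /event_code /block; apply: (wp_seq (wp_pair L I qN r5)).
move=> s1 [m1 m2 [x1 x6] keys b].
have y2 := x1 2 isT; have y4 := x1 4 isT; have y5 := x1 5 isT.
rewrite r2 in y2; rewrite r4 in y4; rewrite r5 in y5.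
do 6![apply: wp_rstore; first by rewrite /= y4 y5; lia].
rewrite /= y4 y5.
rewrite y2 x6 b; split; [by lia|move=> v11 e11; rewrite m1 in e11].
have bits (bit : bool) i : i < 2 -> (if bit then 1 - i else i) = (bit (+) odd i : nat) by exact: turn_bit.
split=> h.
  split; [by lia|by lia|].
  split; rewrite /= ?y2 ?x6.
  - by move=> x xl; rewrite -x1 //; move: xl; do 6![case: x => [|x] //].
  - move=> x; rewrite r4 -m2 => hx; do 6![case: eqP => [e|_]; first by exfalso; move: hx; rewrite e; lia].
    by [].
  - move=> c c6; rewrite r4 -keys //; move: c6.
    by case: c => [|[|[|[|[|[|]]]]]] // _; rewrite ?eqxx // !eqn_add2l.
  - by move=> x hx; rewrite (negbTE hx) m1.
  - by move=> i2; rewrite eqxx e11 -bits //; move: h; case: (pair_start q).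
have {}h : pair_start q = false by move: h; case: (pair_start q).
split; rewrite /= ?y2 ?x6.
- by move=> x xl; rewrite -x1 //; move: xl; do 6![case: x => [|x] //].
- move=> x; rewrite r4 -m2 => hx; do 6![case: eqP => [e|_]; first by exfalso; move: hx; rewrite e; lia].
  by [].
- move=> c c6; rewrite r4 -keys //; move: c6.
  by case: c => [|[|[|[|[|[|]]]]]] // _; rewrite ?eqxx // !eqn_add2l.
- by move=> x hx; rewrite m1.
- by move=> i2; rewrite -bits // h m1.
Qed.

End EventCode.

(** * Tournament trees *)

Section Tournament.
Local Open Scope nat_scope.
Variables (R : realType).
Implicit Types (N v w j : nat) (t : nat -> nat) (key : nat -> R).

(* A tournament tree stored as a heap: node [v] has children [2v] and [2v+1],
   the leaves are the nodes [N + j], and [t v] is the winner below [v]. *)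
Definition node_ok N t key v :=
  [/\ t v < N, t v = t (2 * v) \/ t v = t (2 * v + 1),
      (key (t v) <= key (t (2 * v)))%R & (key (t v) <= key (t (2 * v + 1)))%R].

Definition tree_node N t key v := if v < N then node_ok N t key v else t v = v - N.

Definition tree_ok N t key := forall v, 0 < v < 2 * N -> tree_node N t key v.

(** Heap ancestors, [v] included: halving an index leads to the parent, and beyond the root to 0. *)
Definition anc w v := exists k, w = v %/ 2 ^ k.

Lemma anc_refl v : anc v v. Proof. by exists 0; rewrite divn1. Qed.

Lemma anc_half w v : anc w v -> anc w./2 v.
Proof. by move=> [k ->]; exists k.+1; rewrite -divn2 expnSr divnMA. Qed.

Lemma anc_child0 w v : anc (2 * w) v -> anc w v.
Proof. by move=> /anc_half; have -> : (2 * w)./2 = w by lia. Qed.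

Lemma anc_child1 w v : anc (2 * w + 1) v -> anc w v.
Proof. by move=> /anc_half; have -> : (2 * w + 1)./2 = w by lia. Qed.

Lemma anc_le w v : anc w v -> w <= v.
Proof. by move=> [k ->]; exact: leq_div. Qed.

Lemma anc_step w v : anc w v -> w = v \/ anc w v./2.
Proof.
move=> [[|k] ->]; first by left; rewrite divn1.
by right; exists k; rewrite -divn2 expnS divnMA.
Qed.

Lemma tree_lt N t key v : 0 < v < 2 * N -> tree_node N t key v -> t v < N.
Proof. by move=> hv; rewrite /tree_node /node_ok; case: ltnP => h; [case|move=> ->; lia]. Qed.

Lemma tree_root N t key : 1 < N -> tree_ok N t key ->
  t 1 < N /\ forall j, j < N -> (key (t 1) <= key j)%R.
Proof.
move=> N1 ok; split; first by apply: (@tree_lt N t key) (ok 1 _); lia.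
have all : forall v, 0 < v < 2 * N -> (key (t 1) <= key (t v))%R.
  elim/ltn_ind => v IH hv; have [->//|v1] := eqVneq v 1.
  have h : 0 < v./2 < 2 * N by have := half_leq (ltnW (proj2 (andP hv))); have := odd_double_half v; lia.
  have hN : v./2 < N by have := odd_double_half v; lia.
  have := IH v./2 _ h; have := ok _ h; rewrite /tree_node hN => -[_ _ h1 h2] /(_ _).
  have vlt : v./2 < v by have := odd_double_half v; lia.
  move=> /(_ vlt) h3; have := odd_double_half v; case: (odd v) => /= e.
    by have -> : v = 2 * v./2 + 1 by [lia]; exact: le_trans h3 h2.
  by have -> : v = 2 * v./2 by [lia]; exact: le_trans h3 h1.
move=> j jN; have h : 0 < N + j < 2 * N by lia.
have := all _ h; have := ok _ h; rewrite /tree_node ltnNge leq_addr /= => ->.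
by rewrite addKn.
Qed.

(** The winner at an inner node is the winner at one of its children, so following it down ends at
    its own leaf. *)
Lemma tree_anc N t key v : tree_ok N t key -> 0 < v < 2 * N -> anc v (N + t v).
Proof.
move=> ok; have [d] := ubnP (2 * N - v); elim: d v => // d IH v hd hv.
have := ok _ hv; rewrite /tree_node; case: ltnP => vN; last first.
  by move=> ->; rewrite subnKC //; exact: anc_refl.
case=> _ [e|e] _ _; rewrite e.
  by apply: anc_child0; apply: IH; lia.
by apply: anc_child1; apply: IH; lia.
Qed.

(** By [tree_anc], [j] can win at [w] or at a child of [w] only if [w] is above the leaf of [j]:
    changing one key spoils only the nodes on one path to the root. *)
Lemma node_ok_key N t key key' j w : tree_ok N t key -> 0 < w < N ->
  (forall i, i < N -> i != j -> key' i = key i) -> ~ anc w (N + j) -> node_ok N t key' w.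
Proof.
move=> ok wN hk na; have hw : 0 < w < 2 * N by lia.
have := ok _ hw; rewrite /tree_node; case/andP: (wN) => w0 -> [h1 h2 h3 h4].
have tj v : v = w \/ v = 2 * w \/ v = 2 * w + 1 -> t v != j.
  move=> hv; apply/eqP => e; apply: na.
  have := @tree_anc N t key v ok; rewrite e; case: hv => [->|[]->] h.
  - by apply: h; lia.
  - by apply: anc_child0; apply: h; lia.
  - by apply: anc_child1; apply: h; lia.
have lt2 : t (2 * w) < N by apply: (@tree_lt N t key) (ok _ _); lia.
have lt3 : t (2 * w + 1) < N by apply: (@tree_lt N t key) (ok _ _); lia.
by split=> //; rewrite !hk //; apply: tj; by [left|right; left|right; right].
Qed.

Lemma node_ok_ext N t t' key w : t' w = t w -> t' (2 * w) = t (2 * w) ->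
  t' (2 * w + 1) = t (2 * w + 1) -> node_ok N t key w -> node_ok N t' key w.
Proof. by rewrite /node_ok => -> -> ->. Qed.

Definition winner t key v :=
  if (key (t (2 * v + 1)) < key (t (2 * v)))%R then t (2 * v + 1) else t (2 * v).

Lemma winner_ok N t key v : 0 < v < N ->
  t (2 * v) < N -> t (2 * v + 1) < N ->
  node_ok N [eta t with v |-> winner t key v] key v.
Proof.
move=> hv h1 h2; rewrite /node_ok /= eqxx.
have -> : (2 * v == v) = false by apply/eqP; lia.
have -> : (2 * v + 1 == v) = false by apply/eqP; lia.
rewrite /winner; case: ifP => h; split=> //; try by [left|right].
- exact: ltW.
- by rewrite leNgt h.
Qed.

Lemma node_ok_upd N t key v x w : node_ok N t key w -> w != v -> 2 * w != v -> 2 * w + 1 != v ->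
  node_ok N [eta t with v |-> x] key w.
Proof. by rewrite /node_ok /= => h /negbTE -> /negbTE -> /negbTE ->. Qed.

End Tournament.

Section TreeCode.
Local Open Scope nat_scope.
Local Notation "a ++i b" := (IAdd a b) (at level 50, left associativity).
Local Notation "a --i b" := (ISub a b) (at level 50, left associativity).
Local Notation "a **i b" := (IMul a b) (at level 40, left associativity).
Local Notation "a %/i b" := (IDiv a b) (at level 40, left associativity).
Local Notation r := RReg.
Local Notation i_ := IReg.
Local Notation "k %:i" := (IConst k) (at level 1, left associativity, format "k %:i").

Definition fix_code : cmd := block [::
  ILoad 20 (2%:i **i i_ 9); ILoad 21 (2%:i **i i_ 9 ++i 1%:i);
  RLoad 60 (i_ 4 ++i i_ 20); RLoad 61 (i_ 4 ++i i_ 21);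
  If (TRLt (r 61) (r 60)) (IStore (i_ 9) (i_ 21)) (IStore (i_ 9) (i_ 20))].

Definition build_code : cmd :=
  While (TILt 0%:i (i_ 9))
    (Seq (If (TILt (i_ 9) (i_ 2)) fix_code (IStore (i_ 9) (i_ 9 --i i_ 2)))
         (ISet 9 (i_ 9 --i 1%:i))).

Definition climb_code : cmd :=
  While (TILt 0%:i (i_ 9)) (Seq fix_code (ISet 9 (i_ 9 %/i 2%:i))).

Variables (R : realType) (M N F : nat).
Hypotheses (HM : 2 * N + F <= M).
Implicit Types (s : state R).

Definition keys s j := rmem s (F + j).

Definition fix_frame s s' := [/\ rmem s' = rmem s, forall x, x < 20 -> ireg s' x = ireg s x &
  forall x, x < 20 -> rreg s' x = rreg s x].

Definition upd t v x : nat -> nat := [eta t with v |-> x].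

Definition fix_post s s' := fix_frame s s' /\
  imem s' = upd (imem s) (ireg s 9) (winner (imem s) (keys s) (ireg s 9)).

Lemma wp_fix s : ireg s 4 = F -> 0 < ireg s 9 < N ->
  imem s (2 * ireg s 9) < N -> imem s (2 * ireg s 9 + 1) < N ->
  wp M fix_code (fix_post s) s.
Proof.
move=> r4 hv h1 h2; rewrite /fix_code /block.
apply: wp_iload => [|v20 e20]; first by rewrite /=; lia.
rewrite /= in e20.
apply: wp_iload => [|v21 e21]; first by rewrite /=; lia.
rewrite /= in e21.
apply: wp_rload => [|v60 e60]; first by rewrite /= r4 e20; lia.
rewrite /= r4 in e60.
apply: wp_rload => [|v61 e61]; first by rewrite /= r4 e21; lia.
rewrite /= r4 in e61.
apply: wp_if; rewrite [teval _ _]/= e60 e61 e20 e21 => h.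
  split; rewrite /=; [by lia|by lia|split; first by split=> // x; do 20![case: x => [|x] //]].
  by rewrite /= /winner /keys h.
split; rewrite /=; [by lia|by lia|split; first by split=> // x; do 20![case: x => [|x] //]].
by rewrite /= /winner /keys (negbTE h).
Qed.

(** Nodes are treated in decreasing order, so the children of a node are in place before it. *)
Lemma runs_build s : ireg s 4 = F -> ireg s 2 = N -> ireg s 9 = 2 * N - 1 ->
  runs M build_code s (2 * N * 100 + 10) (fun s' => [/\ fix_frame s (set_ireg s' 9 (ireg s 9)),
     forall x, 2 * N <= x -> imem s' x = imem s x & tree_ok N (imem s') (keys s')]).
Proof.
move=> r4 r2 r9.
pose I (k : nat) s1 := [/\ ireg s1 9 = k, k < 2 * N \/ k = 0, fix_frame s (set_ireg s1 9 (ireg s 9)),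
  forall x, 2 * N <= x -> imem s1 x = imem s x &
  forall v, k < v < 2 * N -> tree_node N (imem s1) (keys s1) v].
have I0 : I (2 * N - 1) s.
  split=> //; first by lia.
    by split=> // x _ /=; case: eqP => // ->.
  by move=> v; lia.
have step k s1 : I k s1 -> teval s1 (TILt 0%:i (i_ 9)) -> 0 < k /\
    runs M (Seq (If (TILt (i_ 9) (i_ 2)) fix_code (IStore (i_ 9) (i_ 9 --i i_ 2))) (ISet 9 (i_ 9 --i 1%:i)))
      s1 90 (I k.-1).
  move=> [k9 kN [f1 f2 f3] out ok] /=; rewrite k9 => k0; split=> //.
  have {}kN : k < 2 * N by lia.
  have k2 : ireg s1 2 = N by have := f2 2 isT; rewrite /= r2.
  have k4 : ireg s1 4 = F by have := f2 4 isT; rewrite /= r4.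
  have f2' x : x < 20 -> x != 9 -> ireg s1 x = ireg s x.
    by move=> xl /negbTE x9; have := f2 x xl; rewrite /= x9.
  have fin : forall s2 : state R, fix_frame s1 s2 ->
      imem s2 = upd (imem s1) k (imem s2 k) -> tree_node N (imem s2) (keys s2) k ->
      I k.-1 (set_ireg s2 9 k.-1).
    move=> s2 [g1 g2 g3] e okk; split=> //=; first by lia.
    - split=> /=; first by rewrite g1 f1.
        move=> x xl; case: eqP => [->//|/eqP x9]; by rewrite g2 // f2'.
      by move=> x xl; rewrite g3 // f3.
    - move=> x xl; have /negbTE xk : x != k by lia.
      by rewrite e /upd /= xk out.
    move=> v hv; have [->//|vk] := eqVneq v k.
    have hv' : k < v < 2 * N by lia.
    have := ok v hv'; rewrite /tree_node; case: ifP => vN.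
      move=> h; rewrite e; have -> : keys (set_ireg s2 9 k.-1) = keys s1 by rewrite /keys /= g1.
      by apply: node_ok_upd => //; apply/eqP; lia.
    by rewrite /= e /upd /= (negbTE vk).
  have kk : I k.-1 = I k.-1 by [].
  apply: (@runs_seq _ _ _ _ _ 80 10 (fun s2 => I k.-1 (set_ireg s2 9 k.-1) /\ ireg s2 9 = k)); last first.
    move=> s2 [h h9]; apply: runs_weaken (@wp_runs _ M (ISet 9 (i_ 9 --i 1%:i)) s2 (I k.-1) _) _ _ => //.
    split=> /= [|v ->]; first by rewrite h9; lia.
    by rewrite h9 subn1.
  apply: runs_weaken (@wp_runs _ M (If (TILt (i_ 9) (i_ 2)) fix_code (IStore (i_ 9) (i_ 9 --i i_ 2))) s1
    (fun s2 => I k.-1 (set_ireg s2 9 k.-1) /\ ireg s2 9 = k) _) _ _ => //.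
  apply: wp_if; rewrite [teval _ _]/= k9 k2 => h.
    have c1 : imem s1 (2 * k) < N by apply: (@tree_lt R N _ (keys s1)) (ok _ _); lia.
    have c2 : imem s1 (2 * k + 1) < N by apply: (@tree_lt R N _ (keys s1)) (ok _ _); lia.
    have hk : 0 < ireg s1 9 < N by rewrite k9 k0.
    apply: (@wp_weaken _ _ _ _ (fix_post s1)); first by apply: wp_fix => //; rewrite k9.
    move=> s2 [fr e]; have [g1 g2 g3] := fr; split; last by rewrite g2.
    rewrite k9 in e; apply: fin => //; first by rewrite e /upd /= eqxx.
    have -> : keys s2 = keys s1 by rewrite /keys g1.
    by rewrite /tree_node h e; apply: winner_ok; rewrite // k0.
  split; rewrite /= ?k9 ?k2; [by lia|by lia|].
  split=> //; apply: fin => //=; first by rewrite eqxx.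
  by rewrite /tree_node (negbTE h) /= eqxx.
have h := runs_while step I0; apply: (runs_weaken h) => //.
  by rewrite [tcost _]/=; nia.
move=> s' [/= nb [k' [k9 kN f1 f2 f3]]]; split=> //.
by move=> v hv; apply: f3; move: nb; rewrite k9; lia.
Qed.

(** Only the ancestors of the current node can be wrong; repairing that node leaves only those of
    its parent. *)
Lemma runs_climb s j d : ireg s 4 = F -> j < N -> 1 < N -> ireg s 9 = (N + j)./2 -> N + j < 2 ^ d ->
  (forall v, 0 < v < 2 * N -> ~ anc v (N + j)./2 -> tree_node N (imem s) (keys s) v) ->
  runs M climb_code s (d * 100 + 10) (fun s' => [/\ fix_frame s (set_ireg s' 9 (ireg s 9)),
     forall x, 2 * N <= x -> imem s' x = imem s x & tree_ok N (imem s') (keys s')]).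
Proof.
move=> r4 jN N1 r9 hd ok0.
(* The counter [k] bounds the remaining height, through [ireg s1 9 < 2 ^ k]. *)
pose I (k : nat) s1 := [/\ ireg s1 9 < N, ireg s1 9 < 2 ^ k, fix_frame s (set_ireg s1 9 (ireg s 9)),
  forall x, 2 * N <= x -> imem s1 x = imem s x &
  forall v, 0 < v < 2 * N -> ~ anc v (ireg s1 9) -> tree_node N (imem s1) (keys s1) v].
have I0 : I d s.
  split=> //.
  - by rewrite r9; lia.
  - by rewrite r9; lia.
  - by split=> // x _ /=; case: eqP => // ->.
  - by move=> v hv; rewrite r9; exact: ok0.
have step k s1 : I k s1 -> teval s1 (TILt 0%:i (i_ 9)) -> 0 < k /\
    runs M (Seq fix_code (ISet 9 (i_ 9 %/i 2%:i))) s1 90 (I k.-1).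
  move=> [vN vk [f1 f2 f3] out ok] /= v0.
  have k0 : 0 < k by case: (k) vk => //; rewrite expn0; lia.
  split=> //.
  have k4 : ireg s1 4 = F by have := f2 4 isT; rewrite /= r4.
  have f2' x : x < 20 -> x != 9 -> ireg s1 x = ireg s x.
    by move=> xl /negbTE x9; have := f2 x xl; rewrite /= x9.
  set v := ireg s1 9 in vN vk v0 ok *.
  have below w : v < w < 2 * N -> imem s1 w < N.
    move=> hw; apply: (@tree_lt R N _ (keys s1)); first by lia.
    by apply: ok; [lia|move/anc_le; lia].
  apply: (@runs_seq _ _ _ _ _ 80 10 (fix_post s1)).
    apply: runs_weaken (@wp_runs _ M fix_code s1 (fix_post s1) _) _ _ => //.
    by apply: wp_fix => //; rewrite -/v ?v0 //; apply: below; lia.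
  move=> s2 [[g1 g2 g3] e].
  apply: runs_weaken (@wp_runs _ M (ISet 9 (i_ 9 %/i 2%:i)) s2 (I k.-1) _) _ _ => //.
  have v2 : ireg s2 9 = v by rewrite g2.
  split=> /= [|_ ->]; rewrite v2; first by have := leq_div v 2; lia.
  split=> /=.
  - by apply: leq_ltn_trans (leq_div _ _) vN.
  - by rewrite divn2; move: vk; rewrite -{1}(prednK k0) expnS; lia.
  - split=> /=; first by rewrite g1 f1.
      by move=> x xl; case: eqP => [->//|/eqP x9]; rewrite g2 // f2'.
    by move=> x xl; rewrite g3 // f3.
  - move=> x xl; have /negbTE xk : x != v by lia.
      by rewrite e /upd /= -/v xk out.
  move=> w hw na; rewrite divn2 in na.
  have -> : keys (set_ireg s2 9 (v %/ 2)) = keys s1 by rewrite /keys /= g1.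
  rewrite e -/v; have [->|wv] := eqVneq w v.
    by rewrite /tree_node vN; apply: winner_ok; rewrite ?v0 //; apply: below; lia.
  have nw : ~ anc w v by case/anc_step => // h; rewrite h eqxx in wv.
  have := ok w hw nw; rewrite /tree_node; case: ifP => wN; last by rewrite /upd /= (negbTE wv).
  move=> h; apply: node_ok_upd => //; apply/eqP => e2; apply: na; rewrite -e2.
    by have -> : (2 * w)./2 = w by [lia]; exact: anc_refl.
  by have -> : (2 * w + 1)./2 = w by [lia]; exact: anc_refl.
have h := runs_while step I0; apply: (runs_weaken h) => //.
  by rewrite [tcost _]/=; nia.
move=> s' [/= nb [k' [k9 kN f1 f2 f3]]]; split=> //.
move=> v hv; apply: f3 => // /anc_le; move: nb; lia.
Qed.

End TreeCode.

(** * The sweep *)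

Section SweepFacts.
Local Open Scope nat_scope.
Variables (R : realType) (n l : nat) (tog : pred nat) (key : nat -> R) (start : pred nat).
Implicit Types (D : pred nat) (th : R).
Local Notation parity_upto := (parity_upto n l tog start).
Local Notation marked := (marked n l tog).
Local Notation value := (value n l tog key start).

(** Contacts at time [th] among the processed events only; others of the same time may be
    pending. *)
Definition marked_at D th := marked (fun j => D j && (key j == th)).

Lemma eq_parity_upto D D' k : (forall j, j < n * l -> D j = D' j) -> parity_upto D k = parity_upto D' k.
Proof.
move=> h; congr (_ (+) _); apply: eq_big_nat => j /andP[_ jN]; by rewrite h.
Qed.

Lemma eq_marked D D' k : (forall j, j < n * l -> D j = D' j) -> marked D k = marked D' k.
Proof.
by move=> h; apply: eq_in_has => j; rewrite mem_iota add0n => /= jN; rewrite h.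
Qed.

Lemma parity_upto_add D j k : j < n * l -> ~~ D j ->
  parity_upto (fun i => D i || (i == j)) k = parity_upto D k (+) (tog j && (j %/ l == k)).
Proof.
move=> jN nD; rewrite /parity_upto -addbA; congr (_ (+) _).
have -> : \big[addb/false]_(0 <= i < n * l) [&& tog i, i %/ l == k & D i || (i == j)] =
  \big[addb/false]_(0 <= i < n * l) ([&& tog i, i %/ l == k & D i] (+) ((i == j) && (tog i && (i %/ l == k)))).
  apply: eq_bigr => i _; have [->|_] := eqVneq i j; last by rewrite orbF addbF.
  by rewrite (negbTE nD) /= !andbT !andbF; case: (tog j).
by rewrite big_split /= (big_addb_single (fun i => tog i && (i %/ l == k))).
Qed.

Lemma marked_add D j th k : j < n * l -> key j = th ->
  marked_at (fun i => D i || (i == j)) th k = marked_at D th k || (~~ tog j && (j %/ l == k)).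
Proof.
move=> jN kj; apply/hasP/orP => [[i iN /and3P[h1 h2 /andP[/orP[h3|/eqP h3] h4]]]|
  [/hasP[i iN /and3P[h1 h2 /andP[h3 h4]]]|/andP[h1 h2]]].
- by left; apply/hasP; exists i => //; rewrite h1 h2 h3 h4.
- by right; rewrite -h3 h1 h2.
- by exists i => //; rewrite h1 h2 h3 h4.
- by exists j; rewrite ?mem_iota //= h1 h2 eqxx orbT kj eqxx.
Qed.

(** The truncated subtraction is exact, [g k0] being a term of the sum. *)
Lemma sum_update (f g : nat -> nat) k0 : k0 < n -> (forall k, k < n -> k != k0 -> f k = g k) ->
  \sum_(0 <= k < n) f k = \sum_(0 <= k < n) g k - g k0 + f k0.
Proof.
move=> kn fg; rewrite !big_mkord (bigD1 (Ordinal kn)) //= [in RHS](bigD1 (Ordinal kn)) //= addKn addnC.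
by congr (_ + _); apply: eq_bigr => i ik; apply: fg.
Qed.

Lemma sum_bool_le (f : nat -> bool) : \sum_(0 <= k < n) f k <= n.
Proof.
rewrite -[leqRHS]muln1 -[X in X * 1]subn0 -sum_nat_const_nat.
by apply: leq_sum => k _; case: (f k).
Qed.

(* Between two consecutive event times nothing changes, and at an event time a
   point on the boundary counts: the maximum is attained at an event. *)
Lemma value_between D cur next : (forall j, j < n * l -> D j -> (key j <= cur)%R) ->
  (forall j, j < n * l -> ~~ D j -> (next <= key j)%R) -> (cur < next)%R ->
  value cur = \sum_(0 <= k < n) (parity_upto D k || marked_at D cur k : nat) /\
  forall phi, (cur <= phi < next)%R -> value phi <= value cur.
Proof.
move=> hD hnD cn.
have upto phi k : (cur <= phi < next)%R -> parity_upto (fun j => (key j <= phi)%R) k = parity_upto D k.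
  move=> /andP[p1 p2]; apply: eq_parity_upto => j jN; case Dj : (D j).
    exact: le_trans (hD j jN Dj) p1.
  by apply/negbTE; rewrite -ltNge; apply: (lt_le_trans p2); apply: hnD; rewrite ?Dj.
have vc : value cur = \sum_(0 <= k < n) (parity_upto D k || marked_at D cur k : nat).
  apply: eq_bigr => k _; rewrite /inside upto ?lexx //; congr ((_ || _) : nat).
  apply: eq_marked => j jN; case Dj : (D j) => //=.
  by apply/negbTE; rewrite neq_lt (lt_le_trans cn) ?orbT // hnD ?Dj.
split=> // phi hphi; rewrite vc; apply: leq_sum => k _; rewrite /inside upto //.
case: (parity_upto D k) => //=; have [->|pc] := eqVneq phi cur.
  have -> : marked (fun j => key j == cur) k = marked_at D cur k; last by [].
  apply: eq_marked => j jN; case Dj : (D j) => //=.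
  by apply/negbTE; rewrite neq_lt (lt_le_trans cn) ?orbT // hnD ?Dj.
have -> // : marked (fun j => key j == phi) k = false.
apply/hasPn => j; rewrite mem_iota add0n /= => jN; rewrite !negb_and; apply/orP; right; apply/orP; right.
case/andP: hphi => p1 p2; case Dj : (D j).
  rewrite neq_lt; apply/orP; left; apply: (le_lt_trans (hD j jN Dj)).
  by rewrite lt_neqAle eq_sym pc.
by rewrite neq_lt (lt_le_trans p2) ?orbT // hnD ?Dj.
Qed.

End SweepFacts.

Section SweepCode.
Local Open Scope nat_scope.
Local Notation "a ++i b" := (IAdd a b) (at level 50, left associativity).
Local Notation "a --i b" := (ISub a b) (at level 50, left associativity).
Local Notation "a **i b" := (IMul a b) (at level 40, left associativity).
Local Notation "a %/i b" := (IDiv a b) (at level 40, left associativity).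
Local Notation r := RReg.
Local Notation i_ := IReg.
Local Notation "k %:i" := (IConst k) (at level 1, left associativity, format "k %:i").

(** When the least pending time exceeds the current one, the count for the current time is complete
    and is compared with the best. It is then reset to the number of points of odd parity, no
    contact at the new time having been processed. *)
Definition advance_code : cmd := block [::
  ILoad 8 1%:i; RLoad 2 (i_ 4 ++i i_ 8);
  If (TRLt (r 1) (r 2))
     (block [:: If (TILt (i_ 14) (i_ 12)) (Seq (ISet 14 (i_ 12)) (RSet 0 (r 1))) Skip;
        ISet 12 (i_ 13); RSet 1 (r 2)]) Skip].

(** The contribution of the point is withdrawn, its parity or contact time updated, and its
    contribution added again. A point is in contact now when its contact time is not below the
    current time. *)
Definition touch_code : cmd := block [::
  ISet 6 (i_ 8 %/i (i_ 1 **i 6%:i));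
  ILoad 10 (2%:i **i i_ 2 ++i i_ 6); RLoad 3 (i_ 4 ++i (i_ 2 ++i i_ 6));
  ISet 13 (i_ 13 --i i_ 10);
  If (TRLt (r 3) (r 1)) (ISet 12 (i_ 12 --i i_ 10)) (ISet 12 (i_ 12 --i 1%:i));
  If (TILt (i_ 8 --i 6%:i **i (i_ 8 %/i 6%:i)) 4%:i)
     (Seq (ISet 10 (1%:i --i i_ 10)) (IStore (2%:i **i i_ 2 ++i i_ 6) (i_ 10)))
     (Seq (RSet 3 (r 1)) (RStore (i_ 4 ++i (i_ 2 ++i i_ 6)) (r 1)));
  ISet 13 (i_ 13 ++i i_ 10);
  If (TRLt (r 3) (r 1)) (ISet 12 (i_ 12 ++i i_ 10)) (ISet 12 (i_ 12 ++i 1%:i));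
  RStore (i_ 4 ++i i_ 8) two_pi;
  ISet 9 ((i_ 2 ++i i_ 8) %/i 2%:i)].

Definition sweep_code : cmd :=
  While (TRLt (r 1) two_pi)
    (Seq advance_code (If (TRLt (r 2) two_pi) (Seq touch_code climb_code) Skip)).

Variables (R : realType) (n m M : nat) (key : nat -> R) (start : pred nat).
Hypotheses (n0 : 0 < n) (m0 : 0 < m) (HM : 20 * (n * m) <= M).
Hypothesis key_range : forall j, (0 <= key j <= 2 * pi)%R.
Implicit Types (s : state R) (D : pred nat).

Let N := 6 * (n * m).
Let F := 2 * (n + m + 1).
Local Notation parity D := (parity_upto n (m * 6) is_toggle start D).
Local Notation marks := (marked_at n (m * 6) is_toggle key).
Local Notation value := (value n (m * 6) is_toggle key start).

(* [D] is the set of events already processed; their keys are replaced by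
   [2 * pi].  Real register 1 holds the current time; integer registers 13 and 12
   count the points of odd parity and the covered points; the best value so far
   and the time where it is attained are in registers 14 and 0. *)
Record sweep_core D s : Prop := SweepCore {
  sc_layout : layout n m s;
  sc_keys : forall j, j < N -> keys F s j = if D j then (2 * pi)%R else key j;
  sc_cur : (0 <= rreg s 1 <= 2 * pi)%R;
  sc_done : forall j, j < N -> D j -> (key j <= rreg s 1)%R /\ (key j < 2 * pi)%R;
  sc_todo : forall j, j < N -> ~~ D j -> (rreg s 1 <= key j)%R;
  sc_bits : forall k, k < n -> imem s (2 * N + k) = parity D k;
  sc_last : forall k, k < n -> (rmem s (F + (N + k)) < rreg s 1)%R = ~~ marks D (rreg s 1) k;
  sc_last_le : forall k, k < n -> (rmem s (F + (N + k)) <= rreg s 1)%R;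
  sc_base : ireg s 13 = \sum_(0 <= k < n) (parity D k : nat);
  sc_val : ireg s 12 = \sum_(0 <= k < n) (parity D k || marks D (rreg s 1) k : nat);
  sc_out : (0 <= rreg s 0 < 2 * pi)%R;
  sc_best_le : ireg s 14 <= value (rreg s 0);
  sc_best : forall phi, (0 <= phi < rreg s 1)%R -> value phi <= ireg s 14;
  sc_best_n : ireg s 14 <= n }.

(** [sweep_core] mentions neither the tree nor register 9, so repairing the tree preserves it. *)
Lemma core_frame D s s' v : fix_frame s (set_ireg s' 9 v) ->
  (forall x, 2 * N <= x -> imem s' x = imem s x) -> sweep_core D s -> sweep_core D s'.
Proof.
move=> [/= f1 f2 f3] f4 [[l0 l1 l2 l3 l4] c1 c2 c3 c4 c5 c6 c7 c8 c9 c10 c11 c12 c13].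
have g x : x < 20 -> x != 9 -> ireg s' x = ireg s x.
  by move=> xl /negbTE x9; have := f2 x xl; rewrite x9.
split.
- by split; rewrite g.
- by move=> j jN; rewrite -c1 // /keys f1.
- by rewrite f3.
- by rewrite f3.
- by rewrite f3.
- by move=> k kn; rewrite f4 ?leq_addr // c5.
- by move=> k kn; rewrite f1 f3 // c6.
- by move=> k kn; rewrite f1 f3 // c7.
- by rewrite g.
- by rewrite g // f3.
- by rewrite f3.
- by rewrite g // f3.
- by move=> phi; rewrite f3 // g //; exact: c12.
- by rewrite g.
Qed.

Lemma sweep_sizes : [/\ 0 < n * m, n <= n * m, m <= n * m & n + m <= (n * m).+1].
Proof. exact: sizes. Qed.

(** The cells used are the first [2 * N + n] integer ones and [F + (N + n)] real ones; as [n + m] is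
    at most [n * m + 1], [20 * (n * m)] is enough for both. *)
Lemma mem_bounds : [/\ 2 * N + n < M, F + (N + n) < M, 1 < N & n < M].
Proof. by have [nm0 nle mle nmle] := sweep_sizes; split; rewrite /N /F; lia. Qed.

Lemma NE : n * (m * 6) = N. Proof. by rewrite /N; lia. Qed.

Definition advanced D s' := [/\ sweep_core D s', tree_ok N (imem s') (keys F s'), ireg s' 8 < N,
  keys F s' (ireg s' 8) = rreg s' 2 & rreg s' 1 = rreg s' 2].

(** The root gives the least pending time [v2], and [value_between] shows that no angle before it
    beats the current one. *)
Lemma wp_advance D s : sweep_core D s -> tree_ok N (imem s) (keys F s) -> (rreg s 1 < 2 * pi)%R ->
  wp M advance_code (advanced D) s.
Proof.
move=> core tree cur2; case: (core) => [[l0 l1 l2 l3 l4] c1 c2 c3 c4 c5 c6 c7 c8 c9 c10 c11 c12 c13].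
have [nm0 nle mle nmle] := sweep_sizes.
have [t1N tmin] : imem s 1 < N /\ forall j, j < N -> (keys F s (imem s 1) <= keys F s j)%R.
  by apply: tree_root => //; rewrite /N; lia.
rewrite /advance_code /block.
have [mb1 mb2 mb3 mb4] := mem_bounds.
apply: wp_iload => [|v8 e8]; first by rewrite /=; clear -mb1 mb3; lia.
rewrite /= in e8; rewrite -e8 in t1N tmin.
apply: wp_rload => [|v2 e2]; first by rewrite /= l4 -/F; clear -t1N mb2; lia.
rewrite /= l4 -/(keys F s v8) in e2.
have ge_cur : (rreg s 1 <= v2)%R.
  rewrite e2 c1 //; case Dj : (D v8); first exact: ltW.
  by apply: c4; rewrite ?Dj.
have v2_2pi : (v2 <= 2 * pi)%R.
  by rewrite e2 c1 //; case: (D v8) => //; case/andP: (key_range v8).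
have next j : j < N -> ~~ D j -> (v2 <= key j)%R.
  by move=> jN nD; rewrite e2; have := tmin j jN; rewrite [X in (_ <= X)%R]c1 // (negbTE nD).
have vn : ireg s 12 <= n by rewrite c9; exact: sum_bool_le.
have bn : ireg s 13 <= n by rewrite c8; exact: sum_bool_le.
apply: wp_if; rewrite [teval _ _]/= => h; last first.
  have cv : rreg s 1 = v2 by apply/eqP; rewrite eq_le ge_cur leNgt h.
  by split=> //=.
have hD j : j < n * (m * 6) -> D j -> (key j <= rreg s 1)%R by rewrite NE => jN /(c3 j jN) [].
have hnD j : j < n * (m * 6) -> ~~ D j -> (v2 <= key j)%R by rewrite NE => /next.
have [vcur vphi] := value_between is_toggle start hD hnD h.
have new_best b o : (0 <= o < 2 * pi)%R -> b <= value o -> value (rreg s 1) <= b -> ireg s 14 <= b -> b <= n ->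
    advanced D (set_rreg (set_ireg (set_rreg (set_ireg
      (set_rreg (set_ireg s 8 v8) 2 v2) 14 b) 0 o) 12 (ireg s 13)) 1 v2).
  move=> o1 o2 o3 o4 o5.
  (* Processed events are not later than the old time, so none of them is at [v2]. *)
  have mk k : marks D v2 k = false.
    apply/hasPn => j; rewrite mem_iota add0n /= NE => jN; rewrite !negb_and.
    apply/orP; right; apply/orP; right; case Dj : (D j) => //=.
    by rewrite neq_lt (le_lt_trans _ h) //; case: (c3 j jN Dj).
  split=> //=; split=> //=.
  - by rewrite v2_2pi andbT (le_trans _ ge_cur) //; case/andP: c2.
  - by move=> j jN Dj; have [d1 d2] := c3 j jN Dj; rewrite (le_trans d1 ge_cur).
  - by move=> k kn; rewrite mk (le_lt_trans (c7 k kn) h).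
  - by move=> k kn; apply: le_trans (c7 k kn) ge_cur.
  - by rewrite c8; apply: eq_bigr => k _; rewrite mk orbF.
  - move=> phi /andP[p0 p1]; have [hp|hp] := ltP phi (rreg s 1).
      by apply: leq_trans o4; apply: c12; rewrite p0.
    by apply: leq_trans o3; apply: vphi; rewrite hp.
have vE : ireg s 12 = value (rreg s 1) by rewrite c9 vcur.
have [c20 _] := andP c2.
apply: (@wp_seq_eq _ _ _ _ _ (if ireg s 14 < ireg s 12 then
    set_rreg (set_ireg (set_rreg (set_ireg s 8 v8) 2 v2) 14 (ireg s 12)) 0 (rreg s 1)
  else set_rreg (set_ireg (set_rreg (set_ireg s 8 v8) 2 v2) 14 (ireg s 14)) 0 (rreg s 0))).
  apply: wp_if; rewrite [teval _ _]/= => hb; rewrite ?hb ?(negbTE hb).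
    by rewrite /=; split; [clear -vn mb4; lia|move=> v -> v' ->].
  rewrite /=; set s0 := set_rreg (set_ireg s 8 v8) 2 v2.
  by rewrite (set_ireg_id s0 14 : set_ireg s0 14 (ireg s 14) = s0) (set_rreg_id s0 0 : set_rreg s0 0 (rreg s 0) = s0).
case: ifP => hb; rewrite /=; (split; [by clear -bn mb4; lia|move=> v -> v' ->]).
  by apply: new_best; [rewrite c20|rewrite vE|rewrite vE|exact: ltnW|exact: vn].
by apply: new_best; [|by []|rewrite -vE leqNgt hb|by []|by []].
Qed.

Definition flipped k s D s' := [/\ forall x, x != 10 -> ireg s' x = ireg s x,
  (forall x, x != 3 -> rreg s' x = rreg s x) /\ (rreg s' 3 <= rreg s 1)%R,
  ireg s' 10 = parity D k /\ (rreg s' 3 < rreg s 1)%R = ~~ marks D (rreg s 1) k,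
  (forall x, x != 2 * N + k -> imem s' x = imem s x) /\ imem s' (2 * N + k) = parity D k &
  (forall x, x != F + (N + k) -> rmem s' x = rmem s x) /\ rmem s' (F + (N + k)) = rreg s' 3].

Definition touched D j c s' := [/\ sweep_core D s', ireg s' 9 = (N + j)./2, rreg s' 1 = c &
  forall v, 0 < v < 2 * N -> ~ anc v (N + j)./2 -> tree_node N (imem s') (keys F s') v].

(** A stored time below [2 * pi] belongs to a pending event. Only the point owning it changes, so
    one term of each count is updated, and the tree can be wrong only above the leaf of the
    event. *)
Lemma wp_touch D s : advanced D s -> (rreg s 2 < 2 * pi)%R ->
  ~~ D (ireg s 8) /\ wp M touch_code (touched (fun i => D i || (i == ireg s 8)) (ireg s 8) (rreg s 1)) s.
Proof.
move=> [core tree jN kj r12] th2; case: (core) => [[l0 l1 l2 l3 l4] c1 c2 c3 c4 c5 c6 c7 c8 c9 c10 c11 c12 c13].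
have [nm0 nle mle nmle] := sweep_sizes.
have [mb1 mb2 mb3 mb4] := mem_bounds.
set j := ireg s 8 in jN kj *; set D' := fun i => _.
have nD : ~~ D j.
  by apply/negP => Dj; move: kj th2; rewrite c1 // Dj => <-; rewrite ltxx.
split=> //; have keyj : key j = rreg s 1 by move: kj; rewrite c1 // (negbTE nD) r12.
set k := j %/ (m * 6).
have kn : k < n by rewrite /k ltn_divLR ?NE // muln_gt0 m0.
have jN' : j < n * (m * 6) by rewrite NE.
have bE : imem s (2 * N + k) = parity D k by exact: c5.
have lE := c6 k kn; have leE := c7 k kn.
have vn : ireg s 12 <= n by rewrite c9; exact: sum_bool_le.
have bn : ireg s 13 <= n by rewrite c8; exact: sum_bool_le.
have par' k' : parity D' k' = parity D k' (+) (is_toggle j && (k == k')).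
  exact: parity_upto_add.
have mrk' k' : marks D' (rreg s 1) k' = marks D (rreg s 1) k' || (~~ is_toggle j && (k == k')).
  exact: marked_add.
rewrite /touch_code /block.
apply: wp_iset => [|v6 e6]; first by rewrite /= l1 -/j -/k; clear -kn mb4; lia.
rewrite /= l1 -/j -/k in e6.
apply: wp_iload => [|v10 e10]; first by rewrite /= l2 e6 -/N; clear -kn mb1; lia.
rewrite /= l2 e6 bE in e10.
apply: wp_rload => [|v3 e3]; first by rewrite /= l4 l2 e6 -/N -/F; clear -kn mb2; lia.
rewrite /= l4 l2 e6 in e3.
apply: wp_iset => [|v13 e13]; first by rewrite /=; clear -bn mb4; lia.
rewrite /= in e13.
set s1 := set_ireg _ _ _.
apply: (@wp_seq_eq _ _ _ _ _ (set_ireg s1 12 (ireg s 12 - (parity D k || marks D (rreg s 1) k)))).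
  apply: wp_if; rewrite [teval _ _]/= e3 lE => h; (split; [by rewrite /=; clear -vn mb4; lia|move=> v ->]) => /=.
    by rewrite (negbTE h) orbF e10.
  by move: h; rewrite negbK => ->; rewrite orbT.
set s2 := set_ireg s1 12 _.
have j6 : j - 6 * (j %/ 6) = j %% 6 by rewrite {1}(divn_eq j 6) mulnC addKn.
apply: (@wp_seq _ _ _ _ _ (flipped k s2 D')).
  apply: wp_if; rewrite [teval _ _]/= -/j j6 -/(is_toggle j) => tg.
    rewrite /=; split; [by clear -mb1 mb3; lia|move=> v ->].
    split; rewrite /= ?l2 ?e6 -/N; [by clear -kn mb1; lia|by clear -mb1 mb3; lia|].
    split=> /=.
    - by move=> x /negbTE ->.
    - by split=> //; rewrite e3.
    - by rewrite par' mrk' tg eqxx e10 e3 lE /= orbF addbT; split=> //; case: (parity D k).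
    - split=> [x /negbTE ->//|]; rewrite eqxx par' tg eqxx e10 addbT; by case: (parity D k).
    - by split=> //; rewrite e3.
  rewrite /= => v ->; split; rewrite /= ?l2 ?l4 ?e6 -/N -/F; first by clear -kn mb2; lia.
  split=> /=.
  - by [].
  - by split=> // x /negbTE ->.
  - by rewrite par' mrk' (negbTE tg) eqxx e10 ltxx /= orbT addbF.
  - by split=> //; rewrite par' (negbTE tg) addbF.
  - by split=> [x /negbTE ->//|]; rewrite eqxx.
move=> s3 [f1 [f2 f2'] [f3 f4] [f5 f6] [f7 f8]].
have bsum : parity D k <= ireg s 13.
  by rewrite c8 big_mkord (bigD1 (Ordinal kn)) //= leq_addr.
have vsum : (parity D k || marks D (rreg s 1) k : nat) <= ireg s 12.
  by rewrite c9 big_mkord (bigD1 (Ordinal kn)) //= leq_addr.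
have base' : ireg s 13 - parity D k + parity D' k = \sum_(0 <= k' < n) (parity D' k' : nat).
  rewrite c8 -(@sum_update n (fun k' => parity D' k' : nat)) // => k' k'n k'k.
  by rewrite par' eq_sym (negbTE k'k) andbF addbF.
have val' : ireg s 12 - (parity D k || marks D (rreg s 1) k) + (parity D' k || marks D' (rreg s 1) k) =
    \sum_(0 <= k' < n) (parity D' k' || marks D' (rreg s 1) k' : nat).
  rewrite c9 -(@sum_update n (fun k' => parity D' k' || marks D' (rreg s 1) k' : nat)) // => k' k'n k'k.
  by rewrite par' mrk' eq_sym (negbTE k'k) !andbF addbF orbF.
have g13 : ireg s3 13 = ireg s 13 - parity D k by rewrite f1 //= e13 e10.
have g12 : ireg s3 12 = ireg s 12 - (parity D k || marks D (rreg s 1) k) by rewrite f1.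
apply: wp_iset => [|w13 h13]; first by rewrite /= g13 f3 base' ; apply: leq_ltn_trans mb4; exact: sum_bool_le.
rewrite /= g13 f3 base' in h13.
apply: (@wp_seq_eq _ _ _ _ _ (set_ireg (set_ireg s3 13 w13) 12
  (\sum_(0 <= k' < n) (parity D' k' || marks D' (rreg s 1) k' : nat)))).
  have r1 : rreg s3 1 = rreg s 1 by rewrite f2.
  have vM : ireg s 12 - (parity D k || marks D (rreg s 1) k) + (parity D' k || marks D' (rreg s 1) k) < M.
    by rewrite val'; apply: leq_ltn_trans mb4; exact: sum_bool_le.
  apply: wp_if; rewrite [teval _ _]/= r1 f4 -val' => h.
    by rewrite (negbTE h) orbF in vM *; split; rewrite /= g12 f3 // => v ->.
  rewrite negbK in h; rewrite h orbT in vM *.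
  by split; rewrite /= g12 // => v ->.
have q4 : ireg s3 4 = F by rewrite f1.
have q8 : ireg s3 8 = j by rewrite f1.
have q2 : ireg s3 2 = N by rewrite f1.
apply: wp_rstore; first by rewrite /= q4 q8; clear -jN mb2; lia.
rewrite [ieval _ _]/= [reval _ _]/= q4 q8.
split; rewrite /= q2 q8; first by rewrite divn2; clear -jN mb1; lia.
move=> v9 e9.
have rm x : x != F + j -> x != F + (N + k) -> rmem s3 x = rmem s x by move=> _; exact: f7.
have jk i : i < N -> F + i != F + (N + k) by rewrite eqn_add2l; clear; lia.
have kj' i : (F + (N + i) == F + j) = false by rewrite eqn_add2l; clear -jN; lia.
have r1 : rreg s3 1 = rreg s 1 by rewrite f2.
have r0 : rreg s3 0 = rreg s 0 by rewrite f2.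
have i14 : ireg s3 14 = ireg s 14 by rewrite f1.
split=> /=; last 3 first.
- by rewrite e9 divn2.
- exact: r1.
- move=> v hv na.
  have im x : x < 2 * N -> imem s3 x = imem s x by move=> hx; apply: f5; clear -hx; lia.
  have := tree v hv; rewrite /tree_node; case: ifP => vN ok; last by rewrite im //; case/andP: hv.
  have nanc : ~ anc v (N + j) by case/anc_step => // e; move: vN; rewrite e; clear; lia.
  have wN : 0 < v < N by rewrite vN andbT; case/andP: hv.
  apply: (@node_ok_ext _ _ (imem s)); [by apply: im; clear -wN; lia|
    by apply: im; clear -wN; lia|by apply: im; clear -wN; lia|].
  apply: (@node_ok_key _ _ _ (keys F s) _ j) => // i iN ij.
  by rewrite /keys /= eqn_add2l (negbTE ij) rm ?jk // eqn_add2l.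
split=> /=; rewrite ?r0 ?r1 ?i14 //.
- by split; rewrite /= f1.
- move=> i iN; rewrite /keys /= eqn_add2l /D'; have [->|ij] := eqVneq i j; first by rewrite orbT.
  by rewrite orbF rm ?jk ?eqn_add2l // -c1.
- by move=> i iN /orP[/(c3 i iN)//|/eqP ->]; rewrite keyj lexx r12.
- by move=> i iN; rewrite /D' negb_or => /andP[/(c4 i iN)].
- move=> k' k'n; have [->|k'k] := eqVneq k' k; first exact: f6.
  by rewrite f5 ?eqn_add2l // par' eq_sym (negbTE k'k) andbF addbF; exact: c5.
- move=> k' k'n; rewrite kj'; have [->|k'k] := eqVneq k' k; first by rewrite f8.
  by rewrite f7 ?eqn_add2l //= mrk' eq_sym (negbTE k'k) andbF orbF; exact: c6.
- move=> k' k'n; rewrite kj'; have [->|k'k] := eqVneq k' k; first by rewrite f8.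
  by rewrite f7 ?eqn_add2l //=; exact: c7.
Qed.

(** The measure counts the pending events, plus one for the last round, which only moves the time to
    [2 * pi]. *)
Definition sweep_inv (i : nat) s := exists D, [/\ sweep_core D s, tree_ok N (imem s) (keys F s) &
  i = (rreg s 1 < 2 * pi)%R + \sum_(0 <= j < N) (~~ D j : nat)].

Lemma runs_sweep s d : 2 * N <= 2 ^ d -> sweep_inv N.+1 s ->
  runs M sweep_code s (N.+1 * (d * 100 + 1000) + 100) (fun s' => exists2 D, sweep_core D s' & rreg s' 1 = (2 * pi)%R).
Proof.
move=> hd I0; have [nm0 nle mle nmle] := sweep_sizes.
have step i s0 : sweep_inv i s0 -> teval s0 (TRLt (r 1) two_pi) -> 0 < i /\
    runs M (Seq advance_code (If (TRLt (r 2) two_pi) (Seq touch_code climb_code) Skip)) s0 (d * 100 + 900) (sweep_inv i.-1).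
  move=> [D [core tree iE]] cur2; have {}cur2 : (rreg s0 1 < 2 * pi)%R by [].
  rewrite cur2 in iE; split; first by rewrite iE.
  have -> : d * 100 + 900 = 200 + (d * 100 + 700) by lia.
  apply: (@runs_seq _ _ _ _ _ _ _ (advanced D)).
    by apply: runs_weaken (wp_runs (wp_advance core tree cur2)) _ _.
  move=> s1 adv; have [core1 tree1 jN kj r12] := adv.
  have T : (tcost (TRLt (r 2) two_pi) + (d * 100 + 600)).+1 <= d * 100 + 700 by rewrite [tcost _]/=; lia.
  apply: (@runs_weaken _ _ _ _ _ _ (sweep_inv i.-1) _ _ T) => //; apply: runs_if => th2; last first.
    apply: (runs_weaken (wp_runs (c := Skip) (Q := sweep_inv i.-1) _)) => //; last by rewrite /=; lia.
    exists D; split=> //; rewrite iE /= r12; suff -> : (rreg s1 2 < 2 * pi)%R = false by [].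
    exact: negbTE.
  have {}th2 : (rreg s1 2 < 2 * pi)%R by [].
  have [nD tch] := wp_touch adv th2.
  have -> : d * 100 + 600 = 500 + (d * 100 + 100) by lia.
  apply: (@runs_seq _ _ _ _ _ _ _ (touched (fun i => D i || (i == ireg s1 8)) (ireg s1 8) (rreg s1 1))).
    by apply: runs_weaken (wp_runs tch) _ _.
  move=> s2 [core2 r9 r1 tr2]; have [l0 l1 l2 l3 l4] := sc_layout core2.
  have hd' : N + ireg s1 8 < 2 ^ d by apply: leq_trans hd; lia.
  have MF : 2 * N + F <= M by rewrite /N /F; lia.
  have N1 : 1 < N by rewrite /N; lia.
  apply: runs_weaken (runs_climb MF l4 jN N1 r9 hd' tr2) _ _; first by lia.
  move=> s3 [fr im tr3]; have core3 := core_frame fr im core2.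
  eexists; split; [exact: core3|exact: tr3|].
  have [_ _ fr3] := fr; have := fr3 1 isT => /= ->.
  rewrite r1 r12 th2 iE.
  have jN2 : \sum_(0 <= j < N) (~~ (D j || (j == ireg s1 8)) : nat) = \sum_(0 <= j < N) (~~ D j : nat) - 1.
    rewrite (@sum_update N _ (fun j => ~~ D j : nat) _ jN) ?nD ?eqxx ?orbT ?addn0 // => j _ /negbTE ->.
    by rewrite orbF.
  have pos : 0 < \sum_(0 <= j < N) (~~ D j : nat).
    by rewrite big_mkord (bigD1 (Ordinal jN)) //= nD.
  by rewrite jN2 /=; move: pos; clear; move: (\sum_(_ <= _ < _) _) => x; lia.
have h := runs_while step I0; apply: (runs_weaken h).
  by rewrite [tcost _]/=; nia.
move=> s' [nb [i [D [core tree _]]]]; exists D => //; rewrite /= in nb.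
by have /andP[_ c2] := sc_cur core; apply/eqP; rewrite eq_le c2 leNgt; exact: nb.
Qed.

End SweepCode.

(** * The program *)

Section Program.
Local Open Scope nat_scope.
Local Notation "a ++i b" := (IAdd a b) (at level 50, left associativity).
Local Notation "a --i b" := (ISub a b) (at level 50, left associativity).
Local Notation "a **i b" := (IMul a b) (at level 40, left associativity).
Local Notation i_ := IReg.
Local Notation "k %:i" := (IConst k) (at level 1, left associativity, format "k %:i").

Definition clear_code : cmd := block [::
  IStore (2%:i **i i_ 2 ++i i_ 5) 0%:i; RStore (i_ 4 ++i (i_ 2 ++i i_ 5)) (RSub (RInt 0) (RInt 1))].

Definition sum_code : cmd := block [::
  ILoad 11 (2%:i **i i_ 2 ++i i_ 5); ISet 13 (i_ 13 ++i i_ 11)].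

Definition setup_code : cmd := block [::
  ISet 3 (i_ 0 **i i_ 1); ISet 2 (6%:i **i i_ 3); ISet 4 (2%:i **i (i_ 0 ++i i_ 1 ++i 1%:i)); ISet 5 0%:i].

Definition start_sweep_code : cmd := block [::
  RSet 1 (RInt 0); RSet 0 (RInt 0); ISet 14 0%:i; ISet 12 (i_ 13)].

Definition fixed_mcr_program : cmd :=
  Seq setup_code (Seq (for_loop 5 0 clear_code)
  (Seq (ISet 5 0%:i) (Seq (for_loop 5 3 event_code)
  (Seq (Seq (ISet 5 0%:i) (ISet 13 0%:i)) (Seq (for_loop 5 0 sum_code)
  (Seq (ISet 9 (2%:i **i i_ 2 --i 1%:i)) (Seq build_code
  (Seq start_sweep_code sweep_code)))))))).

Variables (R : realType) (n m M : nat) (S : n.-tuple (R * R)) (P : m.-tuple (R * R)) (o : R * R).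
Hypotheses (n0 : 0 < n) (m0 : 0 < m) (HM : 20 * (n * m) <= M).
Implicit Types (s : state R).

Let N := 6 * (n * m).
Let F := 2 * (n + m + 1).

Lemma ang_range (v : R * R) : (0 <= ang v <= 2 * pi)%R.
Proof.
have [->|v0] := eqVneq v 0%R; last by have [/andP[h1 h2] _] := ang_spec v0; rewrite h1 ltW.
(* For the null vector the conventional quotient 0 gives the angle [acos 0], still in range. *)
rewrite /ang /= ltxx mul0r acos0; have := pi_gt0 R => p0; apply/andP; split; lra.
Qed.

Lemma event_key_range j : (0 <= event_key S P o j <= 2 * pi)%R.
Proof.
have p2 : (0 <= (2 * pi : R) <= 2 * pi)%R by rewrite lexx mulr_ge0 // pi_ge0.
have turn (a b : R * R) : (0 <= turn_key a b <= 2 * pi)%R by rewrite /turn_key; case: ifP => // _; exact: ang_range.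
rewrite /event_key; case: ifP => // _; rewrite /edge_key.
by case: (j %% 6) => [|[|[|[|[|c]]]]] //; case: ifP => // _; exact: ang_range.
Qed.

Lemma point_startE k : k < n ->
  point_start S P o k = \big[addb/false]_(0 <= q < n * m) ((q %/ m == k) && pair_start S P o q).
Proof.
move=> kn; rewrite big_nat_blocks.
rewrite (eq_big_nat _ _ (F2 := fun k' => (k' == k) && point_start S P o k)); last first.
  move=> k' _; rewrite (eq_big_nat _ _ (F2 := fun i => (k' == k) &&
      ((arm S o k' != 0%R) && edge_start (end1 S P o k' i) (end2 S P o k' i)))).
    have [->|_] := eqVneq k' k; last by rewrite big1.
    rewrite /= /point_start; case: (arm S o k == 0%R) => //=; by rewrite big1.
  move=> i /andP[_ im]; rewrite /pair_start divnMDl // (divn_small im) addn0.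
  by rewrite modnMDl (modn_small im).
by rewrite (big_addb_single (fun=> point_start S P o k)).
Qed.

Definition cleared (i : nat) s := [/\ layout n m s, inputs S P o s, ireg s 5 = i,
  forall k, k < i -> imem s (2 * N + k) = 0 & forall k, k < i -> rmem s (F + (N + k)) = (-1)%R].

Definition started (q : nat) s := [/\ layout n m s, inputs S P o s, ireg s 5 = q,
  forall j, j < 6 * q -> keys F s j = event_key S P o j &
  (forall k, k < n -> imem s (2 * N + k) = \big[addb/false]_(0 <= q' < q) ((q' %/ m == k) && pair_start S P o q')) /\
  (forall k, k < n -> rmem s (F + (N + k)) = (-1)%R)].

Definition ready s := [/\ layout n m s, forall j, j < N -> keys F s j = event_key S P o j,
  forall k, k < n -> imem s (2 * N + k) = point_start S P o k &
  forall k, k < n -> rmem s (F + (N + k)) = (-1)%R].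

Definition summed (i : nat) s := [/\ ready s, ireg s 5 = i &
  ireg s 13 = \sum_(0 <= k < i) (point_start S P o k : nat)].

Lemma runs_clear s : cleared 0 s -> runs M (for_loop 5 0 clear_code) s (n * 28 + 4) (cleared n).
Proof.
have [mb1 mb2 mb3 mb4] := mem_bounds n0 m0 HM.
apply: (@runs_for _ _ 5 0 clear_code 20) => // [i s1 [[h _ _ _ _] _ h5 _ _] //|i s1 iN [L I r5 b l]].
have [l0 l1 l2 l3 l4] := L; have [i1 i2 i3] := I.
apply: runs_weaken (wp_runs (Q := fun s' => ireg s' 5 = i /\ cleared i.+1 (set_ireg s' 5 i.+1)) _) _ _ => //.
rewrite /clear_code /block; apply: wp_istore; rewrite /= ?l2 ?r5 -/N; [by clear -iN mb1; lia|by clear -mb1 mb3; lia|].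
split; rewrite ?l4 ?l2 -/F -/N; first by clear -iN mb2; lia.
split=> //; split=> //=.
- have ne x : x < F -> (x == F + (N + i)) = false by clear; lia.
  split=> [k kn|k kn|]; rewrite /= !ne; [exact: i1| | |exact: i2| | |exact: i3| |]; rewrite /F; lia.
- move=> k; rewrite eqn_add2l ltnS leq_eqVlt => /orP[/eqP ->|ki]; first by rewrite eqxx.
  by rewrite (ltn_eqF ki); exact: b.
- move=> k; rewrite !eqn_add2l ltnS leq_eqVlt => /orP[/eqP ->|ki]; first by rewrite eqxx sub0r.
  by rewrite (ltn_eqF ki); exact: l.
Qed.

Lemma runs_events s : started 0 s ->
  runs M (for_loop 5 3 event_code) s (n * m * (cmd_cost event_code + 8) + 4) (started (n * m)).
Proof.
have [mb1 mb2 mb3 mb4] := mem_bounds n0 m0 HM.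
have nmM : n * m < M by clear -HM mb1; lia.
apply: (@runs_for _ _ 5 3 event_code) => // [i s1 [[_ _ _ h _] _ h5 _ _] //|q s1 qN [L I r5 ks [bs ls]]].
have [l0 l1 l2 l3 l4] := L; have [i1 i2 i3] := I.
apply: (runs_weaken (wp_runs (wp_event n0 m0 HM L I qN r5))) => // s2 [f1 f2 f3 f4 f5].
have kn : q %/ m < n by rewrite ltn_divLR.
rewrite l4 -/F in f2 f3; rewrite -/N in f4 f5.
have low x : x < F -> rmem s2 x = rmem s1 x by move=> xF; apply: f2; clear -xF; lia.
split; first by rewrite f1.
split=> //=.
- by split; rewrite /= f1.
- split=> [k kn'|k kn'|]; rewrite /= !low; [exact: i1| | |exact: i2| | |exact: i3| |]; rewrite /F; lia.
- move=> j jq; rewrite /keys /=; have [j6|j6] := ltnP j (6 * q).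
    by rewrite f2 ?ks //; [exact: ks|clear -j6; lia].
  by have := f3 (j - 6 * q); rewrite subnKC //; apply; clear -j6 jq; lia.
split=> [k k'n|k k'n].
  rewrite big_nat_recr //=; have [<-|kq] := eqVneq (q %/ m) k.
    by rewrite f5 bs // ?oddb ?andTb 1?addbC //; case: (\big[_/_]_(_ <= _ < _) _).
  by rewrite f4 ?bs ?andFb ?addbF // eqn_add2l eq_sym.
rewrite f2 ?ls //; clear -qN; rewrite /N /F; lia.
Qed.

Lemma runs_sum s : summed 0 s -> runs M (for_loop 5 0 sum_code) s (n * 28 + 4) (summed n).
Proof.
have [mb1 mb2 mb3 mb4] := mem_bounds n0 m0 HM.
apply: (@runs_for _ _ 5 0 sum_code 20) => // [i s1 [[[h _ _ _ _] _ _ _] h5 _] //|i s1 iN [[L ks bs ls] r5 r13]].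
have [l0 l1 l2 l3 l4] := L.
apply: runs_weaken (wp_runs (Q := fun s' => ireg s' 5 = i /\ summed i.+1 (set_ireg s' 5 i.+1)) _) _ _ => //.
have vE : ireg s1 13 + imem s1 (2 * N + i) = \sum_(0 <= k < i.+1) (point_start S P o k : nat).
  by rewrite big_nat_recr //= -r13 bs.
have vM : \sum_(0 <= k < i.+1) (point_start S P o k : nat) < M.
  by apply: leq_ltn_trans (sum_bool_le _ _) _; apply: leq_ltn_trans mb4.
rewrite /sum_code /block; apply: wp_iload => [|v11 e11]; first by rewrite /= l2 r5 -/N; clear -iN mb1; lia.
rewrite /= l2 r5 -/N in e11.
by split; rewrite /= e11 vE // => v ->; split=> //; split=> //; split.
Qed.

Definition total_time d := 40 + (n * 28 + 4 + (2 + (n * m * (cmd_cost event_code + 8) + 4 + (4 + (n * 28 + 4 +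
  (6 + (2 * N * 100 + 10 + (10 + (N.+1 * (d * 100 + 1000) + 100))))))))).

Lemma runs_program s d : 2 * N <= 2 ^ d -> ireg s 0 = n -> ireg s 1 = m -> inputs S P o s ->
  runs M fixed_mcr_program s (total_time d) (fun s' => (0 <= rreg s' 0 < 2 * pi)%R /\
    forall phi, (0 <= phi < 2 * pi)%R -> the_value S P o phi <= the_value S P o (rreg s' 0)).
Proof.
move=> hd l0 l1 I; have [mb1 mb2 mb3 mb4] := mem_bounds n0 m0 HM; have [nm0 nle mle nmle] := sizes n0 m0.
rewrite /total_time; have events := runs_events; move: (cmd_cost event_code) events => e events.
apply: (@runs_seq _ _ _ _ _ _ _ (cleared 0)).
  apply: runs_weaken (wp_runs (Q := cleared 0) _) _ _ => //.
  rewrite /= l0 l1; split; first by clear -HM nm0; lia.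
  move=> v3 ->; split; first by clear -mb1; lia.
  move=> v2 ->; split; first by clear -mb2; lia.
  move=> v4 ->; split; first by clear -mb1; lia.
  by move=> v5 ->; split=> //; split.
move=> s1 /runs_clear h1; apply: (runs_seq h1) => {h1} s2 [L I2 r5 b l].
apply: (@runs_seq _ _ _ _ _ _ _ (started 0)).
  apply: runs_weaken (wp_runs (Q := started 0) _) _ _ => //.
  split=> [|v ->] /=; first by clear -mb1; lia.
  by split=> //; split=> // k kn; rewrite big_geq // b.
move=> s3 /events h1; apply: (runs_seq h1) => {h1} s4 [L4 _ r54 k4 [b4 l4]].
apply: (@runs_seq _ _ _ _ _ _ _ (summed 0)).
  apply: runs_weaken (wp_runs (Q := summed 0) _) _ _ => //.
  rewrite /=; split=> [|v ->]; first by clear -mb1; lia.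
  split=> [|v' ->]; first by clear -mb1; lia.
  split=> //=; last by rewrite big_geq.
  by split=> // k kn; rewrite b4 // point_startE.
move=> s5 /runs_sum h1; apply: (runs_seq h1) => {h1} s6 [R6 _ r13].
have [L6 k6 b6 la6] := R6; have [l60 l61 l62 l63 l64] := L6.
apply: (@runs_seq _ _ _ _ _ _ _ (fun s' => s' = set_ireg s6 9 (2 * N - 1))).
  apply: runs_weaken (wp_runs (Q := fun s' => s' = set_ireg s6 9 (2 * N - 1)) _) _ _ => //.
  by rewrite /= l62 -/N; split=> [|v ->//]; clear -mb1; lia.
move=> s7 ->.
have MF : 2 * N + F <= M by clear -HM nmle nm0; rewrite /N /F; lia.
apply: (runs_seq (runs_build MF _ _ _)); rewrite //= => s8 [[/= f1 f2 f3] f4 tr].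
have g x : x < 20 -> x != 9 -> ireg s8 x = ireg s6 x.
  by move=> xl /negbTE x9; have := f2 x xl; rewrite x9.
apply: (@runs_seq _ _ _ _ _ _ _ (sweep_inv n m (event_key S P o) (point_start S P o) N.+1)).
  apply: runs_weaken (wp_runs (Q := sweep_inv n m (event_key S P o) (point_start S P o) N.+1) _) _ _ => //.
  have v13 : ireg s8 13 < M.
    by rewrite g // r13; apply: leq_ltn_trans mb4; exact: sum_bool_le.
  rewrite /= => v1 -> v0 ->; split=> [|v14 ->]; first by clear -mb1; lia.
  split=> // v12 ->.
  have p0 : (0 < 2 * pi :> R)%R by rewrite mulr_gt0 // pi_gt0.
  have par0 k : parity_upto n (m * 6) is_toggle (point_start S P o) pred0 k = point_start S P o k.
    by rewrite /parity_upto big1 ?addbF // => j _; rewrite !andbF.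
  have mk0 k : marked_at n (m * 6) is_toggle (event_key S P o) pred0 0%R k = false.
    by apply/hasPn => j _; rewrite /= !andbF.
  (* No event has been processed: the parities are the start bits, and the contact times -1 precede
     the time 0. *)
  exists pred0; split=> //=; last first.
    by rewrite p0 sum_nat_const_nat subn0 muln1.
  split=> //=.
  - by split; rewrite /= g.
  - by move=> j jN; rewrite -k6 // /keys /= f1.
  - by rewrite lexx ltW.
  - by move=> j jN _; case/andP: (event_key_range j).
  - by move=> k kn; rewrite f4 ?leq_addr // par0 b6.
  - by move=> k kn; rewrite f1 la6 // mk0 ltrN10.
  - by move=> k kn; rewrite f1 la6 // lerN10.
  - by rewrite g // r13; apply: eq_bigr => k _; rewrite par0.
  - by rewrite g // r13; apply: eq_bigr => k _; rewrite par0 mk0 orbF.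
  - by rewrite lexx.
  - by move=> phi /andP[p1 p2]; have := le_lt_trans p1 p2; rewrite ltxx.
move=> s9 I9.
apply: runs_weaken (runs_sweep n0 m0 HM event_key_range hd I9) _ _ => //.
move=> s' [D core cur]; split; first exact: (sc_out core).
move=> phi hphi; apply: leq_trans (sc_best_le core); apply: (sc_best core).
by rewrite cur.
Qed.

End Program.

(** * From the binary to the natural logarithm *)

Section Bounds.
Local Open Scope nat_scope.

(** Since [1], [n], [n * m] and [d] are all at most [n * m * d], the constants of the phases can be
    added up; [100 * 100] leaves a margin, and the cost of an event stays symbolic. *)
Lemma total_time_le n m d : 0 < n -> 0 < m -> 0 < d ->
  total_time n m d <= (100 * 100 + cmd_cost event_code) * (n * m * d).
Proof.
move=> n0 m0 d0; rewrite /total_time; move: (cmd_cost event_code) => e.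
have [X0 nX _ _] := sizes n0 m0; move: (n * m) X0 nX => X X0 nX.
have XX : X <= X * d by rewrite leq_pmulr.
have -> : X * (e + 8) = X * e + X * 8 by rewrite mulnDr.
have -> : (6 * X).+1 * (d * 100 + 1000) = 600 * (X * d) + 6 * (1000 * X) + d * 100 + 1000 by rewrite -addn1; ring.
have dX : d <= X * d by rewrite leq_pmull.
have ee : X * e <= e * (X * d) by rewrite mulnC leq_mul2l XX orbT.
rewrite mulnDl -(mulnA 100 100); move: (X * d) (X * e) (e * (X * d)) XX ee dX X0 nX => y z w; clear; lia.
Qed.

(** Write [up_log 2 (12 * X)] as [d + 1]. Then [2 ^ d < 12 * X <= X ^ 4], because [12 <= 3 ^ 3], and
    [1 / 2 <= ln 2] gives [d <= 8 * ln X]. The remaining 1 is at most [2 * ln X]. *)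
Lemma up_log_le_ln (R : realType) X : 3 <= X -> ((up_log 2 (12 * X))%:R <= 10 * ln X%:R :> R)%R.
Proof.
move=> X3; have X12 : 1 < 12 * X by lia.
have := @up_log_gtn 2 _ isT X12; have := up_log_gt0 2 (12 * X); rewrite X12 /=.
case: (up_log 2 (12 * X)) => // d _ /= dX.
have {}dX : 2 ^ d <= X ^ 4.
  apply: leq_trans (ltnW dX) _; rewrite expnS mulnC leq_mul2l; apply/orP; right.
  by apply: leq_trans (_ : 3 ^ 3 <= _); rewrite ?leq_exp2r.
(* From [ln (1 + x) <= x] at [x = - 2^-1]. *)
have ln2 : (2^-1 <= ln 2 :> R)%R.
  have := @le_ln1Dx R (- 2^-1)%R; have -> : (1 + - 2^-1 = 2^-1 :> R)%R by field.
  rewrite lnV ?posrE ?ltr0n // => h; have {}h := h _; lra.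
have lnX : (ln 2 <= ln X%:R :> R)%R by rewrite ler_ln ?posrE ?ltr0n ?ler_nat; lia.
have : (ln (2 ^ d)%:R <= ln (X ^ 4)%:R :> R)%R.
  by rewrite ler_ln ?posrE ?ltr0n ?ler_nat ?expn_gt0 //; lia.
rewrite !natrX !lnXn ?ltr0n //; last by lia.
rewrite -[(ln 2 *+ d)%R]mulr_natr -addn1 natrD => h.
have hd : (d%:R * 2^-1 <= ln (2 : R) * d%:R)%R by rewrite mulrC ler_wpM2r // ler0n.
lra.
Qed.

Lemma inputs_of_input (R : realType) n m (S : n.-tuple (R * R)) (P : m.-tuple (R * R)) o s :
  fixed_mcr_input S P o s -> inputs S P o s.
Proof.
move=> [_ _ h]; rewrite !size_cat !size_tuple /= in h.
have {}h k : k < n + (m + 1) -> rmem s (2 * k) = (nth 0%R (S ++ P ++ [:: o]) k).1 /\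
    rmem s (2 * k + 1) = (nth 0%R (S ++ P ++ [:: o]) k).2.
  by move=> kn; rewrite mul2n [k.*2 + 1]addn1; exact: h.
split=> [k kn|i im|].
- by have := h k; rewrite nth_cat size_tuple kn; apply; lia.
- have := h (n + i); rewrite nth_cat size_tuple [n + i < n]ltnNge leq_addr /= addKn nth_cat size_tuple im; apply; lia.
- have := h (n + m); rewrite nth_cat size_tuple [n + m < n]ltnNge leq_addr /= addKn nth_cat size_tuple ltnn subnn /=.
  by apply; lia.
Qed.

End Bounds.

Theorem theorem5 (R : realType) :
  exists (p : cmd) (C : nat),
    forall (n m : nat) (S : n.-tuple (R * R)) (P : m.-tuple (R * R))
           (r : R * R) (s : state R),
      (1 <= n)%N -> (3 <= m)%N -> uniq S -> simple_polygon P ->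
      fixed_mcr_input S P r s ->
      exists (t : nat) (s' : state R),
        [/\ exec (C * (n * m))%N p s t s',
            t%:R <= C%:R * ((n * m)%N%:R * ln (n * m)%N%:R) :> R &
            fixed_mcr_solution S P r (output s')].
Proof.
pose K := (100 * 100 + cmd_cost event_code)%N.
(* The factor 10 comes from [up_log_le_ln]; the same constant bounds the memory, as
   [20 <= 10 * K]. *)
exists fixed_mcr_program, (10 * K)%N => n m S P o s n0 m3 _ simple input.
have m0 : (0 < m)%N by exact: leq_trans m3.
have X3 : (3 <= n * m)%N by exact: (@leq_mul 1 3).
have [l0 l1 _] := input.
have K2 : (20 <= 10 * K)%N by rewrite /K; move: (cmd_cost event_code) => e; lia.
have HM : (20 * (n * m) <= 10 * K * (n * m))%N by rewrite leq_mul2r K2 orbT.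
have hd : (2 * (6 * (n * m)) <= 2 ^ up_log 2 (12 * (n * m)))%N by rewrite mulnA up_logP.
have d0 : (0 < up_log 2 (12 * (n * m)))%N by rewrite up_log_gt0 /=; lia.
have [t [s' [run time [range best]]]] := runs_program n0 m0 HM hd l0 l1 (inputs_of_input input).
exists t, s'; split=> //; last exact: value_solution.
have le : (t%:R <= (K * (n * m * up_log 2 (12 * (n * m))))%:R :> R).
  by rewrite ler_nat; apply: leq_trans time _; exact: total_time_le.
apply: (le_trans le); rewrite [(10 * K)%N]mulnC mulnA !(natrM _ (_ * _)%N) [(K * 10)%:R]natrM -!mulrA.
rewrite [(K * (n * m))%:R]natrM -mulrA !ler_wpM2l ?ler0n // mulrCA.
by rewrite ler_wpM2l ?ler0n // up_log_le_ln.
Qed.
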